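(* Fix $h\in\mathbb R^d$, $h\neq0$ (arbitrary), and consider testing $H_0:\Delta=0$ versus $H_1:\Delta=N^{-1/2}h$, where $f_2(\cdot)=f_1(\cdot-\Delta)$, with $m/N\to\lambda\in(0,1)$. Assume $\frac1N\sum_{i=1}^N\delta_{h_i^d}\xrightarrow{w}\nu$ and $\limsup_{N\to\infty}\frac1N\sum_{i=1}^N\|J(h_i^d)\|^2\le\int\|J(z)\|^2\,d\nu(z)$. Then the following hold. (1) If $\nu=\mathcal N(0,I_d)$ and $J(x)=(\Phi(x_1),\dots,\Phi(x_d))$ for $x=(x_1,\dots,x_d)$ (so the effective reference distribution is $\mathrm{Unif}[0,1]^d$), then $$\inf_{\mathcal F_{\mathrm{ind}}}\mathrm{ARE}(T^{\nu,J},T)\ge\frac{108}{125}=0.864 .$$ Further, equality (that is, $\mathrm{ARE}(T^{\nu,J},T)=108/125$) holds if and only if the $i$-th component of $X$ has density of the form $$f_i(x)=\frac{3}{20\sqrt5\,\sigma_i^3}\big(5\sigma_i^2-(x-\theta_i)^2\big)\mathbf 1\{|x-\theta_i|\le\sqrt5\,\sigma_i\}$$ for all $i\in\{1,\dots,d\}$, where $\sigma_1,\dots,\sigma_d>0$. The same conclusion also holds if $\nu=\mathrm{Unif}[0,1]^d$ and $J(x)=x$. (2) If $\nu=\mathcal N(0,I_d)$ and $J(x)=x$ (so the effective reference distribution is $\mathcal N(0,I_d)$), then $$\inf_{\mathcal F_{\mathrm{ind}}}\mathrm{ARE}(T^{\nu,J},T)\ge1 .$$ Further, equality (that is, $\mathrm{ARE}(T^{\nu,J},T)=1$)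 holds if and only if $X\sim\mathcal N(\theta,D)$, where $D$ is a diagonal matrix with strictly positive entries.
   Context: $X_1,\dots,X_m$ i.i.d. with density $f_1$ and $Y_1,\dots,Y_n$ i.i.d. with density $f_2$ on $\mathbb R^d$, independent samples; $N=m+n$; $Z_1,\dots,Z_N$ is the pooled sample. $\{h_1^d,\dots,h_N^d\}\subset\mathbb R^d$ is a fixed set of $N$ vectors for each $N$. Empirical ranks: $\widehat R_{m,n}(Z_i):=h^d_{\widehat\sigma_i}$ with $\widehat\sigma\in\arg\min_{\sigma\in S_N}\sum_i\|Z_i-h^d_{\sigma_i}\|^2$ ($S_N$ = permutations of $\{1,\dots,N\}$). $\nu$ is the reference distribution, $J:\mathbb R^d\to\mathbb R^d$ the score function, and $\Sigma_{\mathrm{ERD}}$ the covariance matrix of the effective reference distribution $J\#\nu$ (the push-forward of $\nu$ by $J$). The rank Hotelling statistic is $T^{\nu,J}_{m,n}=\frac{mn}{m+n}V^\top\Sigma_{\mathrm{ERD}}^{-1}V$ with $V=\frac1m\sum_iJ(\widehat R_{m,n}(X_i))-\frac1n\sum_jJ(\widehat R_{m,n}(Y_j))$. The Hotelling statistic is $T_{m,n}=\frac{mn}{m+n}(\bar X-\bar Y)^\top S_{m,n}^{-1}(\bar X-\bar Y)$, $S_{m,n}$ the pooled sample covariance matrix. Location family: $f_1=f(\cdot|\theta_0)$ where $f(x|\theta)$, $\theta\in\Theta\subseteq\mathbb R^d$, is a location family; $\eta(x,\theta):=\nabla_\theta f(x|\theta)/f(x|\theta)$. Standing regularity: the family is quadratic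 mean differentiable at $\theta_0$, $\mathbb E_{\theta_0}\|\eta(X,\theta_0)\|^2<\infty$, and the Fisher information $\mathbb E_{\theta_0}[\eta(X,\theta_0)\eta(X,\theta_0)^\top]$ exists and is invertible. $\mathrm{ARE}(T^{\nu,J},T)$ is the asymptotic (Pitman) relative efficiency of the test based on $T^{\nu,J}_{m,n}$ with respect to the Hotelling $T^2$ test (limit of the ratio of the sample size needed by the latter to that needed by the former to reach the same power at the same level). As both statistics have noncentral $\chi^2_d$ limits under these alternatives, it is the ratio of noncentrality parameters: $$\mathrm{ARE}(T^{\nu,J},T)=\frac{\big\|\Sigma_{\mathrm{ERD}}^{-1/2}\,\mathbb E_{H_0}[J(R^\nu_{H_0}(X))\,h^\top\eta(X,\theta_0)]\big\|^2}{\big\|(\mathbb E_{H_0}[(X-\mathbb EX)(X-\mathbb EX)^\top])^{-1/2}\,\mathbb E_{H_0}[X\,h^\top\eta(X,\theta_0)]\big\|^2},$$ where $X\sim f_1$ and $R^\nu_{H_0}$ is the a.e. unique gradient of a convex function pushing the law of $X$ forward to $\nu$; its value is $+\infty$ when some component of $X$ has infinite variance. $\mathcal F_{\mathrm{ind}}$ is the class of $d$-dimensional product distributions each of whose components belongs to a Lebesgue absolutely continuous location family: densities $\prod_{i=1}^d\tilde f_i(z_i-\theta_i)$ with $\tilde f_1,\dots,\tilde f_d$ univariate Lebesgue densities and $\theta=(\theta_1,\dots,\theta_d)\in\Theta\subseteq\mathbb R^d$. The infimum is over laws of $X$ in this class. $\Phi$ is the standard normal distribution function.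
   Formalization: In (2), ''equality only if X ~ N(θ,D)'' is stated only for the components with h_i ≠ 0 (all of them when no h_i is 0): for h = e_1, X_1 normal and X_2 logistic, independent, the efficiency is 1 although X is not normal. *)

(* Defs.v *)
From HB Require Import structures.
From mathcomp Require Import all_boot all_order all_algebra.
From mathcomp Require Import all_classical all_reals all_analysis.

Set Implicit Arguments.
Unset Strict Implicit.
Unset Printing Implicit Defensive.

Import Order.TTheory GRing.Theory Num.Theory.
Import numFieldNormedType.Exports.

Local Open Scope classical_set_scope.
Local Open Scope ring_scope.

(* The sigma-algebra generated by the coordinates, i.e. the Borel sets.       *)
Definition measure_rV_display : measure_display. Proof. by []. Qed.

Section measurable_rV.
Context {R : realType} {d : nat}.

Let coors : 'I_d -> 'rV[R]_d -> R := fun i x => x 0 i.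

Let rV_set0 : g_sigma_preimage coors set0.
Proof. exact: sigma_algebra0. Qed.

Let rV_setC A : g_sigma_preimage coors A -> g_sigma_preimage coors (~` A).
Proof. exact: sigma_algebraC. Qed.

Let rV_bigcup (F : _^nat) : (forall i, g_sigma_preimage coors (F i)) ->
  g_sigma_preimage coors (\bigcup_i (F i)).
Proof. exact: sigma_algebra_bigcup. Qed.

HB.instance Definition _ := @isMeasurable.Build measure_rV_display
  'rV[R]_d (g_sigma_preimage coors) rV_set0 rV_setC rV_bigcup.

Lemma measurable_coord (i : 'I_d) :
  measurable_fun [set: 'rV[R]_d] (fun x : 'rV[R]_d => x 0 i).
Proof.
move=> _ Y mY; rewrite setTI; apply: sub_sigma_algebra => /=.
rewrite -bigcup_seq/=; exists i => /=; first by rewrite mem_index_enum.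
by exists Y => //; rewrite setTI.
Qed.

Lemma measurable_fun_coordP d1 (T : measurableType d1) (f : T -> 'rV[R]_d) :
  (forall i, measurable_fun setT (fun t => f t 0 i)) -> measurable_fun setT f.
Proof.
move=> mf _ A mA; rewrite setTI.
suff : g_sigma_preimage coors `<=` [set B | measurable (f @^-1` B)] by apply.
apply: smallest_sub.
  split => /=.
  - by rewrite preimage_set0.
  - by move=> B mB; rewrite setTD -preimage_setC; exact: measurableC.
  - by move=> F mF; rewrite preimage_bigcup; exact: bigcup_measurable.
rewrite -bigcup_seq; apply: bigcup_sub => i _ _ [B mB <-] /=.
have := mf i measurableT B mB; rewrite !setTI.
by rewrite -comp_preimage.
Qed.

End measurable_rV.

Section lebesgue_rV.
Context {R : realType}.

Definition cons_rV d (x : measurableTypeR R * 'rV[R]_d) : 'rV[R]_d.+1 :=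
  row_mx (x.1)%:M x.2 : 'rV[R]_(1 + d).

Lemma measurable_cons_rV d : measurable_fun setT (@cons_rV d).
Proof.
apply: measurable_fun_coordP => i.
have [->|[j ->]] : i = 0 \/ exists j, i = lift 0 j.
  by case: (unliftP 0 i) => [j ->|->]; [right; exists j|left].
- rewrite (_ : (fun _ => _) = fst) //; apply/funext => x.
  have -> : 0 = lshift d (0 : 'I_1) :> 'I_(1 + d) by exact: val_inj.
  by rewrite [LHS]row_mxEl mxE eqxx mulr1n.
- rewrite (_ : (fun _ => _) = (fun y : 'rV[R]_d => y 0 j) \o snd).
    by apply: measurableT_comp => //; exact: measurable_coord.
  apply/funext => x /=.
  have -> : lift 0 j = rshift 1 j :> 'I_(1 + d) by exact: val_inj.
  by rewrite [LHS]row_mxEr.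
Qed.

Section cons_measure.
Context {d : nat} (mu : {measure set 'rV[R]_d -> \bar R}).

Definition cons_measure : set 'rV[R]_d.+1 -> \bar R :=
  pushforward (lebesgue_measure \x^ mu)%E (@cons_rV d).

Let cons_measure0 : cons_measure set0 = 0%E.
Proof. by rewrite /cons_measure /pushforward preimage_set0 measure0. Qed.

Let cons_measure_ge0 A : (0 <= cons_measure A)%E.
Proof. by rewrite /cons_measure /pushforward measure_ge0. Qed.

Let cons_measure_sigma_additive : semi_sigma_additive cons_measure.
Proof.
move=> F mF tF mUF; rewrite /cons_measure /pushforward preimage_bigcup.
have mpre B : measurable B -> measurable (@cons_rV d @^-1` B).
  by move=> mB; rewrite -[X in measurable X]setTI; exact: measurable_cons_rV.
apply: measure_semi_sigma_additive.
- by move=> k; exact: mpre.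
- apply/trivIsetP => /= i j _ _ ij; rewrite -preimage_setI.
  by move/trivIsetP : tF => /(_ _ _ _ _ ij) ->//; rewrite preimage_set0.
- by rewrite -preimage_bigcup; exact: mpre.
Qed.

HB.instance Definition _ := isMeasure.Build _ _ _ cons_measure
  cons_measure0 cons_measure_ge0 cons_measure_sigma_additive.

End cons_measure.

Fixpoint lebesgue_rV (d : nat) : {measure set 'rV[R]_d -> \bar R} :=
  match d with
  | 0 => \d_(0 : 'rV[R]_0)
  | d'.+1 => cons_measure (lebesgue_rV d')
  end.

End lebesgue_rV.

Section vectors.
Context {R : realType} {d : nat}.
Implicit Types (u v : 'rV[R]_d) (A : 'M[R]_d).

(* The library norm on 'rV[R]_d is the sup norm; the Euclidean structure is
   spelled out. *)
Definition dot u v : R := \sum_i u 0 i * v 0 i.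

Definition sqnorm v : R := dot v v.

(* A^{-1/2}, for A symmetric positive definite (0 if there is no root). *)
Definition inv_sqrtmx A : 'M[R]_d :=
  xget 0 [set S : 'M[R]_d | [/\ S^T = S,
    (forall v, 0 <= (v *m S *m v^T) 0 0) & S *m S = invmx A]].

Definition grad (g : 'rV[R]_d -> R) (x : 'rV[R]_d) : 'rV[R]_d :=
  \row_i 'D_(delta_mx 0 i) g x.

Definition has_grad (g : 'rV[R]_d -> R) (x : 'rV[R]_d) : Prop :=
  forall i, derivable g x (delta_mx 0 i).

End vectors.

Section laws.
Context {R : realType} {d : nat}.
Implicit Types (P nu : probability 'rV[R]_d R) (f : 'rV[R]_d -> R).

Definition has_density P f : Prop :=
  [/\ measurable_fun setT f, forall x, 0 <= f x &
      forall A, measurable A ->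
        P A = (\int[lebesgue_rV d]_(x in A) (f x)%:E)%E].

Definition std_normal_law P : Prop :=
  has_density P (fun x => \prod_(i < d) normal_pdf 0 1 (x 0 i)).

Definition uniform_law P : Prop :=
  has_density P (fun x => \prod_(i < d) uniform_pdf 0 1 (x 0 i)).

Definition std_normal_cdf (t : R) : R := fine (normal_prob 0 1 `]-oo, t]).

Definition normal_cdf_score (x : 'rV[R]_d) : 'rV[R]_d :=
  \row_i std_normal_cdf (x 0 i).

Definition Evec (mu : set 'rV[R]_d -> \bar R) (g : 'rV[R]_d -> 'rV[R]_d) :
  'rV[R]_d := \row_i fine (\int[mu]_x (g x 0 i)%:E)%E.

Definition covmx (mu : set 'rV[R]_d -> \bar R) : 'M[R]_d :=
  \matrix_(i, j) fine (\int[mu]_x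
    ((x 0 i - Evec mu id 0 i) * (x 0 j - Evec mu id 0 j))%:E)%E.

Definition weak_cvg_to (hd : forall N : nat, 'I_N -> 'rV[R]_d) nu : Prop :=
  forall g : 'rV[R]_d -> R, continuous g -> (exists M, forall x, `|g x| <= M) ->
    (fun N => N%:R^-1 * \sum_(i < N) g (hd N i)) @ \oo
      --> fine (\int[nu]_x (g x)%:E)%E.

(* Convex functions with values in ]-oo, +oo]: a real-valued potential need
   not exist, e.g. for the transport of Unif[0,1] to N(0,1). *)
Definition convex_ereal (psi : 'rV[R]_d -> \bar R) : Prop :=
  (forall x, psi x != -oo%E) /\
  (forall x y (t : R), 0 < t < 1 ->
    (psi (t *: x + (1 - t) *: y)%R <= t%:E * psi x + (1 - t)%:E * psi y)%E).

Definition is_gradient_at (psi : 'rV[R]_d -> \bar R) (x v : 'rV[R]_d) : Prop :=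
  [/\ (\forall y \near x, psi y \is a fin_num),
      differentiable (fine \o psi) x & grad (fine \o psi) x = v].

Definition is_rank_map P nu (T : 'rV[R]_d -> 'rV[R]_d) : Prop :=
  [/\ measurable_fun setT T,
      forall B, measurable B -> pushforward P T B = nu B &
      exists2 psi, convex_ereal psi &
        {ae P, forall x, is_gradient_at psi x (T x)}].

Definition rank_map P nu : 'rV[R]_d -> 'rV[R]_d :=
  xget (fun=> 0) [set T | is_rank_map P nu T].

Definition rank_noncentrality P nu (J : 'rV[R]_d -> 'rV[R]_d)
    (h : 'rV[R]_d) (eta : 'rV[R]_d -> 'rV[R]_d) : R :=
  sqnorm (Evec P (fun x => dot h (eta x) *: J (rank_map P nu x))
          *m inv_sqrtmx (covmx (pushforward nu J))).

Definition hotelling_noncentrality P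
    (h : 'rV[R]_d) (eta : 'rV[R]_d -> 'rV[R]_d) : R :=
  sqnorm (Evec P (fun x => dot h (eta x) *: x) *m inv_sqrtmx (covmx P)).

Definition finite_variances P : Prop :=
  forall i, (\int[P]_x ((x 0 i) ^+ 2)%:E < +oo)%E.

(* Pitman efficiency of the rank Hotelling test with respect to the Hotelling
   test in direction h: both statistics have noncentral chi-squared limits with
   d degrees of freedom, so it is the ratio of the noncentrality parameters.
   For product laws with finite variances, the coordinates i with h 0 i = 0 drop
   out of both parameters. *)
Definition ARE nu (J : 'rV[R]_d -> 'rV[R]_d) (h : 'rV[R]_d)
    P (eta : 'rV[R]_d -> 'rV[R]_d) : \bar R :=
  if `[< finite_variances P >] then
    (rank_noncentrality P nu J h eta / hotelling_noncentrality P h eta)%:E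
  else +oo%E.

End laws.

Section families.
Context {R : realType} {d : nat}.
Implicit Types p : 'rV[R]_d -> 'rV[R]_d -> R.

Definition score p (x theta : 'rV[R]_d) : 'rV[R]_d :=
  (p x theta)^-1 *: grad (p x) theta.

Definition qmd_at p (theta0 : 'rV[R]_d) : Prop :=
  (\int[lebesgue_rV d]_x
     ((Num.sqrt (p x (theta0 + delta)) - Num.sqrt (p x theta0)
       - 2^-1 * dot delta (score p x theta0) * Num.sqrt (p x theta0)) ^+ 2
      / sqnorm delta)%:E)%E @[delta --> (0 : 'rV[R]_d)^'] --> 0%E.

Definition fisher_information p theta0 (P : probability 'rV[R]_d R) : 'M[R]_d :=
  \matrix_(i, j) fine (\int[P]_x
    (score p x theta0 0 i * score p x theta0 0 j)%:E)%E.

Definition is_pdf (f : R -> R) : Prop :=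
  [/\ measurable_fun setT f, forall x, 0 <= f x &
      (\int[lebesgue_measure]_x (f x)%:E = 1)%E].

Definition product_location (f : 'I_d -> R -> R) (x theta : 'rV[R]_d) : R :=
  \prod_(i < d) f i (x 0 i - theta 0 i).

End families.

Record F_ind (R : realType) (d : nat) := {
  base : 'I_d -> R -> R ;
  Theta : set 'rV[R]_d ;
  theta0 : 'rV[R]_d ;
  law : probability 'rV[R]_d R ;
  base_pdf : forall i, is_pdf (base i) ;
  theta0_in : Theta theta0 ;
  law_density : has_density law (product_location base ^~ theta0)
}.

Section class.
Context {R : realType} {d : nat}.
Implicit Types X : F_ind R d.

Definition family X : 'rV[R]_d -> 'rV[R]_d -> R := product_location (base X).

Definition eta X (x : 'rV[R]_d) : 'rV[R]_d := score (family X) x (theta0 X).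

(* grad (family X x) is meaningful at theta0 for almost every x, and the score
   is a random vector. *)
Definition has_score X : Prop :=
  measurable_fun setT (eta X) /\
  {ae law X, forall x, has_grad (family X x) (theta0 X)}.

(* The limit in qmd_at runs over all directions, hence the interior point. *)
Definition regular X : Prop :=
  [/\ (Theta X)° (theta0 X), has_score X,
      qmd_at (family X) (theta0 X),
      (\int[law X]_x (sqnorm (eta X x))%:E < +oo)%E &
      fisher_information (family X) (theta0 X) (law X) \in unitmx].

Definition component_density X (i : 'I_d) (t : R) : R :=
  base X i (t - theta0 X 0 i).

(* Densities are determined up to Lebesgue-null sets. The centre is not
   theta0 X 0 i, because the base density need not be centred. *)
Definition epanechnikov_component X (i : 'I_d) : Prop :=
  exists m s : R, 0 < s /\
    {ae lebesgue_measure, forall t : R, component_density X i t =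
      3 / (20 * Num.sqrt 5 * s ^+ 3) * (5 * s ^+ 2 - (t - m) ^+ 2)
      * (`|t - m| <= Num.sqrt 5 * s)%R%:R}.

Definition normal_component X (i : 'I_d) : Prop :=
  exists m s : R, 0 < s /\
    {ae lebesgue_measure, forall t : R,
      component_density X i t = normal_pdf m s t}.

Definition AREX (nu : probability 'rV[R]_d R) J (h : 'rV[R]_d) X : \bar R :=
  ARE nu J h (law X) (eta X).

End class.

(* Main.v *)
(* All laws involved are products, so the rank map is the coordinatewise
   increasing transport x_i |-> S_i(x_i): it is the gradient of a convex function,
   and uniqueness follows from the equality case of Fenchel's inequality.
   Quadratic mean differentiability gives E[eta_j 1(s < x_i)] = (i == j) c_i(s)
   for almost every s, c_i being the density of x_i, and hence, by Fubini,
   E[eta_j W(x_i)] = (i == j) \int W' c_i for increasing W. Both noncentrality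
   parameters are therefore diagonal,
     ARE = (\sum_i h_i^2 A_i^2 / tau) / (\sum_i h_i^2 / sigma_i^2),
   a weighted mean of the numbers sigma_i^2 A_i^2 / tau, which are bounded one
   coordinate at a time.
   (1) Here tau = 1/12 and A_i = \int c_i^2. If e is the Epanechnikov density with
   the mean and the variance of c_i, then e is the positive part of a quadratic
   polynomial, so \int c_i e >= \int e^2, and \int (c_i - e)^2 >= 0 yields
   A_i >= \int e^2. The Fisher information of an Epanechnikov density is infinite,
   so the two sides of the equivalence are both false for a regular law; the
   value 108/125 is attained at laws that merely have a score.
   (2) Here tau = 1 and A_i = \int c_i^2 / phi(S_i). By AM-GM,
   2 <= sigma_i A_i + B_i / sigma_i, where B_i = \int phi(S_i) = E[x_i S_i(x_i)] is
   at most sigma_i by Cauchy-Schwarz. Equality forces x_i to be an affine function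
   of S_i(x_i), hence normal. *)
Require Import Defs.
From HB Require Import structures.
From mathcomp Require Import all_boot all_order all_algebra.
From mathcomp Require Import all_classical all_reals all_analysis.
From mathcomp Require Import measurable_realfun ring lra.

Set Implicit Arguments.
Unset Strict Implicit.
Unset Printing Implicit Defensive.

Import Order.TTheory GRing.Theory Num.Theory.
Import numFieldNormedType.Exports.

Local Open Scope classical_set_scope.
Local Open Scope ring_scope.

(** Nothing is assumed about the smoothness of the component densities, and the transports and
    potentials are only as regular as monotonicity makes them. In the two bounds differentiation is
    therefore replaced by Fubini's theorem: the score enters only through tail expectations, and c_i
    / phi(S_i) stands for the derivative of S_i because its integrals over intervals are the
    increments of S_i. All that concerns the score passes through [score_property], which is reached
    in two ways. For regular laws, tail probabilities are differentiated under a shift of one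
    coordinate. Laws that merely have a score, such as the Epanechnikov laws, offer no quadratic
    mean expansion; there the pointwise gradient is evaluated from an explicit density. [rank_map]
    is an arbitrary choice among the maps that satisfy its definition, so it must be identified
    almost everywhere before anything is computed: each of two rank maps is tested against the
    potential of the other, which forces equal correlations with x. The constant 108/125 is 12 s^2
    (\int e^2)^2 for an Epanechnikov density e of variance s^2, a number free of the scale. *)

Section linear_algebra.
Context {R : realType} {d : nat}.

(** Any symmetric S with S S = A^-1 gives |v S|^2 = v A^-1 v^T, whichever root [inv_sqrtmx] picks.
    The diagonal root is exhibited to show that the set of roots is inhabited. *)
Lemma sqnorm_mul_inv_sqrtmx (s : 'I_d -> R) (v : 'rV[R]_d) :
  (forall i, 0 < s i) ->
  sqnorm (v *m inv_sqrtmx (diag_mx (\row_i s i))) = \sum_i v 0 i ^+ 2 / s i.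
Proof.
move=> s0.
have dotE (a b : 'rV[R]_d) : dot a b = (a *m b^T) 0 0.
  by rewrite mxE; apply: eq_bigr => i _; rewrite mxE.
set A := diag_mx _.
have Ainv : A *m diag_mx (\row_i (s i)^-1) = 1%:M.
  rewrite /A mulmx_diag; apply/matrixP => i j; rewrite !mxE.
  by have [->|//] := eqVneq i j; rewrite divff// gt_eqF.
have Au : A \in unitmx by have [] := mulmx1_unit Ainv.
have -> : \sum_i v 0 i ^+ 2 / s i = (v *m invmx A *m v^T) 0 0.
  have -> : invmx A = diag_mx (\row_i (s i)^-1).
    by rewrite -[RHS]mul1mx -(mulVmx Au) -mulmxA Ainv mulmx1.
  rewrite mul_mx_diag mxE; apply: eq_bigr => i _; rewrite !mxE.
  by rewrite expr2 mulrAC.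
rewrite /sqnorm dotE /inv_sqrtmx.
set P := [set S | _].
have PS : P (diag_mx (\row_i (Num.sqrt (s i))^-1)).
  split.
  - by rewrite tr_diag_mx.
  - move=> w; rewrite mul_mx_diag mxE sumr_ge0// => i _; rewrite !mxE.
    by rewrite mulrAC mulr_ge0// ?invr_ge0 ?sqrtr_ge0// -expr2 sqr_ge0.
  - have -> : invmx A = diag_mx (\row_i (s i)^-1).
      by rewrite -[RHS]mul1mx -(mulVmx Au) -mulmxA Ainv mulmx1.
    rewrite mulmx_diag; congr diag_mx; apply/rowP => i; rewrite !mxE.
    by rewrite -invfM -expr2 sqr_sqrtr// ltW.
have [St _ SS] := xgetPex 0 (ex_intro P _ PS).
by rewrite trmx_mul St -!mulmxA (mulmxA (xget _ _)) SS.
Qed.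

End linear_algebra.

(** * Integration against a density *)

Section integral_density.
Context d (T : measurableType d) (R : realType).
Variables (mu nu : {measure set T -> \bar R}) (f : T -> R).
Hypotheses (mf : measurable_fun setT f) (f0 : forall x, 0 <= f x).
Hypothesis nuE : forall A, measurable A ->
  nu A = (\int[mu]_(x in A) (f x)%:E)%E.

Import HBNNSimple.

Lemma integral_density_indic A : measurable A ->
  (\int[nu]_x (\1_A x)%:E = \int[mu]_x ((\1_A x)%:E * (f x)%:E))%E.
Proof.
move=> mA; rewrite integral_indic// setIT nuE// [LHS]integral_mkcond.
apply: eq_integral => x _; rewrite patchE indicE.
by case: ifPn => xA; rewrite ?mul1e ?mul0e.
Qed.

Lemma integral_density_nnsfun (g : {nnsfun T >-> R}) :
  (\int[nu]_x (g x)%:E = \int[mu]_x ((g x)%:E * (f x)%:E))%E.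
Proof.
under [LHS]eq_integral do rewrite fimfunE -fsumEFin//.
rewrite [LHS]ge0_integral_fsum//; last 2 first.
  - by move=> r; exact/measurable_EFinP/measurableT_comp.
  - by move=> n x _; rewrite EFinM nnfun_muleindic_ge0.
under [RHS]eq_integral.
  move=> x _; rewrite fimfunE -fsumEFin// ge0_mule_fsuml; last first.
    by move=> r; rewrite EFinM nnfun_muleindic_ge0.
  over.
rewrite [RHS]ge0_integral_fsum//; last 2 first.
  - move=> r; apply: emeasurable_funM; last exact/measurable_EFinP.
    exact/measurable_EFinP/measurableT_comp.
  - by move=> n x _; rewrite mule_ge0// ?lee_fin//; exact: nnfun_muleindic_ge0.
apply: eq_fsbigr => r _.
rewrite integralZl_indic_nnsfun//= integral_density_indic//.
have [r0|r0] := ltP r 0.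
  rewrite preimage_nnfun0// indic0.
  under eq_integral do rewrite mul0e.
  under [RHS]eq_integral do rewrite mulr0 mul0e.
  by rewrite integral0 mule0.
rewrite -ge0_integralZl//; last 2 first.
  - apply: emeasurable_funM; apply/measurable_EFinP => //.
  - by move=> x _; rewrite mule_ge0// lee_fin.
by apply: eq_integral => x _; rewrite muleA -EFinM.
Qed.

(** Monotone approximation by simple functions reduces the claim to indicators, where it is the
    hypothesis on nu. *)
Lemma ge0_integral_density (g : T -> \bar R) : measurable_fun setT g ->
  (forall x, 0 <= g x)%E ->
  (\int[nu]_x g x = \int[mu]_x (g x * (f x)%:E))%E.
Proof.
move=> mg g0.
pose g_ := nnsfun_approx measurableT mg.
have g_nd x : {homo (fun n => g_ n x) : a b / (a <= b)%N >-> a <= b}.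
  by move=> a b ab; exact/lefP/nd_nnsfun_approx.
transitivity (limn (fun n => \int[nu]_x (g_ n x)%:E)%E).
  rewrite -monotone_convergence//=.
  - apply: eq_integral => x _; apply/esym/cvg_lim => //=.
    exact: cvg_nnsfun_approx.
  - by move=> n; exact/measurable_EFinP/measurable_funTS.
  - by move=> n ? _; rewrite lee_fin.
  - by move=> x _ a b ab; rewrite lee_fin g_nd.
transitivity (limn (fun n => \int[mu]_x ((g_ n x)%:E * (f x)%:E))%E).
  by congr (limn _); apply/funext => n; rewrite integral_density_nnsfun.
rewrite -monotone_convergence//=.
- apply: eq_integral => x _; apply/cvg_lim => //=.
  under eq_fun do rewrite muleC.
  rewrite muleC; apply: cvgeZl => //.
  exact: cvg_nnsfun_approx.
- by move=> n; apply: emeasurable_funM; exact/measurable_EFinP.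
- by move=> n x _; rewrite mule_ge0// lee_fin.
- by move=> x _ a b ab; rewrite lee_pmul ?lee_fin// g_nd.
Qed.

Lemma integrable_density (g : T -> R) : measurable_fun setT g ->
  nu.-integrable setT (EFin \o g) <->
  mu.-integrable setT (fun x => (g x * f x)%:E).
Proof.
move=> mg.
have E : (\int[nu]_x `|(g x)%:E| = \int[mu]_x `|(g x * f x)%:E|)%E.
  rewrite ge0_integral_density//; last first.
    by apply: measurableT_comp => //; exact/measurable_EFinP.
  by apply: eq_integral => x _; rewrite EFinM abseM [in RHS](gee0_abs (_ : 0 <= (f x)%:E)%E)// lee_fin.
split => /integrableP[_ ?]; apply/integrableP; split; rewrite ?E//.
- by apply/measurable_EFinP/measurable_funM.
- by rewrite -E.
- exact/measurable_EFinP.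
Qed.

(** Multiplication by f >= 0 commutes with positive and negative parts, so the two sides agree part
    by part, also where g is not integrable. *)
Lemma integral_density (g : T -> R) : measurable_fun setT g ->
  (\int[nu]_x (g x)%:E = \int[mu]_x (g x * f x)%:E)%E.
Proof.
move=> mg; rewrite [LHS]integralE [RHS]integralE.
congr (_ - _)%E; rewrite ge0_integral_density//.
- by apply: eq_integral => x _; rewrite !funeposE/= EFinM -[in RHS](mul0e (f x)%:E) maxe_pMl ?lee_fin.
- exact/measurable_funepos/measurable_EFinP.
- apply: eq_integral => x _; rewrite !funenegE/= -[in RHS](mul0e (f x)%:E).
  by rewrite -mulNr EFinM maxe_pMl ?lee_fin.
- exact/measurable_funeneg/measurable_EFinP.
Qed.

End integral_density.

Section sigma_finite_of.
Context d (T : measurableType d) (R : realType) (mu : {measure set T -> \bar R}).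

(* lebesgue_rV is declared as a mere measure; Fubini's theorem needs a
   sigma-finite instance, which is attached to this alias. *)
Definition sigma_finite_of (H : sigma_finite setT mu) : set T -> \bar R := mu.

Variable H : sigma_finite setT mu.

HB.instance Definition _ := Measure.copy (sigma_finite_of H) mu.

HB.instance Definition _ :=
  Measure_isSigmaFinite.Build _ _ _ (sigma_finite_of H) H.

End sigma_finite_of.

(** * Lebesgue measure on row vectors and product laws *)

Section lebesgue_rV_prod.
Context {R : realType}.

Lemma ge0_integral_cons_rV d (mu : {sigma_finite_measure set 'rV[R]_d -> \bar R})
    (f : 'rV[R]_d.+1 -> \bar R) : measurable_fun setT f ->
  (forall x, 0 <= f x)%E ->
  (\int[cons_measure mu]_x f x =
   \int[lebesgue_measure]_t \int[mu]_x f (cons_rV (t, x)))%E.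
Proof.
move=> mf f0.
transitivity (\int[lebesgue_measure \x^ mu]_z f (cons_rV z))%E.
  rewrite -[RHS](ge0_integral_pushforward (@measurable_cons_rV R d) (lebesgue_measure \x^ mu)%E (D := setT)) //.
(* [cons_measure] is built on [\x^], which integrates in the other order than [\x]. The two products
   agree on rectangles, hence everywhere, and Tonelli's theorem is applied to the second. *)
transitivity (\int[lebesgue_measure \x mu]_z f (cons_rV z))%E.
  apply: eq_measure_integral => A mA _; apply/esym.
  by apply: product_measure_unique => // ? ? ? ?; rewrite /= product_measure2E.
rewrite fubini_tonelli1//.
by apply: measurableT_comp => //; exact: measurable_cons_rV.
Qed.

Definition uncons_rV d (x : 'rV[R]_d.+1) : measurableTypeR R * 'rV[R]_d :=
  (x 0 ord0, \row_j x 0 (lift ord0 j)).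

Lemma measurable_uncons_rV d : measurable_fun setT (@uncons_rV d).
Proof.
apply/measurable_fun_pairP; split; first exact: (measurable_coord ord0).
apply: measurable_fun_coordP => i.
rewrite (_ : (fun _ => _) = (fun x : 'rV[R]_d.+1 => x 0 (lift ord0 i))).
  exact: measurable_coord.
by apply/funext => x /=; rewrite mxE.
Qed.

Lemma cons_rVK d : cancel (@cons_rV R d) (@uncons_rV d).
Proof.
move=> [t x]; rewrite /uncons_rV; congr (_, _).
  rewrite (_ : ord0 = lshift d (0 : 'I_1) :> 'I_(1 + d)); last exact: val_inj.
  by rewrite [LHS]row_mxEl mxE eqxx mulr1n.
apply/rowP => j; rewrite mxE.
rewrite (_ : lift ord0 j = rshift 1 j :> 'I_(1 + d)); last exact: val_inj.
by rewrite [LHS]row_mxEr.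
Qed.

Lemma cons_rV_0 d z : @cons_rV R d z 0 ord0 = z.1.
Proof. by have := cons_rVK z => /(congr1 fst). Qed.

Lemma cons_rV_lift d z j : @cons_rV R d z 0 (lift ord0 j) = z.2 0 j.
Proof. by have := cons_rVK z => /(congr1 snd)/rowP/(_ j); rewrite mxE. Qed.

Lemma sigma_finite_cons_rV d (mu : {sigma_finite_measure set 'rV[R]_d -> \bar R}) :
  sigma_finite setT (cons_measure mu).
Proof.
have /sigma_finiteP[F [FT ndF Foo]] :=
  sigma_finiteT (@lebesgue_measure R : {sigma_finite_measure set _ -> \bar R}).
have /sigma_finiteP[G [GT ndG Goo]] := sigma_finiteT mu.
exists (fun k => @uncons_rV d @^-1` (F k `*` G k)).
  apply/seteqP; split => // x _.
  have [n _ Fn] : (\bigcup_k F k) (uncons_rV x).1 by rewrite -FT.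
  have [k _ Gk] : (\bigcup_k G k) (uncons_rV x).2 by rewrite -GT.
  exists (maxn n k) => //; split.
  - by move: Fn; exact/subsetPset/ndF/leq_maxl.
  - by move: Gk; exact/subsetPset/ndG/leq_maxr.
move=> k; have [mF Fk] := Foo k; have [mG Gk] := Goo k.
have mFG : measurable (F k `*` G k) by exact: measurableX.
split; first by rewrite -[X in measurable X]setTI; exact: measurable_uncons_rV.
rewrite /= /cons_measure /pushforward -comp_preimage.
rewrite (_ : _ \o _ = id) ?preimage_id; last by apply/funext; exact: cons_rVK.
by rewrite /= product_measure2E// lte_mul_pinfty// ge0_fin_numE.
Qed.

Lemma sigma_finite_lebesgue_rV d :
  sigma_finite setT (lebesgue_rV d : {measure set 'rV[R]_d -> \bar R}).
Proof.
elim: d => [|d IH] /=.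
  exists (fun=> setT) => [|i]; first by rewrite bigcup_const.
  by split => //=; rewrite diracT ltry.
exact: (sigma_finite_cons_rV (sigma_finite_of IH)).
Qed.

Definition lebesgue_rV_sigma d : {sigma_finite_measure set 'rV[R]_d -> \bar R} :=
  sigma_finite_of (@sigma_finite_lebesgue_rV d).

Lemma measurable_prod_coord d (u : 'I_d -> R -> R) :
  (forall i, measurable_fun setT (u i)) ->
  measurable_fun setT (fun x : 'rV[R]_d => \prod_i u i (x 0 i)).
Proof.
move=> mu; apply: measurable_prod => i _.
by apply: measurableT_comp => //; exact: measurable_coord.
Qed.

Lemma integral_lebesgue_rV_prod d (u : 'I_d -> R -> R) (I : 'I_d -> R) :
  (forall i, measurable_fun setT (u i)) -> (forall i t, 0 <= u i t) ->
  (forall i, (\int[lebesgue_measure]_t (u i t)%:E = (I i)%:E)%E) ->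
  (\int[lebesgue_rV d]_x (\prod_i u i (x 0 i))%:E = (\prod_i I i)%:E)%E.
Proof.
elim: d u I => [|d IH] u I mu u0 uI.
  rewrite /= integral_dirac// ?diracT ?mul1e ?big_ord0//.
  by apply/measurable_EFinP; have := measurable_prod_coord mu.
transitivity (\int[cons_measure (lebesgue_rV_sigma d)]_x
    (\prod_i u i (x 0 i))%:E)%E => //.
rewrite ge0_integral_cons_rV; last 2 first.
  - by apply/measurable_EFinP; have := measurable_prod_coord mu.
  - by move=> x; rewrite lee_fin prodr_ge0.
transitivity (\int[lebesgue_measure]_t
    ((u ord0 t)%:E * (\prod_i I (lift ord0 i))%:E))%E; last first.
  rewrite ge0_integralZr//.
  - by rewrite uI big_ord_recl EFinM.
  - by apply/measurable_EFinP; exact: (mu ord0).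
  - by move=> t _; rewrite lee_fin.
  - rewrite lee_fin prodr_ge0// => i _.
    by rewrite -lee_fin -uI integral_ge0// => t _; rewrite lee_fin.
apply: eq_integral => t _.
transitivity (\int[lebesgue_rV d]_x
    ((u ord0 t)%:E * (\prod_i u (lift ord0 i) (x 0 i))%:E))%E.
  apply: eq_integral => x _; rewrite big_ord_recl EFinM cons_rV_0.
  by congr (_ * _%:E)%E; apply: eq_bigr => i _; rewrite cons_rV_lift.
rewrite ge0_integralZl//.
- by rewrite (IH (fun i => u (lift ord0 i)) (fun i => I (lift ord0 i))).
- by apply/measurable_EFinP; have := measurable_prod_coord (fun i => mu (lift ord0 i)).
- by move=> x _; rewrite lee_fin prodr_ge0.
- by rewrite lee_fin.
Qed.

End lebesgue_rV_prod.

Section lebesgue_shift.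
Context {R : realType}.
Notation mu := (@lebesgue_measure R).

Definition shiftR (a : R) (t : measurableTypeR R) : measurableTypeR R := t - a.

Let measurable_shiftR a : measurable_fun setT (shiftR a).
Proof. exact: measurable_funB. Qed.

HB.instance Definition _ a :=
  isMeasurableFun.Build _ _ _ _ (shiftR a) (measurable_shiftR a).

Lemma lebesgue_measure_shift (a : R) (A : set (measurableTypeR R)) : measurable A ->
  pushforward mu (shiftR a) A = mu A.
Proof.
move=> mA; apply/esym; apply: (lebesgue_measure_unique (mu := pushforward mu (shiftR a))) => //= _ [[x y]] _ <-.
rewrite /pushforward (_ : _ @^-1` _ = `]x + a, y + a]%classic); last first.
  by apply/seteqP; split => t /=; rewrite !in_itv/= ltrBrDr lerBlDr.
rewrite !lebesgue_measure_itv/= !lte_fin ltrD2r; case: ifPn => // _.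
by rewrite -!EFinB; congr EFin; ring.
Qed.

Lemma ge0_integral_shift (a : R) (f : R -> \bar R) : measurable_fun setT f ->
  (forall t, 0 <= f t)%E -> (\int[mu]_t f (t - a)%R = \int[mu]_t f t)%E.
Proof.
move=> mf f0.
transitivity (\int[pushforward mu (shiftR a)]_t f t)%E.
  by rewrite ge0_integral_pushforward//; exact: measurable_shiftR.
by apply: eq_measure_integral => //= A mA AS; exact/lebesgue_measure_shift.
Qed.

Lemma is_pdf_shift (f : R -> R) a : is_pdf f -> is_pdf (fun t => f (t - a)).
Proof.
move=> [mf f0 f1]; split => //.
- by apply: measurableT_comp => //; exact: measurable_funB.
- rewrite (@ge0_integral_shift a (EFin \o f))//.
  exact/measurable_EFinP.
Qed.

End lebesgue_shift.

Section rV_measure.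
Context {R : realType} {d : nat}.

Lemma measurable_rect (A : 'I_d -> set R) : (forall i, measurable (A i)) ->
  measurable [set x : 'rV[R]_d | forall i, A i (x 0 i)].
Proof.
move=> mA.
rewrite (_ : [set x | _] = \bigcap_(i in [set` finset.setT]) [set x : 'rV[R]_d | A i (x 0 i)]).
  apply: fin_bigcap_measurable => // i _.
  by rewrite -[X in measurable X]setTI; exact: measurable_coord.
apply/seteqP; split => [x Ax i _|x Ax i]; first exact: Ax.
by apply: Ax => /=; rewrite finset.in_setT.
Qed.

(** Rectangles are stable under intersection and generate the sigma-algebra of the coordinates: the
    preimage of a set under one coordinate is a rectangle whose other sides are [setT]. *)
Lemma rV_measure_unique (m1 m2 : {measure set 'rV[R]_d -> \bar R}) :
  (forall A : 'I_d -> set R, (forall i, measurable (A i)) ->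
    m1 [set x | forall i, A i (x 0 i)] = m2 [set x | forall i, A i (x 0 i)]) ->
  (m1 setT < +oo)%E ->
  forall B, measurable B -> m1 B = m2 B.
Proof.
move=> m12 m1oo B mB.
pose G := [set [set x : 'rV[R]_d | forall i, A i (x 0 i)] | A in
   [set A : 'I_d -> set R | forall i, measurable (A i)]].
have GT : G setT.
  by exists (fun=> setT) => //; apply/seteqP; split.
apply: (@g_sigma_algebra_measure_unique _ _ _ G _ (fun=> setT)) => //.
- by move=> _ [A mA <-]; exact: measurable_rect.
- by rewrite bigcup_const.
- move=> _ _ [A mA <-] [C mC <-]; exists (fun i => A i `&` C i).
    by move=> i; exact: measurableI.
  apply/seteqP; split => [x AC|x [Ax Cx] i]; last by split.
  by split => i; have [] := AC i.
- by move=> _ [A mA <-]; exact: m12.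
- move: B mB; apply: smallest_sub; first exact: smallest_sigma_algebra.
  rewrite -bigcup_seq; apply: bigcup_sub => i _ _ [A mA <-] /=.
  apply: sub_sigma_algebra; exists (fun j => if j == i then A else setT).
    by move=> j; case: ifP.
  rewrite setTI; apply/seteqP; split => [x /(_ i)|x Ax j]; first by rewrite eqxx.
  by case: eqP => [->|].
Qed.

Definition coord (i : 'I_d) (x : 'rV[R]_d) : measurableTypeR R := x 0 i.

Lemma measurable_coordf i : measurable_fun setT (coord i).
Proof. exact: measurable_coord. Qed.

HB.instance Definition _ i := isMeasurableFun.Build _ _ _ _ (coord i) (@measurable_coordf i).

End rV_measure.

Section product_law.
Context {R : realType} {d : nat}.
Notation mu := (@lebesgue_measure R).

Definition product_law (P : probability 'rV[R]_d R) (c : 'I_d -> R -> R) : Prop :=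
  (forall i, is_pdf (c i)) /\ has_density P (fun x => \prod_i c i (x 0 i)).

Variables (P : probability 'rV[R]_d R) (c : 'I_d -> R -> R).
Hypothesis Pc : product_law P c.

Let mc i : measurable_fun setT (c i). Proof. by have [/(_ i)[]] := Pc. Qed.
Let c0 i t : 0 <= c i t. Proof. by have [/(_ i)[]] := Pc. Qed.
Let c1 i : (\int[mu]_t (c i t)%:E = 1)%E. Proof. by have [/(_ i)[]] := Pc. Qed.

Lemma pdf_integral_fin_num i A : measurable A ->
  (\int[mu]_(t in A) (c i t)%:E \is a fin_num)%E.
Proof.
move=> mA; rewrite ge0_fin_numE; last by apply: integral_ge0 => t _; rewrite lee_fin.
apply: (@le_lt_trans _ _ (\int[mu]_t (c i t)%:E)%E); last by rewrite c1 ltry.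
apply: ge0_subset_integral => //; first by apply/measurable_EFinP; exact: mc.
by move=> t _; rewrite lee_fin.
Qed.

Lemma product_law_rect (A : 'I_d -> set R) : (forall i, measurable (A i)) ->
  P [set x | forall i, A i (x 0 i)] =
  (\prod_i fine (\int[mu]_(t in A i) (c i t)%:E))%:E.
Proof.
move=> mA; have [_ [_ _ PE]] := Pc; rewrite PE; last exact: measurable_rect.
rewrite -(@integral_lebesgue_rV_prod _ _ (fun i t => c i t * \1_(A i) t)).
- rewrite [LHS]integral_mkcond; apply: eq_integral => x _.
  rewrite patchE big_split/=; case: ifPn => [|] xA.
    rewrite [X in _ * X]big1 ?mulr1// => i _; rewrite indicE mem_set//.
    by move: xA; rewrite inE; exact.
  have [i Ai] : exists i, ~ A i (x 0 i).
    by apply/existsNP => Ax; move/negP: xA; apply; rewrite inE.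
  by rewrite [X in _ * X](bigD1 i)//= indicE memNset// mul0r mulr0.
- by move=> i; apply: measurable_funM => //; exact: measurable_indic.
- by move=> i t; rewrite mulr_ge0.
- move=> i; rewrite fineK; last by have := pdf_integral_fin_num i (mA i).
  rewrite [RHS]integral_mkcond.
  apply: eq_integral => t _; rewrite patchE indicE.
  by case: ifPn; rewrite ?mulr1 ?mulr0.
Qed.

Lemma product_law_coord (i : 'I_d) (A : set R) : measurable A ->
  P [set x : 'rV[R]_d | A (x 0 i)] = (\int[mu]_(t in A) (c i t)%:E)%E.
Proof.
move=> mA; rewrite (_ : (fun x => _) = [set x : 'rV[R]_d | A (x 0 i)])//.
have -> : [set x : 'rV[R]_d | A (x 0 i)] =
    [set x | forall j, (if j == i then A else setT) (x 0 j)].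
  apply/seteqP; split => [x Ax j|x /(_ i)]; last by rewrite eqxx.
  by case: eqP => [->|].
rewrite (@product_law_rect (fun j => if j == i then A else setT)); last by move=> j; case: ifP.
rewrite (bigD1 i)//= eqxx big1 => [|j /negbTE ->]; last by rewrite c1.
by rewrite mulr1 fineK ?pdf_integral_fin_num.
Qed.

Lemma product_law_coord2 (i j : 'I_d) (A B : set R) : i != j -> measurable A -> measurable B ->
  P [set x : 'rV[R]_d | A (x 0 i) /\ B (x 0 j)] =
  (P [set x : 'rV[R]_d | A (x 0%R i)] * P [set x : 'rV[R]_d | B (x 0%R j)])%E.
Proof.
move=> ij mA mB; rewrite !product_law_coord//.
have -> : [set x : 'rV[R]_d | A (x 0 i) /\ B (x 0 j)] =
    [set x | forall k, (if k == i then A else if k == j then B else setT) (x 0 k)].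
  apply/seteqP; split => [x [Ax Bx] k|x Hx].
    by case: eqP => [->//|_]; case: eqP => [->|].
  split; first by have := Hx i; rewrite eqxx.
  by have := Hx j; rewrite eq_sym (negbTE ij) eqxx.
rewrite (@product_law_rect (fun k => if k == i then A else if k == j then B else setT)); last first.
  by move=> k; case: ifP => // _; case: ifP.
have ji : j != i by rewrite eq_sym.
rewrite (bigD1 i)//= eqxx (bigD1 j)//= (negbTE ji) eqxx.
rewrite big1 => [|k /andP[/negbTE -> /negbTE ->]]; last by rewrite c1.
by rewrite mulr1 EFinM !fineK ?pdf_integral_fin_num.
Qed.

Definition marginal i : probability (measurableTypeR R) R := distribution P (coord i).

Lemma marginalE i A : measurable A ->
  marginal i A = (\int[mu]_(t in A) (c i t)%:E)%E.
Proof. exact: product_law_coord. Qed.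

Lemma ge0_expectation_coord (i : 'I_d) (u : R -> \bar R) : measurable_fun setT u ->
  (forall t, 0 <= u t)%E ->
  (\int[P]_x u (x 0%R i) = \int[mu]_t (u t * (c i t)%:E))%E.
Proof.
move=> mU u0; rewrite -(ge0_integral_density (nu := marginal i))//.
- by rewrite /marginal ge0_integral_distribution.
- exact: mc.
- by move=> A mA; have := marginalE i mA.
Qed.

Lemma integrable_coord (i : 'I_d) (u : R -> R) : measurable_fun setT u ->
  P.-integrable setT (fun x => (u (x 0 i))%:E) <->
  mu.-integrable setT (fun t => (u t * c i t)%:E).
Proof.
move=> mU; rewrite -(integrable_density (nu := marginal i) (mu := mu))//; [|exact: mc|exact: marginalE].
have E : (\int[P]_x `|(u (x 0 i))%:E| = \int[marginal i]_t `|(u t)%:E|)%E.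
  rewrite /marginal ge0_integral_distribution//.
  by apply: measurableT_comp => //; exact/measurable_EFinP.
split => /integrableP[_ ?]; apply/integrableP; split.
- exact/measurable_EFinP.
- by rewrite -E.
- by apply/measurable_EFinP; apply: measurableT_comp => //; exact: measurable_coord.
- by rewrite E.
Qed.

Lemma expectation_coord (i : 'I_d) (u : R -> R) : measurable_fun setT u ->
  (\int[P]_x (u (x 0 i))%:E = \int[mu]_t (u t * c i t)%:E)%E.
Proof.
move=> mU.
rewrite [LHS]integralE [RHS]integralE; congr (_ - _)%E.
- transitivity (\int[P]_x maxe (u (x 0%R i))%:E 0)%E.
    by apply: eq_integral => x _; rewrite funeposE.
  rewrite (@ge0_expectation_coord i (fun t => maxe (u t)%:E 0%E))//; last 2 first.
  + by apply: measurable_maxe => //; exact/measurable_EFinP.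
  + by move=> t; rewrite le_max lexx orbT.
  by apply: eq_integral => x _; rewrite !funeposE/= EFinM -[in RHS](mul0e (c i x)%:E) maxe_pMl ?lee_fin.
- transitivity (\int[P]_x maxe (- (u (x 0%R i))%:E) 0)%E.
    by apply: eq_integral => x _; rewrite funenegE.
  rewrite (@ge0_expectation_coord i (fun t => maxe (- (u t)%:E)%E 0%E))//; last 2 first.
  + by apply: measurable_maxe => //; apply: measurableT_comp => //; exact/measurable_EFinP.
  + by move=> t; rewrite le_max lexx orbT.
  apply: eq_integral => x _; rewrite !funenegE/= -[in RHS](mul0e (c i x)%:E).
  by rewrite -mulNr EFinM maxe_pMl ?lee_fin.
Qed.

(** The law of a coordinate is absolutely continuous, so a Lebesgue-null set pulls back to a P-null
    set. *)
Lemma coord_ae (i : 'I_d) (Q : R -> Prop) : {ae mu, forall t, Q t} ->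
  {ae P, forall x : 'rV[R]_d, Q (x 0 i)}.
Proof.
move=> [M [mM M0 QM]]; exists [set x : 'rV[R]_d | M (x 0 i)]; split.
- by rewrite -[X in measurable X]setTI; exact: measurable_coord.
- by rewrite product_law_coord// null_set_integral//; apply/measurable_funTS/measurable_EFinP; exact: mc.
- by move=> x /= Qx; exact: QM.
Qed.

Lemma coord_neq_ae (i : 'I_d) (s : R) : {ae P, forall x : 'rV[R]_d, x 0 i != s}.
Proof.
apply: (@coord_ae i (fun t => t != s)); exists [set s]; split => //.
  by rewrite lebesgue_measure_set1.
by move=> t /= /negP/negPn/eqP.
Qed.

Lemma coord_pdf_gt0_ae (i : 'I_d) : {ae P, forall x : 'rV[R]_d, 0 < c i (x 0 i)}.
Proof.
have mM : measurable [set t | c i t = 0].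
  by rewrite -[X in measurable X]setTI; exact: (mc i measurableT (measurable_set1 0)).
exists [set x : 'rV[R]_d | [set t | c i t = 0] (x 0 i)]; split.
- by rewrite -[X in measurable X]setTI; exact: measurable_coord.
- by rewrite product_law_coord//; apply: integral0_eq => t /= ->.
- by move=> x /= /negP; rewrite -leNgt => ?; apply/eqP; rewrite eq_le c0 andbT.
Qed.

(** Two distinct coordinates are independent: their joint law and the product of the marginals agree
    on rectangles. Fubini's theorem on the product then gives integrability and the factorisation at
    once. *)
Lemma expectation_coord2 (i j : 'I_d) (a b : R -> R) : i != j ->
  measurable_fun setT a -> measurable_fun setT b ->
  P.-integrable setT (fun x => (a (x 0 i))%:E) ->
  P.-integrable setT (fun x => (b (x 0 j))%:E) ->
  P.-integrable setT (fun x => (a (x 0 i) * b (x 0 j))%:E) /\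
  (\int[P]_x (a (x 0 i) * b (x 0 j)) = (\int[P]_x a (x 0 i)) * (\int[P]_x b (x 0 j)))%R.
Proof.
move=> ij ma mb ia ib.
pose xy (x : 'rV[R]_d) : measurableTypeR R * measurableTypeR R := (coord i x, coord j x).
have mxy : measurable_fun setT xy by apply: measurable_fun_pair.
pose XY : {mfun 'rV[R]_d >-> (measurableTypeR R * measurableTypeR R)%type} := mfun_Sub (mem_set mxy).
have XYE A : measurable A -> (marginal i \x marginal j)%E A = distribution P XY A.
  apply: product_measure_unique => {}A B mA mB.
  by rewrite /marginal /distribution /pushforward/=; exact: product_law_coord2.
have mab : measurable_fun setT (fun z : measurableTypeR R * measurableTypeR R => a z.1 * b z.2).
  by apply: measurable_funM; apply: measurableT_comp.
have iaM : (marginal i).-integrable setT (EFin \o a).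
  apply: (integrable_pushforward (@measurable_coordf R d i)) => //.
  exact/measurable_EFinP.
have ibM : (marginal j).-integrable setT (EFin \o b).
  apply: (integrable_pushforward (@measurable_coordf R d j)) => //.
  exact/measurable_EFinP.
have Ea : (\int[marginal i]_s (a s)%:E = \int[P]_x (a (x 0 i))%:E)%E.
  by rewrite integral_distribution//; exact/measurable_EFinP.
have Eb : (\int[marginal j]_s (b s)%:E = \int[P]_x (b (x 0 j))%:E)%E.
  by rewrite integral_distribution//; exact/measurable_EFinP.
have iabM : (marginal i \x marginal j)%E.-integrable setT (fun z => (a z.1 * b z.2)%:E).
  apply/integrable12ltyP; first exact/measurable_EFinP.
  under eq_integral => s _.
    under eq_integral => t _ do rewrite /= normrM EFinM.
    rewrite ge0_integralZl//; last first.
      by apply/measurable_EFinP; apply: measurableT_comp.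
    over.
  rewrite ge0_integralZr//.
  - rewrite lte_mul_pinfty//; last by case/integrableP: ibM.
    + exact: integral_ge0.
    + rewrite ge0_fin_numE; last exact: integral_ge0.
      by case/integrableP: iaM.
  - by apply/measurable_EFinP; apply: measurableT_comp.
  - by apply: integral_ge0.
have iab : P.-integrable setT (fun x => (a (x 0 i) * b (x 0 j))%:E).
  apply/integrableP; split.
    by apply/measurable_EFinP; apply: measurable_funM; apply: measurableT_comp => //; exact: measurable_coord.
  case/integrableP: iabM => _; rewrite (eq_measure_integral (distribution P XY)); last first.
    by move=> A mA _; exact: XYE.
  rewrite ge0_integral_distribution//.
  by apply: measurableT_comp => //; exact/measurable_EFinP.
split => //.
rewrite /Rintegral -Ea -Eb.
have -> : (\int[P]_x (a (x 0 i) * b (x 0 j))%:E =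
    \int[marginal i \x marginal j]_z (a z.1 * b z.2)%:E)%E.
  rewrite [RHS](eq_measure_integral (distribution P XY)); last first.
    by move=> A mA _; exact: XYE.
  by rewrite integral_distribution//; exact/measurable_EFinP.
rewrite -integral12_prod_meas1//.
have Efin : (\int[marginal j]_t (b t)%:E \is a fin_num)%E by apply: integrable_fin_num.
have Eafin : (\int[marginal i]_t (a t)%:E \is a fin_num)%E by apply: integrable_fin_num.
rewrite -fineM//; congr fine.
transitivity (\int[marginal i]_s ((a s)%:E * \int[marginal j]_t (b t)%:E))%E.
  apply: eq_integral => s _; rewrite /fubini_F/= -integralZl//.
by rewrite -(fineK Efin) integralZr.
Qed.

End product_law.

Section integrable_real.
Context d (T : measurableType d) (R : realType) (mu : {measure set T -> \bar R}).
Variable D : set T.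
Hypothesis mD : measurable D.
Implicit Types f g : T -> R.

Lemma integrable_realMl f k : mu.-integrable D (fun x => (f x)%:E) ->
  mu.-integrable D (fun x => (k * f x)%:E).
Proof. by move=> fi; under eq_fun do rewrite EFinM; exact: integrableZl. Qed.

Lemma integrable_realMr f k : mu.-integrable D (fun x => (f x)%:E) ->
  mu.-integrable D (fun x => (f x * k)%:E).
Proof. by move=> fi; under eq_fun do rewrite mulrC; exact: integrable_realMl. Qed.

Lemma integrable_realD f g : mu.-integrable D (fun x => (f x)%:E) ->
  mu.-integrable D (fun x => (g x)%:E) -> mu.-integrable D (fun x => (f x + g x)%:E).
Proof. by move=> fi gi; under eq_fun do rewrite EFinD; exact: integrableD. Qed.

Lemma integrable_realB f g : mu.-integrable D (fun x => (f x)%:E) ->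
  mu.-integrable D (fun x => (g x)%:E) -> mu.-integrable D (fun x => (f x - g x)%:E).
Proof. by move=> fi gi; under eq_fun do rewrite EFinB; exact: integrableB. Qed.

Lemma integrable_realN f : mu.-integrable D (fun x => (f x)%:E) ->
  mu.-integrable D (fun x => (- f x)%:E).
Proof. by move=> fi; under eq_fun do rewrite EFinN; exact: integrableN. Qed.

Lemma integrable_sumr (I : Type) (s : seq I) (F : I -> T -> R) :
  (forall i, mu.-integrable D (fun x => (F i x)%:E)) ->
  mu.-integrable D (fun x => (\sum_(i <- s) F i x)%:E).
Proof.
move=> Fi; elim: s => [|i s IH].
  by under eq_fun do rewrite big_nil; exact: integrable0.
by under eq_fun do rewrite big_cons; exact: integrable_realD.
Qed.

Lemma Rintegral_sum (I : Type) (s : seq I) (F : I -> T -> R) :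
  (forall i, mu.-integrable D (fun x => (F i x)%:E)) ->
  \int[mu]_(x in D) (\sum_(i <- s) F i x) = \sum_(i <- s) \int[mu]_(x in D) F i x.
Proof.
move=> Fi; elim: s => [|i s IH].
  under eq_Rintegral do rewrite big_nil.
  by rewrite big_nil /Rintegral integral0.
under eq_Rintegral do rewrite big_cons.
have Fs := integrable_sumr s Fi.
rewrite RintegralD//.
  by rewrite big_cons IH.
exact: Fi.
Qed.

Lemma ae_eq_Rintegral f g : measurable_fun D f -> measurable_fun D g ->
  ae_eq mu D f g -> \int[mu]_(x in D) f x = \int[mu]_(x in D) g x.
Proof.
move=> mf mg fg; rewrite /Rintegral; congr fine; apply: ae_eq_integral => //.
- exact/measurable_EFinP.
- exact/measurable_EFinP.
- by apply: filterS fg => x h Dx; rewrite h.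
Qed.

Lemma ge0_integral_realZl f k : measurable_fun D f -> (forall x, 0 <= f x) -> 0 <= k ->
  (\int[mu]_(x in D) (k * f x)%:E = k%:E * \int[mu]_(x in D) (f x)%:E)%E.
Proof.
move=> mf f0 k0; rewrite -ge0_integralZl//; first exact/measurable_EFinP.
by move=> x _; rewrite lee_fin.
Qed.

Lemma measurable_integrable f : mu.-integrable D (fun x => (f x)%:E) -> measurable_fun D f.
Proof. by case/integrableP => /measurable_EFinP. Qed.

Lemma ae_eq_integrable f g : measurable_fun D g -> ae_eq mu D f g ->
  mu.-integrable D (fun x => (f x)%:E) -> mu.-integrable D (fun x => (g x)%:E).
Proof.
move=> mg fg fi; apply/integrableP; split; first exact/measurable_EFinP.
have /integrableP[mf] := fi.
rewrite (ae_eq_integral (fun x => `|(g x)%:E|)%E)//.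
- by apply: measurableT_comp.
- by apply: measurableT_comp => //; exact/measurable_EFinP.
- by apply: filterS fg => x h Dx; rewrite h.
Qed.

End integrable_real.

(** * Expectations of primitives *)

Section expectation_primitive.
Context d (T : measurableType d) (R : realType) (P : probability T R).
Notation mu := (@lebesgue_measure R).

Lemma measurable_ltR d' (T' : measurableType d') (f g : T' -> R) :
  measurable_fun setT f -> measurable_fun setT g ->
  measurable_fun setT (fun x => (f x < g x)%R%:R : R).
Proof.
move=> mf mg.
rewrite (_ : (fun _ => _) = (fun x => if f x < g x then 1 else 0)).
  by apply: measurable_fun_ifT => //; exact: measurable_fun_ltr.
by apply/funext => x; case: ifP.
Qed.

Lemma integrable_mul_ind (H : T -> R) (b : T -> bool) :
  measurable_fun setT (fun x => (b x)%:R : R) ->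
  P.-integrable setT (EFin \o H) -> P.-integrable setT (fun x => (H x * (b x)%:R)%:E).
Proof.
move=> mb iH; have mH : measurable_fun setT H by apply/measurable_EFinP; case/integrableP: iH.
apply: le_integrable iH => //.
- by apply/measurable_EFinP; apply: measurable_funM.
- move=> x _ /=; rewrite lee_fin normrM.
  by case: (b x); rewrite ?normr1 ?normr0 ?mulr1 ?mulr0.
Qed.

Variables (Y H : T -> R) (w W : R -> R) (t0 : R).
Hypotheses (mY : measurable_fun setT Y) (iH : P.-integrable setT (EFin \o H)).
Hypothesis EH : \int[P]_x H x = 0.
Hypotheses (mw : measurable_fun setT w) (w0 : forall s, 0 <= w s).
Hypothesis Ww : {ae P, forall x,
  (t0 <= Y x -> (\int[mu]_(s in `[t0, Y x[) (w s)%:E = (W (Y x))%:E)%E) /\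
  (Y x < t0 -> (\int[mu]_(s in `[Y x, t0[) (w s)%:E = (- W (Y x))%:E)%E)}.
Hypothesis mWH : measurable_fun setT (fun x => W (Y x) * H x).
Hypothesis iWH : P.-integrable setT (fun x => (W (Y x) * H x)%:E).

Let mH : measurable_fun setT H.
Proof. by apply/measurable_EFinP; case/integrableP: iH. Qed.

Let f (z : T * measurableTypeR R) : R :=
  w z.2 * ((z.2 < Y z.1)%R%:R - (z.2 < t0)%R%:R) * H z.1.

Let mf : measurable_fun setT f.
Proof.
have m2 : measurable_fun setT (snd : T * measurableTypeR R -> R) by exact: measurable_snd.
apply: measurable_funM; last exact: measurableT_comp.
apply: measurable_funM; first exact: measurableT_comp.
apply: measurable_funB; apply: measurable_ltR => //.
exact: measurableT_comp.
Qed.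

(** For fixed x the difference of indicators has a constant sign and w >= 0, so the integral of the
    absolute value is |W(Y x)|. Hence integrability of W(Y) H under P is exactly the integrability
    that Fubini's theorem asks for. *)
Let inner : {ae P, forall x,
  (\int[mu]_s (w s * `|(s < Y x)%R%:R - (s < t0)%R%:R|)%:E = `|W (Y x)|%:E)%E /\
  (\int[mu]_s (w s * ((s < Y x)%R%:R - (s < t0)%R%:R))%:E = (W (Y x))%:E)%E}.
Proof.
apply: filterS Ww => x [W1 W2].
have [tY|Yt] := leP t0 (Y x).
  have := W1 tY; rewrite integral_mkcond => E.
  have W0 : 0 <= W (Y x).
    rewrite -lee_fin -E; apply: integral_ge0 => s _; rewrite patchE.
    by case: ifPn; rewrite ?lee_fin.
  have P1 s : (s < Y x)%R%:R - (s < t0)%R%:R = (s \in `[t0, Y x[)%:R :> R.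
    rewrite in_itv/= [(t0 <= s)]leNgt; case: (ltP s t0) => /= ts; last by rewrite subr0.
    by rewrite (lt_le_trans ts tY) subrr.
  rewrite ger0_norm//; split; rewrite -E; apply: eq_integral => s _; rewrite P1 patchE mem_setE; by
    case: (s \in `[_, _[); rewrite ?normr1 ?normr0 ?mulr1 ?mulr0.
have := W2 Yt; rewrite integral_mkcond => E.
have W0 : W (Y x) <= 0.
  rewrite -oppr_ge0 -lee_fin -E; apply: integral_ge0 => s _; rewrite patchE.
  by case: ifPn; rewrite ?lee_fin.
have P1 s : (s < Y x)%R%:R - (s < t0)%R%:R = - (s \in `[Y x, t0[)%:R :> R.
  rewrite in_itv/= [(Y x <= s)]leNgt; case: (ltP s (Y x)) => /= ts; last by rewrite sub0r.
  by rewrite (lt_trans ts Yt) subrr oppr0.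
rewrite ler0_norm//; split.
  rewrite -E; apply: eq_integral => s _; rewrite P1 patchE mem_setE.
  by case: (s \in `[_, _[); rewrite ?normrN ?normr1 ?normr0 ?mulr1 ?mulr0.
rewrite -[W (Y x)]opprK EFinN -E -integral_ge0N; last first.
  by move=> s _; rewrite patchE; case: ifPn; rewrite ?lee_fin.
apply: eq_integral => s _; rewrite P1 patchE mem_setE.
by case: (s \in `[_, _[); rewrite ?oppr0 ?mulrN ?mulr1 ?mulr0 ?oppe0.
Qed.

Let intf : (P \x mu)%E.-integrable setT (EFin \o f).
Proof.
apply/integrable12ltyP; first exact/measurable_EFinP.
rewrite (ae_eq_integral (fun x => `|(W (Y x) * H x)%:E|)%E)//.
- by case/integrableP: iWH.
- by apply: (measurable_fun_fubini_tonelli_F (fun z => `|(f z)%:E|%E)) => //; apply: measurableT_comp => //; exact/measurable_EFinP.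
- by apply: measurableT_comp => //; exact/measurable_EFinP.
- apply: filterS inner => x [E1 _] _ /=.
  under eq_integral => s _ do rewrite /f/= 2!normrM (ger0_norm (w0 _)) EFinM.
  rewrite ge0_integralZr//.
  + by rewrite E1 normrM EFinM.
  + apply/measurable_EFinP; apply: measurable_funM => //.
    by apply: measurableT_comp => //; apply: measurable_funB; exact: measurable_ltR.
  + by move=> s _; rewrite lee_fin mulr_ge0.
Qed.

Let G s : R := \int[P]_x (H x * (s < Y x)%R%:R).

Let innerG s : (\int[P]_x (f (x, s))%:E = (w s * G s)%:E)%E.
Proof.
have i1 : P.-integrable setT (fun x => (H x * (s < Y x)%R%:R)%:E).
  by apply: integrable_mul_ind => //; exact: measurable_ltR.
have i2 : P.-integrable setT (fun x => (H x * (s < t0)%R%:R)%:E).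
  by apply: integrable_mul_ind => //; exact: measurable_cst.
rewrite EFinM /G /Rintegral fineK; last exact: integrable_fin_num.
rewrite -integralZl//.
transitivity (\int[P]_x ((w s)%:E * (H x * (s < Y x)%R%:R)%:E - (w s * (s < t0)%R%:R)%:E * (H x)%:E))%E.
  by apply: eq_integral => x _; rewrite -!EFinM -EFinB /f/=; congr EFin; ring.
rewrite integralB//; [|exact: integrableZl|exact: integrableZl].
rewrite [X in (_ - X)%E]integralZl//.
have -> : (\int[P]_x (H x)%:E = 0)%E.
  by rewrite -[LHS]fineK ?integrable_fin_num// -[fine _]/(\int[P]_x H x)%R EH.
by rewrite mule0 sube0.
Qed.

(* W(Y) is the integral of w(s) (1(s < Y) - 1(s < t0)) ds; exchange the
   integrals, and the term in t0 vanishes because H is centred. *)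
Lemma expectation_primitive :
  mu.-integrable setT (fun s => (w s * G s)%:E) /\
  \int[P]_x (W (Y x) * H x) = \int[mu]_s (w s * G s).
Proof.
split.
  rewrite (_ : (fun s => _) = fubini_G P (EFin \o f)); last first.
    by apply/funext => s; rewrite /fubini_G/= innerG.
  have mf' : measurable_fun setT (EFin \o f) by exact/measurable_EFinP.
  apply/integrableP; split; first exact: (measurable_fubini_G intf).
  apply: le_lt_trans ((integrable21ltyP _ _ mf').1 intf).
  apply: ge0_le_integral => //.
  - by apply: measurableT_comp => //; exact: (measurable_fubini_G intf).
  - apply: (measurable_fun_fubini_tonelli_G (fun z => `|(f z)%:E|%E)) => //.
    by apply: measurableT_comp.
  - move=> s _; apply: le_abse_integral => //.
    by apply: measurableT_comp => //; exact: measurable_pair2.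
rewrite /Rintegral; congr fine.
transitivity (\int[P]_x fubini_F mu (EFin \o f) x)%E.
  apply: ae_eq_integral => //.
  - exact/measurable_EFinP.
  - exact: (measurable_fubini_F intf).
  - apply: filterS inner => x [E1 E2] _; rewrite /fubini_F/= /f/=.
    under eq_integral => s _ do rewrite EFinM.
    rewrite integralZr//; first by rewrite E2.
    apply/integrableP; split.
      apply/measurable_EFinP; apply: measurable_funM => //.
      by apply: measurable_funB; apply: measurable_ltR.
    under eq_integral => s _ do rewrite /= normrM (ger0_norm (w0 _)).
    by rewrite E1 ltry.
rewrite integral12_prod_meas1// -integral21_prod_meas1//.
by apply: eq_integral => s _; rewrite /fubini_G/= innerG.
Qed.

End expectation_primitive.

(** * Consequences of quadratic mean differentiability *)

Section qmd_derivative.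
Context d (T : measurableType d) (R : realType) (mu : {measure set T -> \bar R}).
Variables (p : R -> T -> R) (q : T -> R).
Hypotheses (mp : forall s, measurable_fun setT (p s)) (p0 : forall s x, 0 <= p s x).
Hypothesis p1 : forall s, (\int[mu]_x (p s x)%:E = 1)%E.
Hypothesis mq : measurable_fun setT q.
Hypothesis Iq : (\int[mu]_x (q x ^+ 2 * p 0 x)%:E < +oo)%E.
Let D s x := Num.sqrt (p s x) - Num.sqrt (p 0 x) - 2^-1 * (s * q x) * Num.sqrt (p 0 x).
Let K s := (\int[mu]_x (D s x ^+ 2 / s ^+ 2)%:E)%E.
Hypothesis K0 : K s @[s --> (0 : R)^'] --> 0%E.

Let mD s : measurable_fun setT (D s).
Proof.
have msq t : measurable_fun setT (fun x => Num.sqrt (p t x)).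
  by apply: measurableT_comp => //; by apply: continuous_measurable_fun; exact: sqrt_continuous.
apply: measurable_funB; first exact: measurable_funB.
by apply: measurable_funM => //; apply: measurable_funM => //; exact: measurable_funM.
Qed.

Lemma integrable_pdf_mul s (u : T -> R) : measurable_fun setT u ->
  (forall x, `|u x| <= 1) -> mu.-integrable setT (fun x => (u x * p s x)%:E).
Proof.
move=> mU u1; apply: (@le_integrable _ _ _ mu setT measurableT _ (EFin \o p s)) => //.
- by apply/measurable_EFinP/measurable_funM.
- move=> x _ /=; rewrite lee_fin normrM (ger0_norm (p0 s x)).
  by rewrite ler_piMl.
- apply/integrableP; split; first exact/measurable_EFinP.
  under eq_integral do rewrite /= ger0_norm//.
  by rewrite p1 ltry.
Qed.

(** From |q| <= 1 + q^2: the total mass and the finite second moment of the score dominate. *)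
Lemma integrable_score_mul (u : T -> R) : measurable_fun setT u ->
  (forall x, `|u x| <= 1) -> mu.-integrable setT (fun x => (u x * q x * p 0 x)%:E).
Proof.
move=> mU u1.
apply: (@le_integrable _ _ _ mu setT measurableT _ (fun x => (p 0 x + q x ^+ 2 * p 0 x)%:E)) => //.
- by apply/measurable_EFinP; apply: measurable_funM => //; exact: measurable_funM.
- move=> x _ /=; rewrite lee_fin 2!normrM (ger0_norm (p0 0 x)) [leRHS]ger0_norm; last first.
    by rewrite addr_ge0// mulr_ge0// sqr_ge0.
  rewrite -[X in X + _]mul1r -mulrDl ler_wpM2r//.
  apply: (@le_trans _ _ (1 * `|q x|)); first by rewrite ler_wpM2r.
  rewrite mul1r -[q x ^+ 2]real_normK ?num_real//; have := sqr_ge0 (`|q x| - 1); nra.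
- apply/integrableP; split.
    apply/measurable_EFinP; apply: measurable_funD => //.
    by apply: measurable_funM => //; exact: measurable_funX.
  under eq_integral => x _.
    rewrite /= ger0_norm; last by rewrite addr_ge0// mulr_ge0// sqr_ge0.
    rewrite EFinD; over.
  rewrite ge0_integralD//.
  - by rewrite p1 lte_add_pinfty// ltry.
  - by move=> x _; rewrite lee_fin.
  - exact/measurable_EFinP.
  - by move=> x _; rewrite lee_fin mulr_ge0// sqr_ge0.
  - by apply/measurable_EFinP; apply: measurable_funM => //; exact: measurable_funX.
Qed.

(* With a and b the square roots of the two densities, a^2 - b^2 = (a - b)^2
   + 2 b (a - b); AM-GM with weight e s splits the cross term with D. *)
Let pointwise (u e s : R) x : `|u| <= 1 -> 0 < e -> s != 0 ->
  `|u * p s x / s - u * p 0 x / s - u * q x * p 0 x| <=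
  (2 * `|s| + e^-1) * (D s x ^+ 2 / s ^+ 2) + (`|s| / 2) * (q x ^+ 2 * p 0 x) + e * p 0 x.
Proof.
move=> u1 e0 s0.
set a := Num.sqrt (p s x); set b := Num.sqrt (p 0 x).
have aE : p s x = a ^+ 2 by rewrite sqr_sqrtr.
have bE : p 0 x = b ^+ 2 by rewrite sqr_sqrtr.
have b0 : 0 <= b by exact: sqrtr_ge0.
set y := D s x; have ay : a = b + y + 2^-1 * (s * q x) * b by rewrite /y /D -/a -/b; ring.
have E : p s x - p 0 x - s * q x * p 0 x = (y + 2^-1 * (s * q x) * b) ^+ 2 + 2 * b * y.
  by rewrite aE bE ay; field.
rewrite (_ : _ - _ - _ = u * ((p s x - p 0 x - s * q x * p 0 x) / s)); last by field.
rewrite normrM (le_trans (ler_wpM2r (normr_ge0 _) u1))// mul1r E normrM normfV.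
have s1 : 0 < `|s| by rewrite normr_gt0.
rewrite ler_pdivrMr// bE.
have -> : s ^+ 2 = `|s| ^+ 2 by rewrite real_normK// num_real.
have sq : s ^+ 2 = `|s| ^+ 2 by rewrite real_normK// num_real.
have B1 : `|(y + 2^-1 * (s * q x) * b) ^+ 2 + 2 * b * y| <=
   (y + 2^-1 * (s * q x) * b) ^+ 2 + 2 * b * `|y|.
  apply: (le_trans (ler_normD _ _)); rewrite ger0_norm ?sqr_ge0// lerD2l.
  by rewrite !normrM (ger0_norm b0) ger0_norm.
apply: (le_trans B1).
have B2 : (y + 2^-1 * (s * q x) * b) ^+ 2 <= 2 * y ^+ 2 + 2^-1 * (`|s| ^+ 2 * q x ^+ 2 * b ^+ 2).
  rewrite -sq; have := sqr_ge0 (y - 2^-1 * (s * q x) * b); nra.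
have B3 : 2 * b * `|y| <= e * `|s| * b ^+ 2 + y ^+ 2 / (e * `|s|).
  have es : 0 < e * `|s| by rewrite mulr_gt0.
  have := sqr_ge0 (e * `|s| * b - `|y|).
  rewrite sqrrB real_normK ?num_real// => H.
  rewrite -(ler_pM2l es) mulrDr [_ * (y ^+ 2 / _)]mulrC divfK ?gt_eqF//.
  nra.
apply: (le_trans (lerD B2 B3)).
rewrite le_eqVlt; apply/orP; left; apply/eqP; field.
by rewrite !gt_eqF.
Qed.

(** The bound of [pointwise] integrates to (2 |s| + 1/e) K(s) + (|s| / 2) I + e, where I is the
    second moment of q and e is free. Fix e, then let s tend to 0. The boundedness of u is what
    turns the L^2 expansion of the square roots into an expansion of expectations. *)
Lemma qmd_derivative (u : T -> R) : measurable_fun setT u ->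
  (forall x, `|u x| <= 1) ->
  ((\int[mu]_x (u x * p s x) - \int[mu]_x (u x * p 0 x)) / s) @[s --> (0 : R)^'] -->
  \int[mu]_x (u x * q x * p 0 x).
Proof.
move=> mU u1.
set I := fine (\int[mu]_x (q x ^+ 2 * p 0 x)%:E).
have IE : (\int[mu]_x (q x ^+ 2 * p 0 x)%:E = I%:E)%E.
  rewrite fineK// ge0_fin_numE// integral_ge0// => x _.
  by rewrite lee_fin mulr_ge0// sqr_ge0.
have I0 : 0 <= I by rewrite fine_ge0// integral_ge0// => x _; rewrite lee_fin mulr_ge0// sqr_ge0.
have main e s : 0 < e -> s != 0 -> (K s < +oo)%E ->
  `|(\int[mu]_x (u x * p s x) - \int[mu]_x (u x * p 0 x)) / s - \int[mu]_x (u x * q x * p 0 x)|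
  <= (2 * `|s| + e^-1) * fine (K s) + (`|s| / 2) * I + e.
  move=> e0 s0 Koo.
  have KE : (\int[mu]_x (D s x ^+ 2 / s ^+ 2)%:E = (fine (K s))%:E)%E.
    rewrite fineK// ge0_fin_numE// integral_ge0// => x _.
    by rewrite lee_fin mulr_ge0// ?invr_ge0 sqr_ge0.
  have i1 := integrable_pdf_mul s mU u1.
  have i2 := integrable_pdf_mul 0 mU u1.
  have i3 := integrable_score_mul mU u1.
  rewrite mulrBl.
  rewrite -(RintegralZr _ _ i1)// -(RintegralZr _ _ i2)//.
  have j1 : mu.-integrable setT (fun x => (u x * p s x / s)%:E) by exact: (integrable_realMr measurableT _ i1).
  have j2 : mu.-integrable setT (fun x => (u x * p 0 x / s)%:E) by exact: (integrable_realMr measurableT _ i2).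
  have j3 : mu.-integrable setT (fun x => (u x * p s x / s - u x * p 0 x / s)%:E).
    exact: integrable_realB.
  have i4 : mu.-integrable setT (fun x => (u x * p s x / s - u x * p 0 x / s - u x * q x * p 0 x)%:E).
    exact: (integrable_realB measurableT j3 i3).
  rewrite -(RintegralB measurableT j1 j2) -(RintegralB measurableT j3 i3).
  apply: (le_trans (le_normr_Rintegral _ i4)) => //.
  rewrite -lee_fin /Rintegral fineK; last first.
    by apply: integrable_fin_num => //; exact: (integrable_norm i4).
  have mq2 : measurable_fun setT (fun x => q x ^+ 2 * p 0 x).
    by apply: measurable_funM => //; exact: measurable_funX.
  have mD2 : measurable_fun setT (fun x => D s x ^+ 2 / s ^+ 2).
    by apply: measurable_funM => //; apply: measurable_funX.
  have D20 x : 0 <= D s x ^+ 2 / s ^+ 2 by rewrite mulr_ge0// ?invr_ge0 sqr_ge0.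
  have q20 x : 0 <= q x ^+ 2 * p 0 x by rewrite mulr_ge0// sqr_ge0.
  have c10 : 0 <= 2 * `|s| + e^-1 by rewrite addr_ge0 ?mulr_ge0// invr_ge0 ltW.
  have c20 : 0 <= `|s| / 2 by rewrite divr_ge0.
  apply: (@le_trans _ _ (\int[mu]_x ((2 * `|s| + e^-1) * (D s x ^+ 2 / s ^+ 2) + (`|s| / 2) * (q x ^+ 2 * p 0 x) + e * p 0 x)%:E)%E).
    apply: ge0_le_integral => //.
    - apply/measurable_EFinP; apply: measurableT_comp => //.
      exact: (measurable_integrable i4).
    - apply/measurable_EFinP; apply: measurable_funD; last exact: measurable_funM.
      by apply: measurable_funD; exact: measurable_funM.
    - by move=> x _; rewrite lee_fin; exact: pointwise.
  under eq_integral do rewrite 2!EFinD.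
  rewrite ge0_integralD//; last 4 first.
  - by move=> x _; rewrite adde_ge0// lee_fin mulr_ge0.
  - by apply: emeasurable_funD; apply/measurable_EFinP; exact: measurable_funM.
  - by move=> x _; rewrite lee_fin mulr_ge0// ltW.
  - by apply/measurable_EFinP; exact: measurable_funM.
  rewrite ge0_integralD//; last 4 first.
  - by move=> x _; rewrite lee_fin mulr_ge0.
  - by apply/measurable_EFinP; exact: measurable_funM.
  - by move=> x _; rewrite lee_fin mulr_ge0.
  - by apply/measurable_EFinP; exact: measurable_funM.
  rewrite !ge0_integral_realZl ?(ltW e0)//.
  by rewrite KE IE p1 mule1 -!EFinM -!EFinD.
apply/cvgrPdist_le => /= e e0.
(* Each of the three terms gets e / 4; C bounds the factor 2 |s| + (e / 4)^-1 as soon as |s| <=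
   1. *)
have e4 : 0 < e / 4 by rewrite divr_gt0.
pose C := 2 + (e / 4)^-1.
have C0 : 0 < C by rewrite addr_gt0// invr_gt0.
have KC : \forall s \near (0 : R)^', (K s < (e / 4 / C)%:E)%E.
  have /fine_cvgP[Kfin /cvgrPdist_lt] := K0.
  move=> /(_ (e / 4 / C)); rewrite divr_gt0// => /(_ isT) Klt.
  near=> s; rewrite -[K s]fineK ?lte_fin; last by near: s.
  apply: le_lt_trans (ler_norm _) _; rewrite -normrN -[X in `|X|]sub0r.
  by near: s.
near=> s.
have s0 : s != 0 by near: s; exact: nbhs_dnbhs_neq.
have Ks : (K s < (e / 4 / C)%:E)%E by near: s.
have s1 : `|s| <= 1 by near: s; apply: dnbhs0_le.
have s2 : `|s| <= e / 4 / (I + 1).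
  by near: s; apply: dnbhs0_le; rewrite divr_gt0// ltr_wpDl.
rewrite distrC (le_trans (main (e / 4) s e4 s0 (lt_trans Ks (ltry _))))//.
have Kf : 0 <= fine (K s) <= e / 4 / C.
  rewrite fine_ge0/=; last by apply: integral_ge0 => x _; rewrite lee_fin mulr_ge0// ?invr_ge0 sqr_ge0.
  rewrite -lee_fin fineK ?ltW//.
  rewrite ge0_fin_numE ?(lt_trans Ks (ltry _))//.
  by apply: integral_ge0 => x _; rewrite lee_fin mulr_ge0// ?invr_ge0 sqr_ge0.
have B1 : (2 * `|s| + (e / 4)^-1) * fine (K s) <= e / 4.
  have /andP[Kf0 Kf1] := Kf.
  apply: (@le_trans _ _ (C * fine (K s))).
    by rewrite ler_wpM2r// lerD2r; lra.
  by rewrite mulrC -ler_pdivlMr.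
have B2 : `|s| / 2 * I <= e / 4.
  apply: (@le_trans _ _ (`|s| * (I + 1))).
    by have := normr_ge0 s; nra.
  by rewrite -ler_pdivlMr// ltr_wpDl.
lra.
Unshelve. all: by end_near.
Qed.

End qmd_derivative.

(** * Distribution functions of univariate densities *)

Section pdf_cdf.
Context {R : realType} (c : R -> R).
Hypothesis pc : is_pdf c.
Notation mu := (@lebesgue_measure R).

Definition pcdf (t : R) : R := \int[mu]_(s in `]-oo, t]) c s.

Let mc : measurable_fun setT c. Proof. by case: pc. Qed.
Let c0 t : 0 <= c t. Proof. by case: pc. Qed.
Let c1 : (\int[mu]_t (c t)%:E = 1)%E. Proof. by case: pc. Qed.

Lemma integrable_pdf A : measurable A -> mu.-integrable A (EFin \o c).
Proof.
move=> mA; apply: (@integrableS _ _ _ mu setT) => //.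
apply/integrableP; split; first exact/measurable_EFinP.
under eq_integral do rewrite /= ger0_norm//.
by rewrite c1 ltry.
Qed.

Lemma pcdfE t : (\int[mu]_(s in `]-oo, t]) (c s)%:E = (pcdf t)%:E)%E.
Proof. by rewrite /pcdf /Rintegral fineK//; apply: integrable_fin_num => //; exact: integrable_pdf. Qed.

Lemma pcdf_ge0 t : 0 <= pcdf t.
Proof. by apply: Rintegral_ge0. Qed.

Lemma pcdf_le1 t : pcdf t <= 1.
Proof.
rewrite -lee_fin -pcdfE -c1; apply: ge0_subset_integral => //.
  by apply/measurable_EFinP; exact: mc.
by move=> s _; rewrite lee_fin.
Qed.

Lemma pcdfB s t : s <= t -> pcdf t - pcdf s = \int[mu]_(x in `]s, t]) c x.
Proof. by move=> st; rewrite /pcdf Rintegral_itvB//; exact: integrable_pdf. Qed.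

Lemma pcdf_nondecreasing s t : s <= t -> pcdf s <= pcdf t.
Proof. by move=> st; rewrite -subr_ge0 pcdfB//; apply: Rintegral_ge0. Qed.

(** Continuity is available for integrals over a compact interval, so the lower limit is moved from
    -oo to t - 1. *)
Lemma pcdf_continuous : continuous pcdf.
Proof.
move=> t.
have ab : t - 1 <= t + 1 by lra.
have := parameterized_integral_continuous ab (integrable_pdf (measurable_itv _)).
have tab : t \in `]t - 1, t + 1[ by rewrite in_itv/=; lra.
have ab' : t - 1 < t + 1 by lra.
move/(continuous_within_itvP _ ab') => [+ _ _] => /(_ t tab) ct.
rewrite /continuous_at.
have E : {near t, (fun x => pcdf (t - 1) + parameterized_integral mu (t - 1) x c) =1 pcdf}.
  near=> x; rewrite /parameterized_integral.
  have x1 : t - 1 <= x.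
    by near: x; exists 1 => //= z /=; rewrite ltr_distl; lra.
  by rewrite -Rintegral_itv_obnd_cbnd -?pcdfB// ?subrKC//; exact: integrable_pdf.
rewrite -(nbhs_singleton E).
apply: cvg_trans; first exact: (near_eq_cvg E).
by apply: cvgD; [exact: cvg_cst|exact: ct].
Unshelve. all: by end_near. Qed.

Lemma ccdf_pdf t : \int[mu]_(s in `]t, +oo[) c s = 1 - pcdf t.
Proof.
rewrite -(@Rintegral_itvB _ c -oo%O +oo%O t)//; last exact: integrable_pdf.
by rewrite set_itvNyy /Rintegral c1.
Qed.

Lemma pcdf_gt u : u < 1 -> exists t, u < pcdf t.
Proof.
move=> u1.
have := @ge0_nondecreasing_set_cvg_integral _ _ R (fun n => `]-oo, n%:R : R]%classic : set (measurableTypeR R)) (EFin \o c) mu.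
have -> : \bigcup_n `]-oo, n%:R]%classic = [set: R].
  apply/seteqP; split => // x _; exists (Num.bound `|x|) => //=.
  by rewrite in_itv/= (le_trans (ler_norm x))// ltW// archi_boundP.
rewrite c1 => H.
have {}H : pcdf n%:R @[n --> \oo] --> (1 : R).
  apply: (@fine_cvg _ _ _ _ (fun n => \int[mu]_(x in `]-oo, n%:R]) (c x)%:E)%E); apply: H => //.
  - by move=> m n mn; apply/subsetPset => x /=; rewrite !in_itv/= => /le_trans; apply; rewrite ler_nat.
  - by move=> n; apply/measurable_EFinP; exact: measurable_funTS.
  - by move=> n x _; rewrite lee_fin.
have [N _ /(_ N (leqnn N))] := cvgr_gt 1 H u u1.
by exists N%:R.
Qed.

Lemma pcdf_lt u : 0 < u -> exists t, pcdf t < u.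
Proof.
move=> u0.
have := @ge0_nondecreasing_set_cvg_integral _ _ R (fun n => `](- n%:R : R), +oo[%classic : set (measurableTypeR R)) (EFin \o c) mu.
have -> : \bigcup_n `](- n%:R), +oo[%classic = [set: R].
  apply/seteqP; split => // x _; exists (Num.bound `|x|) => //=.
  by rewrite in_itv/= andbT ltrNl (le_lt_trans (ler_norm _))// normrN archi_boundP.
rewrite c1 => H.
have {}H : 1 - pcdf (- n%:R) @[n --> \oo] --> (1 : R).
  rewrite [X in X @ _ --> _](_ : _ = fun n : nat => \int[mu]_(x in `](- n%:R), +oo[) c x); last first.
    by apply/funext => n; rewrite ccdf_pdf.
  apply: (@fine_cvg _ _ _ _ (fun n => \int[mu]_(x in `](- n%:R)%R, +oo[) (c x)%:E)%E); apply: H => //.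
  - move=> m n mn; apply/subsetPset => x /=; rewrite !in_itv/= !andbT; apply: le_lt_trans.
    by rewrite lerN2 ler_nat.
  - by move=> n; apply/measurable_EFinP; exact: measurable_funTS.
  - by move=> n x _; rewrite lee_fin.
have u1 : 1 - u < 1 by lra.
have [N _ /(_ N (leqnn N))] := cvgr_gt 1 H _ u1.
by exists (- N%:R); lra.
Qed.

Lemma pcdf_surj u : 0 < u < 1 -> exists t, pcdf t = u.
Proof.
move=> /andP[u0 u1]; have [a au] := pcdf_lt u0; have [b ub] := pcdf_gt u1.
have ab : a <= b.
  by rewrite leNgt; apply/negP => /ltW/pcdf_nondecreasing; lra.
have [||t _ tu] := @IVT R pcdf a b u ab.
- by apply: continuous_subspaceT; exact: pcdf_continuous.
- by rewrite min_l ?max_r ?pcdf_nondecreasing// !ltW.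
- by exists t.
Qed.

(** Lebesgue's differentiation theorem. As c is merely measurable, the derivative is known almost
    everywhere only, and the tail identity of the score inherits this. *)
Lemma pcdf_derive_ae : {ae mu, forall t, derivable pcdf t 1 /\ derive1 pcdf t = c t}.
Proof.
apply: FTC1Ny; first by move=> y; exact: integrable_pdf.
apply: open_integrable_locally => //; first exact: openT.
exact: integrable_pdf.
Qed.

End pdf_cdf.

Lemma pcdf_shift {R : realType} (c : R -> R) a b : is_pdf c ->
  pcdf (fun t => c (t - a)) b = pcdf c (b - a).
Proof.
move=> [mc c0 _]; rewrite /pcdf /Rintegral; congr fine.
rewrite integral_mkcond [RHS]integral_mkcond.
rewrite -[RHS](@ge0_integral_shift _ a)//.
- apply: eq_integral => t _; rewrite !patchE !mem_setE !in_itv/=.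
  by rewrite lerBlDr subrK.
- by apply/(measurable_restrictT _ _).1 => //; apply/measurable_EFinP; exact: measurable_funTS.
- by move=> t; rewrite patchE; case: ifPn => //; rewrite lee_fin.
Qed.

Lemma cvg_dnbhs0 {R : realType} (V W : normedModType R) (g : V -> W) :
  {for 0, continuous g} -> g 0 = 0 -> (forall s, s != 0 -> g s != 0) ->
  g s @[s --> (0 : V)^'] --> (0 : W)^'.
Proof.
move=> gc g0 gn0 A; rewrite /dnbhs /within/= => nA.
have gc' : g s @[s --> (0 : V)] --> nbhs (0 : W) by rewrite -[X in _ --> nbhs X]g0; exact: gc.
have := gc' _ nA; rewrite /nbhs/= => H.
by apply: filterS H => s /= H /gn0; exact: H.
Qed.

(** * The score in integrated form *)

Section score_property.
Context {R : realType} {d : nat}.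
Notation mu := (@lebesgue_measure R).

(* The third item is the integrated form of E[eta_j | x_i] c_i = - (i == j) c_i'.
   It is all that the efficiency depends on: no smoothness of c is assumed. *)
Definition score_property (P : probability 'rV[R]_d R) (c : 'I_d -> R -> R)
    (eta : 'rV[R]_d -> 'rV[R]_d) : Prop :=
  forall j, [/\ P.-integrable setT (fun x => (eta x 0 j)%:E),
    \int[P]_x (eta x 0 j) = 0 &
    forall i, {ae mu, forall s,
      \int[P]_x (eta x 0 j * (s < (x : 'rV[R]_d) 0 i)%R%:R) = (i == j)%:R * c i s}].

Lemma product_law_F_ind (X : F_ind R d) : product_law (law X) (component_density X).
Proof.
split; first by move=> i; apply: is_pdf_shift; exact: base_pdf.
exact: law_density.
Qed.

Lemma score_component_square (X : F_ind R d) j : regular X ->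
  (\int[law X]_x (Defs.eta X x 0%R j ^+ 2)%:E < +oo)%E.
Proof.
move=> [_ [meta _] _ + _]; apply: le_lt_trans; apply: ge0_le_integral => //.
- by move=> x _; rewrite lee_fin sqr_ge0.
- apply/measurable_EFinP; apply: measurable_funX.
  exact: (measurableT_comp (measurable_coord j) meta).
- apply/measurable_EFinP; apply: measurable_sum => i.
  by apply: measurable_funM; exact: (measurableT_comp (measurable_coord i) meta).
- move=> x _; rewrite lee_fin /sqnorm /dot (bigD1 j)//= -expr2 lerDl sumr_ge0// => i _.
  by rewrite -expr2 sqr_ge0.
Qed.

(** The j-th coordinate is shifted by s and [qmd_derivative] is applied twice. With u = 1 the total
    mass is constant in s, so eta_j is centred. With u = 1(b < x_i) the function of s is the tail 1
    - F_i(b - s (i == j)), whose derivative at 0 is (i == j) c_i(b) wherever F_i has derivative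
    c_i. *)
Lemma regular_score_property (X : F_ind R d) : regular X ->
  score_property (law X) (component_density X) (Defs.eta X).
Proof.
move=> rX j; set P := law X; set c := component_density X.
have [pdfc [mdens dens0 PE]] := product_law_F_ind X.
have [mc c0] : (forall i, measurable_fun setT (c i)) /\ (forall i t, 0 <= c i t).
  by split=> i; have [] := pdfc i.
have [_ [meta _] qmd _ _] := rX.
pose sh (s : R) k (t : R) := c k (t - s * (k == j)%:R).
pose p (s : R) (x : 'rV[R]_d) := \prod_k sh s k (x 0 k).
have msh s k : measurable_fun setT (sh s k).
  by apply: measurableT_comp => //; exact: measurable_funB.
have shpdf s k : is_pdf (sh s k) by exact: is_pdf_shift.
have mp s : measurable_fun setT (p s) by exact: measurable_prod_coord.
have p0 s x : 0 <= p s x by apply: prodr_ge0 => k _; exact: c0.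
have p1 s : (\int[lebesgue_rV d]_x (p s x)%:E = 1)%E.
  rewrite (@integral_lebesgue_rV_prod _ _ (sh s) (fun=> 1)) ?big1//.
  - by move=> k t; exact: c0.
  - by move=> k; have [] := shpdf s k.
have pE : p 0 = (fun x => \prod_k c k (x 0 k)).
  by apply/funext => x; apply: eq_bigr => k _; rewrite /sh mul0r subr0.
pose q x := Defs.eta X x 0 j.
have mq : measurable_fun setT q.
  exact: (measurableT_comp (measurable_coord j) meta).
have Pp A : measurable A -> P A = (\int[lebesgue_rV d]_(x in A) (p 0 x)%:E)%E.
  by move=> mA; rewrite pE PE.
have Iq : (\int[lebesgue_rV d]_x (q x ^+ 2 * p 0 x)%:E < +oo)%E.
  apply: le_lt_trans (score_component_square j rX).
  rewrite (@ge0_integral_density _ _ _ (lebesgue_rV d) (law X) (p 0))//.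
  - by apply/measurable_EFinP; exact: measurable_funX.
  - by move=> x; rewrite lee_fin sqr_ge0.
have famE s x : Defs.family X x (theta0 X + s *: delta_mx 0 j) = p s x.
  apply: eq_bigr => k _; rewrite /sh /c /component_density !mxE eqxx/=.
  by congr (base _ _ _); ring.
have famE0 x : Defs.family X x (theta0 X) = p 0 x.
  by rewrite -famE scale0r addr0.
have K0 : (\int[lebesgue_rV d]_x ((Num.sqrt (p s x) - Num.sqrt (p 0 x) -
    2^-1 * (s * q x) * Num.sqrt (p 0 x)) ^+ 2 / s ^+ 2)%:E)%E @[s --> (0 : R)^'] --> 0%E.
  (* The limit in [qmd_at] runs over vectors; it is restricted to the line s e_j, which avoids 0 for
     s != 0. *)
  pose f (delta : 'rV[R]_d) : \bar R := (\int[lebesgue_rV d]_x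
     ((Num.sqrt (Defs.family X x (theta0 X + delta)) - Num.sqrt (Defs.family X x (theta0 X))
       - 2^-1 * dot delta (score (Defs.family X) x (theta0 X)) * Num.sqrt (Defs.family X x (theta0 X))) ^+ 2
      / sqnorm delta)%:E)%E.
  rewrite [X in X @ _ --> _](_ : _ = (fun s => f (s *: delta_mx 0 j))); last first.
    apply/funext => s; apply: eq_integral => x _; rewrite famE famE0.
    have dotj v : dot (s *: delta_mx 0 j) v = s * v 0 j.
      rewrite /dot (bigD1 j)//= big1 => [|k /negbTE kj]; rewrite !mxE ?eqxx ?kj /= ?mulr1 ?addr0//.
      by rewrite mulr0 mul0r.
    rewrite /sqnorm !dotj.
    by rewrite (_ : (s *: delta_mx 0 j : 'rV[R]_d) 0 j = s) ?expr2// !mxE !eqxx mulr1.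
  apply: (@cvg_comp _ _ _ (fun s : R => s *: (delta_mx 0 j : 'rV[R]_d)) f _ ((0 : 'rV[R]_d)^')).
    apply: cvg_dnbhs0.
    - by apply: cvgZr_tmp; exact: cvg_id.
    - by rewrite scale0r.
    - move=> s s0; rewrite scaler_eq0 (negbTE s0)/=; apply/eqP => /rowP/(_ j).
      by rewrite !mxE !eqxx => /eqP; rewrite oner_eq0.
  exact: qmd.
have main (u : 'rV[R]_d -> R) : measurable_fun setT u -> (forall x, `|u x| <= 1) ->
  ((\int[lebesgue_rV d]_x (u x * p s x) - \int[lebesgue_rV d]_x (u x * p 0 x)) / s) @[s --> (0 : R)^'] -->
  \int[P]_x (Defs.eta X x 0 j * u x).
  move=> mU u1; have := @qmd_derivative _ _ _ (lebesgue_rV d) p q mp p0 p1 mq Iq K0 u mU u1.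
  rewrite [X in _ --> X -> _](_ : _ = \int[P]_x (Defs.eta X x 0 j * u x)) //.
  rewrite /Rintegral; congr fine.
  rewrite (@integral_density _ _ _ (lebesgue_rV d) (law X) (p 0)) //.
    by apply: eq_integral => x _; rewrite [u x * _]mulrC.
  exact: measurable_funM.
(* Under the shifted density the k-th factor is c_k, moved by s if k = j; all the other factors
   integrate to 1. *)
have half s k b : \int[lebesgue_rV d]_x ((b < (x : 'rV[R]_d) 0 k)%R%:R * p s x) = 1 - pcdf (c k) (b - s * (k == j)%:R).
  rewrite -pcdf_shift// -/(sh s k) -ccdf_pdf// /Rintegral; congr fine.
  pose u i t : R := if i == k then (b < t)%R%:R * sh s k t else sh s i t.
  have ci : (\int[mu]_(t in `]b, +oo[) (sh s k t)%:E)%E \is a fin_num.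
    by apply: integrable_fin_num => //; exact: integrable_pdf.
  transitivity (\int[lebesgue_rV d]_x (\prod_i u i ((x : 'rV[R]_d) 0%R i))%:E)%E.
    apply: eq_integral => x _; rewrite /p (bigD1 k)//= [in RHS](bigD1 k)//= mulrA /u eqxx.
    by congr (_ * _)%:E; apply: eq_bigr => i /negbTE ->.
  rewrite (@integral_lebesgue_rV_prod _ _ u (fun i => if i == k then \int[mu]_(t in `]b, +oo[) sh s k t else 1)).
  - by rewrite (bigD1 k)//= eqxx big1 ?mulr1 ?fineK// => i /negbTE ->.
  - move=> i; rewrite /u; case: (i == k); last exact: msh.
    by apply: measurable_funM => //; apply: measurable_ltR.
  - by move=> i t; rewrite /u; case: (i == k); rewrite ?mulr_ge0//; exact: c0.
  - move=> i; rewrite /u; case: (i == k); last by have [] := shpdf s i.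
    rewrite /Rintegral fineK// [RHS]integral_mkcond; apply: eq_integral => t _.
    rewrite patchE mem_setE in_itv/= andbT.
    by case: ifP; rewrite ?mul1r ?mul0r.
have peta : \int[P]_x (Defs.eta X x 0 j) = 0.
  have := main (fun=> 1); rewrite normr1 => /(_ (measurable_cst _) (fun=> lexx _)).
  have E s : \int[lebesgue_rV d]_x (1 * p s x) = 1.
    by under eq_Rintegral do rewrite mul1r; rewrite /Rintegral p1.
  under eq_fun do rewrite !E subrr mul0r.
  under eq_Rintegral do rewrite mulr1.
  by move/cvg_lim => <-//; rewrite lim_cst.
split => //.
- have H : (lebesgue_rV d).-integrable setT (fun x => (1 * q x * p 0 x)%:E).
    by apply: (integrable_score_mul mp p0 p1 mq Iq (u := fun=> 1)) => // x; rewrite normr1.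
  apply/(integrable_density (mp 0) (p0 0) Pp mq).
  by under eq_fun do rewrite -[q _]mul1r.
- move=> i; have := pcdf_derive_ae (pdfc i); apply: filterS.
    exact: (ae_filter_ringOfSetsType mu).
  move=> b [Fd Fc].
  have mb : measurable_fun setT (fun x : 'rV[R]_d => (b < x 0 i)%R%:R : R).
    by apply: measurable_ltR => //; exact: measurable_coord.
  have b1 (x : 'rV[R]_d) : `|(b < x 0 i)%R%:R : R| <= 1.
    by case: (b < _); rewrite ?normr1 ?normr0.
  have := main _ mb b1.
  under eq_fun do rewrite !half mul0r subr0.
  move=> /cvg_lim <-//; apply/cvg_lim => //.
  have [ij|ij] := eqVneq i j; last first.
    under eq_fun do rewrite mulr0 subr0 subrr mul0r.
    by rewrite mul0r; exact: cvg_cst.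
  rewrite mul1r (_ : c i b = derive1 (pcdf (c i)) b); last by rewrite /c Fc.
  under eq_fun do rewrite mulr1.
  have := Fd; rewrite /derivable => /cvg_toP H.
  have {}H : h^-1 *: (pcdf (c i) (h *: 1 + b) - pcdf (c i) b) @[h --> (0 : R)^'] --> derive1 (pcdf (c i)) b.
    by rewrite derive1E; exact: H.
  (* A shift of the location by s moves the argument of the distribution function by -s, so the
     difference quotient of F_i is read at -s. *)
  have oppd : - s @[s --> (0 : R)^'] --> (0 : R)^'.
    apply: cvg_dnbhs0; [exact: oppr_continuous|exact: oppr0|].
    by move=> s; rewrite oppr_eq0.
  have := cvg_comp _ _ oppd H; apply: cvg_trans; apply: near_eq_cvg.
  near=> s; rewrite /= /GRing.scale/= mulr1 invrN [- s + b]addrC; ring.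
Unshelve. all: by end_near.
Qed.

End score_property.

(** * Uniqueness of the rank map *)

Section dot.
Context {R : realType} {d : nat}.
Implicit Types u v w : 'rV[R]_d.

Lemma dotC u v : dot u v = dot v u.
Proof. by apply: eq_bigr => i _; rewrite mulrC. Qed.

Lemma dotDl u v w : dot (u + v) w = dot u w + dot v w.
Proof. by rewrite /dot -big_split/=; apply: eq_bigr => i _; rewrite mxE mulrDl. Qed.

Lemma dotZl a u v : dot (a *: u) v = a * dot u v.
Proof. by rewrite /dot big_distrr/=; apply: eq_bigr => i _; rewrite mxE mulrA. Qed.

Lemma dotNl u v : dot (- u) v = - dot u v.
Proof. by rewrite -scaleN1r dotZl mulN1r. Qed.

Lemma dotBl u v w : dot (u - v) w = dot u w - dot v w.
Proof. by rewrite dotDl dotNl. Qed.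

Lemma dotBr u v w : dot u (v - w) = dot u v - dot u w.
Proof. by rewrite dotC dotBl !(dotC u). Qed.

Lemma sqnorm_eq0 u : sqnorm u = 0 -> u = 0.
Proof.
move=> /eqP; rewrite psumr_eq0 => [/allP h|i _]; last by rewrite -expr2 sqr_ge0.
apply/rowP => i; rewrite mxE; have := h i; rewrite mem_index_enum => /(_ isT)/=.
by rewrite mulf_eq0 orbb => /eqP.
Qed.

Lemma continuous_dotl v : continuous (fun u => dot u v).
Proof.
move=> u; rewrite /dot; elim: (index_enum _) => [|i s IH].
  rewrite (_ : (fun w => _) = cst 0); first exact: cst_continuous.
  by apply/funext => w; rewrite big_nil.
rewrite (_ : (fun w => _) = (fun w : 'rV[R]_d => w 0 i * v 0 i) \+
    (fun w : 'rV[R]_d => \sum_(j <- s) w 0 j * v 0 j)).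
  apply: continuousD => //; apply: continuousM; last exact: cst_continuous.
  exact: coord_continuous.
by apply/funext => w; rewrite big_cons.
Qed.

Lemma measurable_dot d' (T : measurableType d') (f g : T -> 'rV[R]_d) :
  measurable_fun setT f -> measurable_fun setT g ->
  measurable_fun setT (fun x => dot (f x) (g x)).
Proof.
move=> mf mg; apply: measurable_sum => i; apply: measurable_funM.
- exact: (measurableT_comp (measurable_coord i) mf).
- exact: (measurableT_comp (measurable_coord i) mg).
Qed.

(** An enumeration of the rational vectors; a number that codes no vector yields 0, which does not
    harm density. Countability makes the supremum in [conjugate] below measurable. *)
Definition rat_rV (n : nat) : 'rV[R]_d :=
  map_mx ratr (odflt 0 (unpickle n : option 'rV[rat]_d)).

Lemma rat_rV_dense (x : 'rV[R]_d) (A : set 'rV[R]_d) : nbhs x A ->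
  exists n, A (rat_rV n).
Proof.
move=> /nbhs_ballP[e /= e0 xeA].
have H i : exists q : rat, ball (x 0 i) e (ratr q).
  have /rat_in_itvoo[q] : x 0 i - e < x 0 i + e by lra.
  by rewrite in_itv/= => /andP[? ?]; exists q; rewrite /ball/= ltr_distlC; apply/andP.
have [f Hf] := choice H.
exists (pickle (\row_i f i : 'rV[rat]_d)); apply: xeA.
split => // i j; rewrite /rat_rV pickleK/= !mxE (ord1 i); exact: Hf.
Qed.

End dot.

Lemma cvg_shiftr {R : realType} (V : normedModType R) (a x : V) :
  (h + x) @[h --> a] --> a + x.
Proof. by apply: cvgD; [exact: cvg_id|exact: cvg_cst]. Qed.

Section gradient.
Context {R : realType} {d : nat}.
Variable psi : 'rV[R]_d -> \bar R.
Hypothesis cpsi : convex_ereal psi.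
Implicit Types x v q y : 'rV[R]_d.

Lemma is_gradient_fin x v : is_gradient_at psi x v -> psi x \is a fin_num.
Proof. by case=> /nbhs_singleton. Qed.

Lemma diff_dot (g : 'rV[R]_d -> R) x v w : differentiable g x -> grad g x = v ->
  'd g x w = dot w v.
Proof.
move=> dg <-; rewrite {1}(row_sum_delta w) linear_sum/=.
by apply: eq_bigr => i _; rewrite linearZ/= /grad mxE deriveE.
Qed.

(** For 0 < t < 1 convexity bounds the difference quotient of psi at x in direction q - x by psi q -
    psi x; let t decrease to 0. *)
Lemma gradient_inequality x v q : is_gradient_at psi x v -> psi q \is a fin_num ->
  fine (psi x) + dot (q - x) v <= fine (psi q).
Proof.
move=> gx fq; have fx := is_gradient_fin gx; case: gx => nfin dif gv.
set g := fine \o psi.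
rewrite addrC -lerBrDr -(diff_dot _ dif gv) -deriveE//.
have /cvg_ex[l gl] : derivable g x (q - x) by exact: diff_derivable.
have -> : 'D_(q - x) g x = l by exact/cvg_lim.
have gl' : h^-1 *: ((g \o shift x) (h *: (q - x)) - g x) @[h --> (0 : R)^'+] --> l.
  by apply: cvg_trans gl; apply: cvg_app; apply: within_subset => t /= t0; rewrite gt_eqF.
apply: (cvgr_to_le gl').
near=> t.
have t0 : 0 < t by near: t; exact: nbhs_right_gt.
have t1 : t < 1 by near: t; exact: nbhs_right_lt.
have E : t *: (q - x) + x = t *: q + (1 - t) *: x.
  by rewrite scalerBr scalerBl scale1r -addrA; congr (_ + _); rewrite addrC.
rewrite /= E; have [ninf cvx] := cpsi.
have := cvx q x t; rewrite t0 t1 => /(_ isT).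
set z := t *: q + (1 - t) *: x.
rewrite -(fineK fq) -(fineK fx) -!EFinM -EFinD => H.
rewrite /GRing.scale/= ler_pdivrMl// /g/=.
(* The value -oo is excluded for convex psi, and +oo by the finite upper bound [H]. *)
case: (psi z) (ninf z) H => [r _| |]//=.
rewrite lee_fin; lra.
Unshelve. all: by end_near. Qed.

(** Differentiability bounds psi (x + h) - psi x - <h, v> by e |h| near 0, so <h, y - v> <= e |h| at
    all small h for which x + h is rational. Density extends this to every small h, scaling to every
    w, and w = y - v gives |y - v|^2 = 0 as e tends to 0. *)
Lemma subgradient_unique x v y : is_gradient_at psi x v ->
  (forall n, psi (rat_rV n) \is a fin_num ->
    fine (psi x) + dot (rat_rV n - x) y <= fine (psi (rat_rV n))) -> y = v.
Proof.
move=> gx sub; have fx := is_gradient_fin gx; case: gx => nfin dif gv.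
set g := fine \o psi.
have frechet (e : R) : 0 < e -> \forall h \near (0 : 'rV[R]_d),
    g (h + x) - g x - dot h v <= e * `|h|.
  move=> e0; have /eqaddoP/(_ e e0) := diff_locally dif; rewrite -/g.
  apply: filterS => h /=.
  rewrite !fctE (diff_dot _ dif gv) => H.
  by apply: le_trans H; rewrite opprD addrA ler_norm.
have dir (e : R) w : 0 < e -> dot w (y - v) <= e * `|w|.
  move=> e0.
  have nx : \forall h \near (0 : 'rV[R]_d), psi (h + x) \is a fin_num.
    have shx : (h + x) @[h --> (0 : 'rV[R]_d)] --> x.
      by have := @cvg_shiftr R 'rV[R]_d 0 x; rewrite add0r.
    exact: (shx _ nfin).
  have F2 : \forall h \near (0 : 'rV[R]_d), \forall k \near h,
      g (k + x) - g x - dot k v <= e * `|k| /\ psi (k + x) \is a fin_num.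
    by apply: nbhs_interior; have F := frechet e e0; near=> k; split; near: k.
  have loc : \forall h \near (0 : 'rV[R]_d), dot h (y - v) <= e * `|h|.
    apply: filterS F2 => h F2; rewrite leNgt; apply/negP => H.
    (* A strict violation at h would persist on a neighbourhood of h, which contains a translate of
       a rational point. *)
    have bad : \forall k \near h, e * `|k| < dot k (y - v).
      have ch : {for h, continuous (fun k : 'rV[R]_d => dot k (y - v) - e * `|k|)}.
        apply: continuousB; first exact: continuous_dotl.
        by apply: continuousM; [exact: cst_continuous|exact: norm_continuous].
      have H' : 0 < dot h (y - v) - e * `|h| by rewrite subr_gt0.
      have := cvgr_gt _ ch _ H' => /(_ (nbhs_filter _)).
      by apply: filterS => k; rewrite subr_gt0.
    have shx : (q - x) @[q --> h + x] --> h.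
      by have := @cvg_shiftr R 'rV[R]_d (h + x) (- x); rewrite addrK.
    have [n [B [G fn]]] := rat_rV_dense (shx _ (filterI bad F2)).
    have := sub n; rewrite -[rat_rV n](subrK x) addrK fn => /(_ isT).
    rewrite dotBr in B; rewrite /g/= in G; lra.
  have tw : (t *: w) @[t --> (0 : R)] --> (0 : 'rV[R]_d).
    by rewrite -[X in _ --> X](scale0r w); apply: cvgZr_tmp; exact: cvg_id.
  have loct : \forall t \near (0 : R)^'+, dot (t *: w) (y - v) <= e * `|t *: w|.
    suff : nbhs (0 : R) (fun t : R => 0 < t -> dot (t *: w) (y - v) <= e * `|t *: w|) by [].
    have twl : nbhs (0 : R) [set t | dot (t *: w) (y - v) <= e * `|t *: w|] by exact: (tw _ loc).
    by apply: filterS twl => t /= H _.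
  near (0 : R)^'+ => t.
  have t0 : 0 < t by near: t; exact: nbhs_right_gt.
  have : dot (t *: w) (y - v) <= e * `|t *: w| by near: t.
  by rewrite dotZl normrZ gtr0_norm// mulrCA ler_pM2l.
have : sqnorm (y - v) <= 0.
  apply/ler_addgt0Pl => e e0; rewrite addr0.
  (* The summand 1 keeps the denominator positive when y = v. *)
  have n1 : 0 < `|y - v| + 1 by rewrite ltr_wpDl.
  apply: (le_trans (dir (e / (`|y - v| + 1)) _ _)); first by rewrite divr_gt0.
  by rewrite mulrAC ler_pdivrMr// ler_pM2l// lerDl.
move=> s0; apply/eqP; rewrite -subr_eq0; apply/eqP/sqnorm_eq0/eqP.
rewrite eq_le s0/= sumr_ge0// => i _; by rewrite -expr2 sqr_ge0.
Unshelve. all: by end_near.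
Qed.

End gradient.

Section integrals_ae.
Context d (T : measurableType d) (R : realType) (mu : {measure set T -> \bar R}).

Lemma integrable_mul_sq (f g : T -> R) :
  measurable_fun setT f -> measurable_fun setT g ->
  mu.-integrable setT (fun x => (f x ^+ 2)%:E) ->
  mu.-integrable setT (fun x => (g x ^+ 2)%:E) ->
  mu.-integrable setT (fun x => (f x * g x)%:E).
Proof.
move=> mf mg f2 g2.
apply: (@le_integrable _ _ _ mu setT measurableT _ (fun x => (f x ^+ 2 + g x ^+ 2)%:E)).
- by apply/measurable_EFinP; exact: measurable_funM.
- move=> x _ /=; rewrite lee_fin normrM [leRHS]ger0_norm ?addr_ge0 ?sqr_ge0//.
  rewrite -[f x ^+ 2]real_normK ?num_real// -[g x ^+ 2]real_normK ?num_real//.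
  have := sqr_ge0 (`|f x| - `|g x|); have := sqr_ge0 (`|f x| + `|g x|); nra.
- exact: integrable_realD.
Qed.

Lemma ae_ge0_Rintegral (k : T -> R) : mu.-integrable setT (fun x => (k x)%:E) ->
  {ae mu, forall x, 0 <= k x} ->
  0 <= \int[mu]_x k x /\ (\int[mu]_x k x = 0 -> {ae mu, forall x, k x = 0}).
Proof.
move=> ik k0; have mk := measurable_integrable ik.
have E : \int[mu]_x k x = \int[mu]_x `|k x|.
  apply: ae_eq_Rintegral => //; first exact: measurableT_comp.
  by apply: filterS k0 => x k0 _; rewrite ger0_norm.
split; first by rewrite E; apply: Rintegral_ge0.
rewrite E => H.
have : ae_eq mu setT (EFin \o k) (cst 0%E).
  apply/(@ae_eq_integral_abs _ _ _ mu setT measurableT); first exact/measurable_EFinP.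
  rewrite -[LHS]fineK; last first.
    by apply: integrable_fin_num => //; exact: (integrable_abse ik).
  by congr EFin.
by apply: filterS => x /(_ I) /= [].
Qed.

End integrals_ae.

Section pushforward_law.
Context {R : realType} {d : nat}.
Variables (P nu : probability 'rV[R]_d R) (S : 'rV[R]_d -> 'rV[R]_d).
Hypotheses (mS : measurable_fun setT S)
  (SP : forall B, measurable B -> pushforward P S B = nu B).

Let Sm : {mfun 'rV[R]_d >-> 'rV[R]_d} := mfun_Sub (mem_set mS).

Let SmE : forall B, measurable B -> distribution P Sm B = nu B.
Proof. exact: SP. Qed.

Lemma ge0_integral_push (f : 'rV[R]_d -> \bar R) : measurable_fun setT f ->
  (forall y, 0 <= f y)%E -> (\int[nu]_y f y = \int[P]_x f (S x))%E.
Proof.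
move=> mf f0; rewrite -(@ge0_integral_distribution _ _ _ _ _ P Sm)//.
by apply: eq_measure_integral => A mA _; exact/esym/SmE.
Qed.

Lemma integrable_push (u : 'rV[R]_d -> R) : measurable_fun setT u ->
  nu.-integrable setT (fun y => (u y)%:E) <-> P.-integrable setT (fun x => (u (S x))%:E).
Proof.
move=> mU; have E : (\int[nu]_y `|(u y)%:E| = \int[P]_x `|(u (S x))%:E|)%E.
  by rewrite ge0_integral_push//; apply: measurableT_comp => //; exact/measurable_EFinP.
split => /integrableP[_ ?]; apply/integrableP; split.
- by apply/measurable_EFinP; exact: measurableT_comp.
- by rewrite -E.
- exact/measurable_EFinP.
- by rewrite E.
Qed.

Lemma Rintegral_push (u : 'rV[R]_d -> R) : measurable_fun setT u ->
  nu.-integrable setT (fun y => (u y)%:E) ->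
  \int[nu]_y u y = \int[P]_x u (S x).
Proof.
move=> mU iu; have iS := (integrable_push mU).1 iu; rewrite /Rintegral; congr fine.
transitivity (\int[distribution P Sm]_y (u y)%:E)%E.
  by apply: eq_measure_integral => A mA _; exact/esym/SmE.
by rewrite integral_distribution//; exact/measurable_EFinP.
Qed.

Lemma ae_push (Q : 'rV[R]_d -> Prop) : {ae nu, forall y, Q y} -> {ae P, forall x, Q (S x)}.
Proof.
move=> [M [mM M0 QM]]; exists (S @^-1` M); split.
- by rewrite -[X in measurable X]setTI; exact: mS.
- by have := SP mM; rewrite M0.
- by move=> x /= ?; exact: QM.
Qed.

Lemma push_ae (Q : set 'rV[R]_d) : measurable Q -> {ae P, forall x, Q (S x)} ->
  {ae nu, forall y, Q y}.
Proof.
move=> mQ [M [mM M0 QM]]; have mQC := measurableC mQ.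
exists (~` Q); split => //.
rewrite -SP//; apply/eqP; rewrite -measure_le0.
apply: (@le_trans _ _ (P M)); last by rewrite M0.
change (P (S @^-1` (~` Q)) <= P M)%E.
apply: le_measure; rewrite ?inE//.
by rewrite -[X in measurable X]setTI; exact: mS.
Qed.

End pushforward_law.

Section transport.
Context {R : realType} {d : nat}.
Variables (P nu : probability 'rV[R]_d R).

Definition second_moments (Q : probability 'rV[R]_d R) :=
  forall i, Q.-integrable setT (fun x => ((x : 'rV[R]_d) 0 i ^+ 2)%:E).

Hypotheses (P2 : second_moments P) (nu2 : second_moments nu).

Let coord_sq (Q : probability 'rV[R]_d R) (Z : 'rV[R]_d -> 'rV[R]_d) := measurable_fun setT Z /\
  forall i, Q.-integrable setT (fun x => (Z x 0 i ^+ 2)%:E).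

Lemma integrable_dot (Q : probability 'rV[R]_d R) Y Z : coord_sq Q Y -> coord_sq Q Z ->
  Q.-integrable setT (fun x => (dot (Y x) (Z x))%:E).
Proof.
move=> [mY Y2] [mZ Z2]; apply: integrable_sumr => // i.
apply: integrable_mul_sq => //.
- exact: (measurableT_comp (measurable_coord i) mY).
- exact: (measurableT_comp (measurable_coord i) mZ).
Qed.

Lemma coord_sq_cst Q v : coord_sq Q (fun=> v).
Proof.
by split => // i; exact: finite_measure_integrable_cst.
Qed.

Lemma coord_sq_push S : measurable_fun setT S ->
  (forall B, measurable B -> pushforward P S B = nu B) -> coord_sq P S.
Proof.
move=> mS SP; split => // i.
have m : measurable_fun setT (fun y : 'rV[R]_d => y 0 i ^+ 2).
  by apply: measurable_funX; exact: measurable_coord.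
exact: (integrable_push mS SP m).1 (nu2 i).
Qed.

Section potential.
Variable psi : 'rV[R]_d -> \bar R.
Hypothesis cpsi : convex_ereal psi.

(* Only rational points are used, so that the conjugate is measurable. *)
Definition conjugate (y : 'rV[R]_d) : \bar R := esups (fun n =>
  if psi (rat_rV n) \is a fin_num
  then (dot (rat_rV n) y - fine (psi (rat_rV n)))%:E else -oo%E) 0%N.

Lemma measurable_conjugate : measurable_fun setT conjugate.
Proof.
apply: measurable_fun_esups => n; case: (psi (rat_rV n) \is a fin_num) => //.
apply/measurable_EFinP; apply: measurable_funB => //.
exact: measurable_dot.
Qed.

Lemma conjugate_ge n y : psi (rat_rV n) \is a fin_num ->
  ((dot (rat_rV n) y - fine (psi (rat_rV n)))%:E <= conjugate y)%E.
Proof. by move=> fn; apply: ereal_sup_ubound; exists n => //=; rewrite fn. Qed.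

(** The supremum in [conjugate] sees rational points only; psi is continuous where it is
    differentiable, so rational points near x come within e of the value at x. *)
Lemma fenchel x v y : is_gradient_at psi x v ->
  ((dot x y - fine (psi x))%:E <= conjugate y)%E.
Proof.
move=> [nfin dif _]; apply/lee_addgt0Pr => e e0.
have e2 : 0 < e / 2 by rewrite divr_gt0.
have A1 : \forall q \near x, fine (psi q) < fine (psi x) + e / 2.
  have ct : {for x, continuous (fine \o psi)} by exact: differentiable_continuous.
  by apply: (cvgr_lt _ ct); rewrite ltrDl.
have A2 : \forall q \near x, dot x y - e / 2 < dot q y.
  have ct : {for x, continuous (fun q => dot q y)} by exact: continuous_dotl.
  by apply: (cvgr_gt _ ct); rewrite gtrBl.
have [n [fn [B1 B2]]] := rat_rV_dense (filterI nfin (filterI A1 A2)).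
apply: (le_trans _ (leeD2r e%:E (conjugate_ge y fn))).
by rewrite -EFinD lee_fin; lra.
Qed.

(** The equality case of Fenchel's inequality: the gradient inequality at x says that x maximises
    <q, v> - psi q. *)
Lemma conjugate_gradient x v : is_gradient_at psi x v ->
  conjugate v = (dot x v - fine (psi x))%:E.
Proof.
move=> gx; apply/eqP; rewrite eq_le (fenchel _ gx) andbT.
apply: ge_ereal_sup => _ [n _ <-]; case: ifPn => fn; last exact: leNye.
have := gradient_inequality cpsi gx fn.
by rewrite lee_fin dotBl; lra.
Qed.

Variables T S : 'rV[R]_d -> 'rV[R]_d.
Hypotheses (mT : measurable_fun setT T) (mS : measurable_fun setT S).
Hypotheses (TP : forall B, measurable B -> pushforward P T B = nu B)
  (SP : forall B, measurable B -> pushforward P S B = nu B).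
Hypothesis gT : {ae P, forall x, is_gradient_at psi x (T x)}.

(* psi x + psi^* y - <x, y> is nonnegative and vanishes exactly at the gradient
   y of psi; integrate it over y = S x. Nothing being known about the
   measurability of psi, it is replaced by <x, T x> - psi^*(T x), and psi^*(T x)
   is integrable because it lies between the affine bounds L1 and L2. *)
Lemma transport_le :
  \int[P]_x dot x (S x) <= \int[P]_x dot x (T x) /\
  (\int[P]_x dot x (S x) = \int[P]_x dot x (T x) -> {ae P, forall x, S x = T x}).
Proof.
have [x0 gx0] : exists x0, is_gradient_at psi x0 (T x0).
  apply/not_existsP => H; have [M [mM M0 QM]] := gT.
  have : (P setT <= P M)%E.
    by apply: le_measure; rewrite ?inE// => x _; apply: QM; exact: H.
  by rewrite M0 probability_setT; rewrite leNgt lte01.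
pose u y := fine (conjugate y).
have mu' : measurable_fun setT u by apply: measurableT_comp => //; exact: measurable_conjugate.
have sqid : coord_sq P id by split => //; exact: P2.
have sqT : coord_sq P T by exact: coord_sq_push.
have sqS : coord_sq P S by exact: coord_sq_push.
have idT := integrable_dot sqid sqT; have idS := integrable_dot sqid sqS.
(* Both bounds come from a single point x0 with a gradient: L1 is Fenchel's inequality at x0, and L2
   the gradient inequality at x0 inserted into psi^*(T x) = <x, T x> - psi x. *)
pose L1 x := dot x0 (T x) - fine (psi x0).
pose L2 x := dot x (T x) - (fine (psi x0) + dot (x - x0) (T x0)).
have iL1 : P.-integrable setT (fun x => (L1 x)%:E).
  apply: integrable_realB => //; last exact: finite_measure_integrable_cst.
  exact: (integrable_dot (coord_sq_cst P x0) sqT).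
have iL2 : P.-integrable setT (fun x => (L2 x)%:E).
  apply: integrable_realB => //; apply: integrable_realD => //.
    exact: finite_measure_integrable_cst.
  under eq_fun do rewrite dotBl.
  apply: integrable_realB => //; first exact: (integrable_dot sqid (coord_sq_cst P _)).
  exact: finite_measure_integrable_cst.
have uT : {ae P, forall x, conjugate (T x) = (u (T x))%:E /\
    u (T x) = dot x (T x) - fine (psi x) /\ L1 x <= u (T x) <= L2 x}.
  apply: filterS gT => x gx; rewrite /u (conjugate_gradient gx)/=; split => //; split => //.
  apply/andP; split.
    by rewrite -lee_fin -(conjugate_gradient gx); exact: (fenchel (T x) gx0).
  rewrite /L2 lerD2l lerN2; apply: (gradient_inequality cpsi gx0).
  exact: is_gradient_fin gx.
have iuT : P.-integrable setT (fun x => (u (T x))%:E).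
  (* The bounds hold almost everywhere; clamping makes the domination hold at every point. *)
  pose g x := Num.max (L1 x) (Num.min (L2 x) (u (T x))).
  have mg : measurable_fun setT g.
    apply: measurable_maxr; first exact: (measurable_integrable iL1).
    apply: measurable_minr; first exact: (measurable_integrable iL2).
    exact: measurableT_comp.
  apply: (@ae_eq_integrable _ _ _ P setT measurableT g).
  - exact: measurableT_comp.
  - apply: filterS uT => x [_ [_ /andP[h1 h2]]] _.
    by rewrite /g min_r// max_r.
  - apply: (@le_integrable _ _ _ P setT measurableT _ (fun x => (`|L1 x| + `|L2 x|)%:E)).
    + exact/measurable_EFinP.
    + move=> x _ /=; rewrite lee_fin [leRHS]ger0_norm ?addr_ge0// /g.
      rewrite /Num.max /Num.min.
      have := ler_norm (L1 x); have := ler_norm (- L1 x); have := ler_norm (L2 x); have := ler_norm (- L2 x).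
      have := normr_ge0 (L1 x); have := normr_ge0 (L2 x).
      rewrite !normrN ler_norml.
      by case: (ltP (L2 x) (u (T x))) => h1; case: (ltP (L1 x)) => h2; move=> *; apply/andP; split; lra.
    + by apply: integrable_realD => //; exact: integrable_norm.
pose f x := dot x (T x) - u (T x).
have if_ : P.-integrable setT (fun x => (f x)%:E) by exact: integrable_realB.
have iu : nu.-integrable setT (fun y => (u y)%:E) by exact/(integrable_push mT TP mu').
have iuS : P.-integrable setT (fun x => (u (S x))%:E) by exact/(integrable_push mS SP mu').
(* The conjugate is finite at T x almost surely, hence nu-almost everywhere, hence at S x almost
   surely, because T and S push P to the same law. *)
have uS : {ae P, forall x, conjugate (S x) = (u (S x))%:E}.
  have : {ae nu, forall y, conjugate y \is a fin_num}.
    apply: (push_ae mT TP).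
      rewrite -[X in measurable X]setTI; apply: emeasurable_fin_num => //.
      exact: measurable_conjugate.
    by apply: filterS uT => x [-> _].
  by move/(ae_push mS SP); apply: filterS => x /fineK.
pose k x := f x + u (S x) - dot x (S x).
have ik : P.-integrable setT (fun x => (k x)%:E).
  by apply: integrable_realB => //; exact: integrable_realD.
have k0 : {ae P, forall x, 0 <= k x}.
  apply: filterS3 gT uS uT => x gx uS [_ [fE _]].
  have := fenchel (S x) gx; rewrite uS lee_fin /k /f fE; lra.
have [kge keq] := ae_ge0_Rintegral ik k0.
(* The integrals of u(T x) and u(S x) both equal the integral of u under nu, and cancel. *)
have kE : \int[P]_x k x = \int[P]_x dot x (T x) - \int[P]_x dot x (S x).
  rewrite RintegralB//; last exact: integrable_realD.
  rewrite RintegralD// RintegralB//.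
  by rewrite -(Rintegral_push mT TP mu' iu) -(Rintegral_push mS SP mu' iu) subrK.
rewrite kE in kge keq; split; first by rewrite -subr_ge0.
move=> E; have k00 : {ae P, forall x, k x = 0} by apply: keq; rewrite E subrr.
have kuS : {ae P, forall x, k x = 0 /\ conjugate (S x) = (u (S x))%:E} by exact: filterI.
apply: filterS3 kuS uT gT => x [kx uSx] [_ [fE _]] gx.
(* Since k x = 0, psi^*(S x) = <x, S x> - psi x, so the terms of the supremum say that S x is a
   subgradient of psi at x along the rational points. *)
apply: (subgradient_unique gx) => n fn.
have := conjugate_ge (S x) fn; rewrite uSx lee_fin dotBl.
move: kx; rewrite /k /f fE; lra.
Qed.

End potential.

(** Each map is a competitor for the potential of the other, so E<x, T x> = E<x, S x>, and the
    equality case of [transport_le] applies. *)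
Lemma rank_map_unique (T S : 'rV[R]_d -> 'rV[R]_d) :
  is_rank_map P nu T -> is_rank_map P nu S -> {ae P, forall x, T x = S x}.
Proof.
move=> [mT TP [psi cpsi gT]] [mS SP [phi cphi gS]].
have [le1 _] := transport_le cphi mS mT SP TP gS.
have [le2 eq2] := transport_le cpsi mT mS TP SP gT.
have : {ae P, forall x, S x = T x} by apply: eq2; apply/eqP; rewrite eq_le le1 le2.
by apply: filterS => x ->.
Qed.

End transport.

Lemma continuous_near_gt {R : realType} (V : topologicalType) (f : V -> R) t a :
  {for t, continuous f} -> a < f t -> \forall s \near t, a < f s.
Proof. by move=> cf at_; exact: (cvgr_gt (f t) cf a at_). Qed.

Lemma continuous_near_lt {R : realType} (V : topologicalType) (f : V -> R) t a :
  {for t, continuous f} -> f t < a -> \forall s \near t, f s < a.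
Proof. by move=> cf at_; exact: (cvgr_lt (f t) cf a at_). Qed.

(** * The coordinatewise transport *)

Section pcdf_uniform.
Context {R : realType} (c : R -> R).
Hypothesis pc : is_pdf c.
Let mu := (@lebesgue_measure R).
Let F := pcdf c.

Let c0 t : 0 <= c t. Proof. by case: pc. Qed.

Lemma measurable_pcdf : measurable_fun setT F.
Proof. by apply: nondecreasing_measurable => //; exact: pcdf_nondecreasing. Qed.

Lemma measurable_pcdf_gt u : measurable [set t | u < F t].
Proof.
rewrite (_ : [set t | _] = F @^-1` `]u, +oo[%classic); last first.
  by apply/seteqP; split => t /=; rewrite in_itv/= andbT.
by rewrite -[X in measurable X]setTI; exact: measurable_pcdf.
Qed.

Let int_le (A B : set R) : measurable A -> measurable B -> A `<=` B ->
  \int[mu]_(t in A) c t <= \int[mu]_(t in B) c t.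
Proof.
move=> mA mB AB; rewrite /Rintegral fine_le//.
- by apply: integrable_fin_num => //; exact: integrable_pdf.
- by apply: integrable_fin_num => //; exact: integrable_pdf.
- apply: ge0_subset_integral => //; last by move=> s _; rewrite lee_fin.
  by have /integrableP[] := integrable_pdf pc mB.
Qed.

(** The probability integral transform. F may have flat pieces, so {u < F} is compared from both
    sides with half-lines that begin at a point where F takes a value v close to u. F reaches every
    v in ]0, 1[, but perhaps not 0 and 1, which is why v is kept inside and the extreme values of u
    are split off. *)
Lemma pcdf_uniform (u : R) : 0 <= u <= 1 -> \int[mu]_(t in [set t | u < F t]) c t = 1 - u.
Proof.
move=> /andP[u0 u1]; apply/eqP; rewrite eq_le; apply/andP; split.
  have sub v : 0 < v < 1 -> v <= u -> \int[mu]_(t in [set t | u < F t]) c t <= 1 - v.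
    move=> v01 vu; have [q qv] := pcdf_surj pc v01.
    rewrite -qv -ccdf_pdf//; apply: int_le => //; first exact: measurable_pcdf_gt.
    move=> t /= ut; rewrite in_itv/= andbT ltNge; apply/negP => /(pcdf_nondecreasing pc).
    by rewrite qv => tv; move: ut; rewrite ltNge (le_trans tv).
  have [u00|u00] := eqVneq u 0.
    rewrite u00 subr0 -[leRHS](_ : \int[mu]_t c t = 1); last first.
      by rewrite /Rintegral; case: pc => _ _ ->.
    by apply: int_le => //; exact: measurable_pcdf_gt.
  have ugt0 : 0 < u by rewrite lt_neqAle eq_sym u00.
  apply/ler_addgt0Pr => e e0.
  have : \int[mu]_(t in [set t | u < F t]) c t <= 1 - Num.max (u / 2) (u - e / 2).
    apply: sub; first by rewrite /Num.max; case: (ltP (u / 2)) => ?; apply/andP; split; lra.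
    by rewrite /Num.max; case: (ltP (u / 2)) => ?; lra.
  rewrite /Num.max; case: (ltP (u / 2)) => ?; lra.
have [u11|u11] := eqVneq u 1.
  by rewrite u11 subrr; apply: Rintegral_ge0.
have ult1 : u < 1 by rewrite lt_neqAle u11.
apply/ler_addgt0Pr => e e0.
have sub v : u < v < 1 -> 1 - v <= \int[mu]_(t in [set t | u < F t]) c t.
  move=> /andP[uv v1]; have [|q qv] := @pcdf_surj _ _ pc v; first by rewrite v1 (le_lt_trans u0).
  rewrite -qv -ccdf_pdf//; apply: int_le => //; first exact: measurable_pcdf_gt.
  move=> t /=; rewrite in_itv/= andbT => /ltW/(pcdf_nondecreasing pc).
  by rewrite qv; exact: lt_le_trans.
have : 1 - Num.min ((u + 1) / 2) (u + e) <= \int[mu]_(t in [set t | u < F t]) c t.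
  by apply: sub; rewrite /Num.min; case: (ltP ((u + 1) / 2)) => ?; apply/andP; split; lra.
rewrite /Num.min; case: (ltP ((u + 1) / 2)) => ?; lra.
Qed.

End pcdf_uniform.

Section quantile.
Context {R : realType}.

(* The last clause says that pcdf g increases strictly to the right of k u; it
   makes the transport below continuous, hence its potential differentiable. *)
Definition is_quantile (g k : R -> R) := forall u z, 0 < u < 1 ->
  ((k u <= z) = (u <= pcdf g z)) /\ (k u < z -> u < pcdf g z).

Variables (c g k : R -> R).
Hypotheses (pc : is_pdf c) (pg : is_pdf g) (kg : is_quantile g k).
Let mu := (@lebesgue_measure R).
Let F := pcdf c.
Let G := pcdf g.

(* The value 0 off the interior of the range of F is immaterial: that set is
   negligible. *)
Definition monotone_transport t : R := if 0 < F t < 1 then k (F t) else 0.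

Local Notation S := monotone_transport.

Lemma monotone_transport_le t z : 0 < F t < 1 -> (S t <= z) = (F t <= G z).
Proof. by move=> t01; rewrite /S t01 (kg z t01).1. Qed.

Lemma monotone_transport_nd s t : 0 < F s < 1 -> 0 < F t < 1 -> s <= t -> S s <= S t.
Proof.
move=> s01 t01 st; rewrite monotone_transport_le// (le_trans (pcdf_nondecreasing pc st))//.
by rewrite -[_ <= _](monotone_transport_le _ t01).
Qed.

Lemma pcdf_interior_open t : 0 < F t < 1 -> \forall s \near t, 0 < F s < 1.
Proof.
move=> /andP[t0 t1]; have cF := @pcdf_continuous _ _ pc t.
have h1 := continuous_near_gt cF t0; have h2 := continuous_near_lt cF t1.
by apply: filterS2 h1 h2 => s h1 h2; apply/andP.
Qed.

(** F is continuous, so G(S t - e) < F t < G(S t + e / 2) persists near t and bounds S there. The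
    right-hand inequality is the strict clause of [is_quantile]. *)
Lemma monotone_transport_continuous t : 0 < F t < 1 -> {for t, continuous S}.
Proof.
move=> t01; have cF := @pcdf_continuous _ _ pc t.
have near_I := pcdf_interior_open t01.
apply/(cvgrPdist_lt (FF := nbhs_filter t)) => e e0.
have a1 : F t < G (S t + e / 2).
  by have := (kg (S t + e / 2) t01).2; rewrite /S t01; apply; rewrite ltrDl divr_gt0.
have a2 : G (S t - e) < F t.
  rewrite ltNge -(monotone_transport_le _ t01) -ltNge; lra.
have h1 := continuous_near_lt cF a1; have h2 := continuous_near_gt cF a2.
apply: filterS3 near_I h1 h2 => s s01 h1 h2.
have : S s <= S t + e / 2 by rewrite monotone_transport_le//; exact: ltW.
have : S t - e < S s by rewrite ltNge monotone_transport_le// -ltNge.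
move=> ? ?; rewrite ltr_distlC; apply/andP; split; lra.
Qed.

Lemma measurable_interior : measurable [set t | 0 < F t < 1].
Proof.
rewrite (_ : [set t | _] = F @^-1` `]0, 1[%classic); last first.
  by apply/seteqP; split => t /=; rewrite in_itv/=.
by rewrite -[X in measurable X]setTI; exact: (measurable_pcdf pc).
Qed.

Lemma measurable_monotone_transport : measurable_fun setT S.
Proof.
apply: (measurability (@RGenOInfty.G R)) => //; first exact: RGenOInfty.measurableE.
move=> _ [_ [z ->] <-]; rewrite setTI.
(* S is monotone on the interior only; the default 0 taken elsewhere lies in ]z, +oo[ or not,
   according to the sign of z. *)
rewrite (_ : S @^-1` _ = ([set t | 0 < F t < 1] `&` [set t | G z < F t]) `|`
    (~` [set t | 0 < F t < 1] `&` [set t | z < 0])).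
  apply: measurableU; apply: measurableI.
  - exact: measurable_interior.
  - exact: measurable_pcdf_gt.
  - by apply: measurableC; exact: measurable_interior.
  - by case: (z < 0); [rewrite (_ : [set t | _] = setT)//|rewrite (_ : [set t | _] = set0)//]; apply/seteqP; split.
apply/seteqP; split => t /=; rewrite in_itv/= andbT.
  case t01 : (0 < F t < 1); last by rewrite /S t01 => ?; right; split => //; rewrite t01.
  by rewrite ltNge monotone_transport_le// -ltNge => ?; left.
case=> [[t01 ?]|[t01 ?]]; last by rewrite /S; move/negP/negbTE : t01 => ->.
by rewrite ltNge monotone_transport_le// -ltNge.
Qed.

End quantile.

Lemma measure_ae_le d (T : measurableType d) (R : realType) (m : {measure set T -> \bar R})
  (A B : set T) : measurable A -> measurable B -> {ae m, forall x, A x -> B x} -> (m A <= m B)%E.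
Proof.
move=> mA mB [M [mM M0 AB]]; rewrite -[leRHS]adde0 -M0.
apply: (@le_trans _ _ (m (B `|` M))); last exact: measureU2.
apply: le_measure; rewrite ?inE//; first exact: measurableU.
move=> x Ax; have [Bx|Bx] := pselect (B x); first by left.
by right; apply: AB => /= /(_ Ax).
Qed.

Lemma measure_ae_eq d (T : measurableType d) (R : realType) (m : {measure set T -> \bar R})
  (A B : set T) : measurable A -> measurable B -> {ae m, forall x, A x <-> B x} -> m A = m B.
Proof.
move=> mA mB AB; apply/eqP; rewrite eq_le; apply/andP; split.
- by apply: measure_ae_le => //; apply: filterS AB => x [].
- by apply: measure_ae_le => //; apply: filterS AB => x [].
Qed.

Lemma measurable_coord_preimage {R : realType} {d : nat} (i : 'I_d) (A : set R) :
  measurable A -> measurable [set x : 'rV[R]_d | A (x 0 i)].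
Proof. by move=> mA; rewrite -[X in measurable X]setTI; exact: measurable_coord. Qed.

Section rank_push.
Context {R : realType} {d : nat}.
Variables (P nu : probability 'rV[R]_d R) (c : 'I_d -> R -> R) (g k : R -> R).
Hypotheses (Pc : product_law P c) (nug : product_law nu (fun=> g)) (kg : is_quantile g k).
Let mu := (@lebesgue_measure R).

Let pc i : is_pdf (c i). Proof. by case: Pc. Qed.

Local Notation S i := (monotone_transport (c i) k).

Lemma product_law_pcdf_gt i u : 0 <= u <= 1 ->
  P [set x | u < pcdf (c i) (x 0 i)] = (1 - u)%:E.
Proof.
move=> u01; rewrite (product_law_coord Pc i (A := [set t | u < pcdf (c i) t])); last exact: measurable_pcdf_gt.
rewrite -(pcdf_uniform (pc i) u01) /Rintegral fineK//.
by apply: (pdf_integral_fin_num Pc); exact: measurable_pcdf_gt.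
Qed.

Let mgt i u : measurable [set x : 'rV[R]_d | u < pcdf (c i) (x 0 i)].
Proof.
exact: (measurable_coord_preimage i (measurable_pcdf_gt (pc i) u)).
Qed.

(** F_i(x_i) is uniform: P(0 < F_i) = 1, and P(1 <= F_i) <= P(v < F_i) = 1 - v for every v < 1. *)
Lemma interior_ae : {ae P, forall x : 'rV[R]_d, forall i, 0 < pcdf (c i) (x 0 i) < 1}.
Proof.
apply: filter_forall => i.
have A0 : {ae P, forall x : 'rV[R]_d, 0 < pcdf (c i) (x 0 i)}.
  exists (~` [set x : 'rV[R]_d | 0 < pcdf (c i) (x 0 i)]); split => //.
    exact: measurableC.
  by rewrite probability_setC// product_law_pcdf_gt ?lexx ?ler01// subr0 subee.
have A1 : {ae P, forall x : 'rV[R]_d, pcdf (c i) (x 0 i) < 1}.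
  have m1 : measurable [set x : 'rV[R]_d | 1 <= pcdf (c i) (x 0 i)].
    apply: (measurable_coord_preimage i (A := [set t | 1 <= pcdf (c i) t])).
    rewrite (_ : [set t | _] = pcdf (c i) @^-1` `[1, +oo[%classic); last first.
      by apply/seteqP; split => t /=; rewrite in_itv/= andbT.
    by rewrite -[X in measurable X]setTI; exact: (measurable_pcdf (pc i)).
  exists [set x : 'rV[R]_d | 1 <= pcdf (c i) (x 0 i)]; split => //; last first.
    by move=> x /= /negP; rewrite -leNgt.
  apply/eqP; rewrite -measure_le0; apply/lee_addgt0Pr => e e0; rewrite add0e.
  pose v := Num.max 0 (1 - e).
  have v01 : 0 <= v <= 1 by rewrite /v /Num.max; case: (ltP 0 (1 - e)) => ?; apply/andP; split; lra.
  have v1 : v < 1 by rewrite /v /Num.max; case: (ltP 0 (1 - e)) => ?; lra.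
  apply: (@le_trans _ _ (P [set x | v < pcdf (c i) (x 0 i)])).
    apply: le_measure; rewrite ?inE//; first exact: (mgt i v).
    by move=> x /=; exact: lt_le_trans.
  rewrite product_law_pcdf_gt// lee_fin /v /Num.max; case: (ltP 0 (1 - e)) => ?; lra.
by apply: filterS2 A0 A1 => x ? ?; apply/andP.
Qed.

Let mSc i : measurable_fun setT (fun x : 'rV[R]_d => (S i (x 0 i) : measurableTypeR R)).
Proof.
exact: (measurableT_comp (measurable_monotone_transport (pc i) kg) (measurable_coord i)).
Qed.

Let Sm i : {mfun 'rV[R]_d >-> measurableTypeR R} := mfun_Sub (mem_set (mSc i)).

(** Almost surely z < S_i(x_i) if and only if G z < F_i(x_i), an event of probability 1 - G z.
    Half-lines determine the law. *)
Lemma monotone_transport_law i A : measurable A ->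
  P [set x | A (S i (x 0 i))] = (\int[mu]_(t in A) (g t)%:E)%E.
Proof.
move=> mA; rewrite -(product_law_coord nug i)//.
pose m1 : {measure set (measurableTypeR R) -> \bar R} := distribution P (Sm i).
pose m2 : {measure set (measurableTypeR R) -> \bar R} := marginal nu i.
change (m1 A = m2 A).
apply: (@measure_unique _ R (measurableTypeR R) (@RGenOInfty.G R) (fun n => `](- n%:R : R), +oo[%classic) _ _ _ _ m1 m2) => //.
- exact: RGenOInfty.measurableE.
- move=> _ _ [x ->] [y ->]; exists (Num.max x y).
  by apply/seteqP; split => t /=; rewrite !in_itv/= !andbT gt_max; [move=> [-> ->]|move=> /andP[]].
- by move=> n; exists (- n%:R).
- apply/seteqP; split => // t _; exists (Num.bound `|t|) => //=.
  rewrite in_itv/= andbT; have := archi_boundP (normr_ge0 t); rewrite ltr_norml => /andP[].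
  by [].
- move=> _ [z ->].
  have -> : m2 `]z, +oo[%classic = (1 - pcdf g z)%:E.
    have pg : is_pdf g by case: nug => /(_ i).
    apply: etrans; first exact: (marginalE nug).
    rewrite -ccdf_pdf// /Rintegral fineK//.
    exact: (pdf_integral_fin_num nug i).
  have pg : is_pdf g by case: nug => /(_ i).
  rewrite -(product_law_pcdf_gt i (u := pcdf g z)) ?pcdf_ge0 ?pcdf_le1//.
  apply: (@measure_ae_eq _ _ _ P (Sm i @^-1` `]z, +oo[) [set x | pcdf g z < pcdf (c i) (x 0 i)]) => //.
    by rewrite -[X in measurable X]setTI; exact: mSc.
    exact: (mgt i (pcdf g z)).
  apply: filterS interior_ae => x /(_ i) xi; rewrite /= in_itv/= andbT.
  by rewrite ltNge (monotone_transport_le kg _ xi) -ltNge.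
- by move=> n; rewrite (le_lt_trans (probability_le1 _ _)) ?ltry.
Qed.

Definition coordinate_transport (x : 'rV[R]_d) : 'rV[R]_d := \row_i S i (x 0 i).

Lemma measurable_coordinate_transport : measurable_fun setT coordinate_transport.
Proof.
apply: measurable_fun_coordP => i; under eq_fun do rewrite mxE.
exact: mSc.
Qed.

Lemma coordinate_transport_push B : measurable B ->
  pushforward P coordinate_transport B = nu B.
Proof.
pose Tm : {mfun 'rV[R]_d >-> 'rV[R]_d} := mfun_Sub (mem_set measurable_coordinate_transport).
move: B; apply: (rV_measure_unique (m1 := distribution P Tm)) => [A mA|]; last first.
  by rewrite (le_lt_trans (probability_le1 _ _)) ?ltry.
apply: etrans; last by apply/esym; exact: (product_law_rect nug mA).
transitivity (P [set x : 'rV[R]_d | forall i, (S i @^-1` (A i)) (x 0 i)]).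
  by congr (P _); apply/seteqP; split => x /= H i; have := H i; rewrite mxE.
have mSA i : measurable (S i @^-1` A i).
  by rewrite -[X in measurable X]setTI; exact: (measurable_monotone_transport (pc i) kg).
apply: etrans; first exact: (product_law_rect Pc mSA).
congr EFin; apply: eq_bigr => i _; congr fine.
rewrite -(monotone_transport_law i (mA i)) -(product_law_coord Pc i (mSA i)).
by [].
Qed.

End rank_push.

(** * A convex potential for the coordinatewise transport *)

Section coordinate_potential.
Context {R : realType}.
Variables (c g k : R -> R).
Hypotheses (pc : is_pdf c) (kg : is_quantile g k).
Let mu := (@lebesgue_measure R).
Local Notation F := (pcdf c).
Local Notation S := (monotone_transport c k).

Lemma integral_ltB (s t : R) :
  mu.-integrable setT (fun r => ((r < t)%R%:R - (r < s)%R%:R)%:E) /\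
  \int[mu]_r ((r < t)%R%:R - (r < s)%R%:R) = t - s.
Proof.
wlog st : s t / s <= t.
  move=> H; have [/H//|/ltW/H[i1 i2]] := leP s t; split.
    have := integrable_realN i1.
    by apply: eq_integrable => // r _; rewrite opprB.
  have <- : - (s - t) = t - s by rewrite opprB.
  rewrite -i2 -mulN1r -RintegralZl//; apply: eq_Rintegral => r _; by rewrite mulN1r opprB.
have E r : (r < t)%R%:R - (r < s)%R%:R = \1_(`[s, t[%classic) r :> R.
  rewrite indicE mem_setE in_itv/=; case: (ltP r s) => rs /=.
    by rewrite (lt_le_trans rs st) subrr.
  by rewrite subr0.
under eq_fun do rewrite E; under [X in _ /\ X = _]eq_Rintegral do rewrite E.
split.
  exact: (@integrable_indic_itv R s t true true).
rewrite /Rintegral integral_indic// setIT.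
rewrite [X in fine X](@lebesgue_measure_itv R `[s, t[)/= lte_fin.
by case: ltP => // ts /=; lra.
Qed.

(* The integral of S from t0 to t, the indicators carrying the sign. *)
Definition monotone_potential (t0 t : R) : R :=
  \int[mu]_s (S s * ((s < t)%R%:R - (s < t0)%R%:R)).

Let mS : measurable_fun setT S := measurable_monotone_transport pc kg.

Let inI s r t : 0 < F s < 1 -> 0 < F t < 1 -> s <= r <= t -> 0 < F r < 1.
Proof.
move=> /andP[s0 s1] /andP[t1 t2] /andP[/(pcdf_nondecreasing pc) h1 /(pcdf_nondecreasing pc) h2].
by apply/andP; split; [exact: lt_le_trans h1|exact: le_lt_trans t2].
Qed.

Lemma integrable_potential t0 t : 0 < F t0 < 1 -> 0 < F t < 1 ->
  mu.-integrable setT (fun s => (S s * ((s < t)%R%:R - (s < t0)%R%:R))%:E).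
Proof.
move=> t00 t01; have mb (a : R) : measurable_fun setT (fun s : R => (s < a)%R%:R : R).
  exact: measurable_ltR.
pose M := `|S t0| + `|S t|.
apply: (@le_integrable _ _ _ mu setT measurableT _ (fun s => (M * ((s < t)%R%:R - (s < t0)%R%:R))%:E)).
- apply/measurable_EFinP; apply: measurable_funM => //.
  by apply: measurable_funB; exact: measurable_ltR.
- move=> s _ /=; rewrite lee_fin !normrM.
  have [->|D] := eqVneq ((s < t)%R%:R - (s < t0)%R%:R : R) 0; first by rewrite normr0 !mulr0.
  apply: ler_wpM2r => //; rewrite [leRHS]ger0_norm ?addr_ge0//.
  suff : S t0 <= S s <= S t \/ S t <= S s <= S t0.
    have := ler_norm (S t); have := ler_norm (- S t); have := ler_norm (S t0); have := ler_norm (- S t0).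
    rewrite !normrN ler_norml /M.
    move: `|S t| `|S t0| (S t) (S t0) (S s) => At At0 a a0 as_; clear.
    by move=> ? ? ? ? [/andP[? ?]|/andP[? ?]]; apply/andP; split; lra.
  move: D; case: (ltP s t) => st; case: (ltP s t0) => st0; rewrite ?subrr ?eqxx// => _.
    have si : 0 < F s < 1 by apply: (inI t00 t01); rewrite st0 ltW.
    by left; rewrite !(monotone_transport_nd pc kg)// ltW.
  have si : 0 < F s < 1 by apply: (inI t01 t00); rewrite st ltW.
  by right; rewrite !(monotone_transport_nd pc kg)// ltW.
- exact: (integrable_realMl measurableT M (integral_ltB _ _).1).
Qed.

(** S r - S s has the sign of r - s, because S is monotone; for t < s the difference of indicators
    is negative and reverses the comparison. *)
Lemma monotone_potential_sub t0 s t : 0 < F t0 < 1 -> 0 < F s < 1 -> 0 < F t < 1 ->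
  monotone_potential t0 s + S s * (t - s) <= monotone_potential t0 t.
Proof.
move=> t00 s01 t01; rewrite addrC -lerBrDr /monotone_potential -RintegralB//; try exact: integrable_potential.
have [i1 i2] := integral_ltB s t.
rewrite -i2 -RintegralZl//; apply: le_Rintegral => //.
- exact: (integrable_realMl measurableT (S s) i1).
- by apply: integrable_realB => //; exact: integrable_potential.
move=> r _; rewrite -mulrBr opprB addrA subrK.
case: (ltP r t) => rt; case: (ltP r s) => rs; rewrite /= ?subrr ?mulr0//.
  have ri : 0 < F r < 1 by apply: (inI s01 t01); rewrite rs ltW.
  by rewrite subr0 !mulr1 (monotone_transport_nd pc kg).
have ri : 0 < F r < 1 by apply: (inI t01 s01); rewrite rt ltW.
by rewrite sub0r !mulrN1 lerN2 (monotone_transport_nd pc kg)// ltW.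
Qed.

End coordinate_potential.

Section rank_map_exists.
Context {R : realType} {d : nat}.
Variables (P nu : probability 'rV[R]_d R) (c : 'I_d -> R -> R) (g k : R -> R).
Hypotheses (Pc : product_law P c) (nug : product_law nu (fun=> g)) (kg : is_quantile g k).

Let pc i : is_pdf (c i). Proof. by case: Pc. Qed.
Local Notation S i := (monotone_transport (c i) k).

Let median i : exists t, 0 < pcdf (c i) t < 1.
Proof.
have [|t tE] := @pcdf_surj _ _ (pc i) 2^-1; first by apply/andP; split; lra.
by exists t; rewrite tE; apply/andP; split; lra. Qed.

Let t0 i := projT1 (cid (median i)).
Let t0P i : 0 < pcdf (c i) (t0 i) < 1 := projT2 (cid (median i)).

Let inside (x : 'rV[R]_d) := `[< forall i, 0 < pcdf (c i) (x 0 i) < 1 >].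
Let phi i := monotone_potential (c i) k (t0 i).

(** The value +oo off the open box where every F_i lies in ]0, 1[ keeps the function convex: outside
    the box S_i is the default 0, and its primitive need not continue convexly. *)
Definition transport_potential (x : 'rV[R]_d) : \bar R :=
  if inside x then (\sum_i phi i (x 0 i))%:E else +oo%E.

Let sub x y : inside x -> inside y ->
  \sum_i phi i (x 0 i) + dot (y - x) (coordinate_transport c k x) <= \sum_i phi i (y 0 i).
Proof.
move=> /asboolP xi /asboolP yi; rewrite /dot -big_split/=; apply: ler_sum => i _.
by rewrite !mxE mulrC; exact: (monotone_potential_sub (pc i) kg (t0P i)).
Qed.

Lemma transport_potential_convex : convex_ereal transport_potential.
Proof.
split=> [x|x y t /andP[ht0 ht1]]; rewrite /transport_potential; first by case: (inside x).
have t'0 : 0 < 1 - t by rewrite subr_gt0.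
have [xi|xi] := boolP (inside x); last first.
  by rewrite gt0_muley ?lte_fin// addye ?leey//; case: (inside y); rewrite ?gt0_muley ?lte_fin.
have [yi|yi] := boolP (inside y); last first.
  by rewrite (@gt0_muley _ (1 - t)%:E) ?lte_fin// addey ?leey.
set z := t *: x + (1 - t) *: y.
(* The box is convex because each F_i is monotone. *)
have zi : inside z.
  apply/asboolP => i; rewrite !mxE.
  have /andP[x0 x1] := asboolW xi i; have /andP[y0 y1] := asboolW yi i.
  have h1 := @pcdf_nondecreasing _ _ (pc i).
  have [xy|/ltW xy] := leP (x 0 i) (y 0 i); apply/andP; split.
  - by apply: (lt_le_trans x0); apply: h1; nra.
  - by apply: le_lt_trans y1; apply: h1; nra.
  - by apply: (lt_le_trans y0); apply: h1; nra.
  - by apply: le_lt_trans x1; apply: h1; nra.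
rewrite zi -!EFinM -EFinD lee_fin.
(* Convexity from subgradients: the inequalities at z towards x and y are averaged with weights t
   and 1 - t, and their linear terms cancel. *)
have := sub zi xi; have := sub zi yi; rewrite /phi.
have -> : x - z = (1 - t) *: (x - y).
  by apply/rowP => i; rewrite !mxE; ring.
have -> : y - z = (- t) *: (x - y).
  by apply/rowP => i; rewrite !mxE; ring.
rewrite !dotZl; move: (dot _ _) (\sum_i _) (\sum_i _) (\sum_i _) => D a b e; nra.
Qed.

Section gradient_at.
Variable x : 'rV[R]_d.
Hypothesis xi : forall i, 0 < pcdf (c i) (x 0 i) < 1.
Let v := coordinate_transport c k x.

Let dotv (y : 'rV[R]_d) : R := dot y v.

Let dotv_linear : linear dotv.
Proof. by move=> a y z; rewrite /dotv dotDl dotZl. Qed.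

HB.instance Definition _ := GRing.isLinear.Build R 'rV[R]_d R _ dotv dotv_linear.

Let coord_cts i : {for x, continuous (fun y : 'rV[R]_d => y 0 i)}.
Proof. exact: coord_continuous. Qed.

Let near_forall (Q : 'I_d -> set R) : (forall i, nbhs (x 0 i) (Q i)) ->
  nbhs x [set y : 'rV[R]_d | forall i, Q i (y 0 i)].
Proof.
move=> HQ.
exact: (@filter_forall _ _ (fun i => [set y : 'rV[R]_d | Q i (y 0 i)]) _ (nbhs_filter x)
  (fun i => @coord_cts i _ (HQ i))).
Qed.

Let near_inside : \forall y \near x, inside y.
Proof.
have := near_forall (fun i => pcdf_interior_open (pc i) (xi i)).
by apply: filterS => y ?; apply/asboolP.
Qed.

Let near_slope (e : R) : 0 < e -> \forall y \near x, forall i,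
  `|S i ((y : 'rV[R]_d) 0 i) - S i (x 0 i)| < e.
Proof.
move=> e0; apply: (near_forall (Q := fun i => [set t | `|S i t - S i (x 0 i)| < e])) => i.
have ct := monotone_transport_continuous (pc i) kg (xi i).
have /(cvgrPdist_lt (FF := nbhs_filter (x 0 i)))/(_ _ e0) := ct.
by apply: filterS => t /=; rewrite distrC.
Qed.

(** The subgradient inequalities at x and at y enclose the error: 0 <= psi y - psi x - <y - x, v> <=
    <y - x, T y - T x>. The last factor is small by continuity of T at x, so psi is differentiable
    in the full sense. *)
Let frechet (e : R) : 0 < e -> \forall h \near (0 : 'rV[R]_d),
  `|fine (transport_potential (h + x)) - (fine (transport_potential x) + dotv h)| <= e * `|h|.
Proof.
move=> e0.
(* The error is shared among the d coordinates; [d.+1] stays positive when d = 0. *)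
have d0 : 0 < e / d.+1%:R by rewrite divr_gt0.
have xin : inside x by exact/asboolP.
have H : \forall y \near x, `|fine (transport_potential y) - (fine (transport_potential x) + dotv (y - x))| <= e * `|y - x|.
  apply: filterS2 near_inside (near_slope d0) => y yi ys.
  rewrite /transport_potential xin yi/= /dotv.
  have l := sub xin yi.
  have u := sub yi xin.
  rewrite ger0_norm ?subr_ge0//.
  apply: (@le_trans _ _ (dot (y - x) (coordinate_transport c k y - v))).
    rewrite dotBr; have : dot (x - y) (coordinate_transport c k y) = - dot (y - x) (coordinate_transport c k y).
      by rewrite -dotNl opprB.
    rewrite -/v in l u *; lra.
  apply: (@le_trans _ _ (\sum_(i < d) `|y - x| * (e / d.+1%:R))).
    apply: ler_sum => i _; apply: (le_trans (ler_norm _)); rewrite normrM.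
    apply: ler_pM => //.
      by rewrite [leRHS]mx_normrE; exact: (le_bigmax _ (fun ij => `|(y - x) ij.1 ij.2|) (0, i)).
    by rewrite !mxE ltW.
  rewrite sumr_const card_ord -mulrnAr [leRHS]mulrC ler_wpM2l// -mulr_natr mulrAC.
  by rewrite ler_pdivrMr// ler_wpM2l ?ler_nat// ltW.
have : \forall h \near (0 : 'rV[R]_d), `|fine (transport_potential (h + x)) - (fine (transport_potential x) + dotv (h + x - x))| <= e * `|h + x - x|.
  have sh := @cvg_shiftr _ _ (0 : 'rV[R]_d) x; rewrite add0r in sh.
  exact: (sh _ H).
by apply: filterS => h; rewrite addrK.
Qed.

Lemma transport_potential_gradient : is_gradient_at transport_potential x v.
Proof.
have cd : continuous dotv by exact: continuous_dotl.
have fr : fine \o transport_potential \o shift x =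
    cst (fine (transport_potential x)) + (dotv : {linear 'rV[R]_d -> R}) +o_ (0 : 'rV[R]_d) id.
  by apply/eqaddoP => e e0; exact: frechet.
have dE := diff_unique cd fr.
have dif : differentiable (fine \o transport_potential) x.
  by apply/diff_locallyP; rewrite dE; split => //; exact: fr.
split => //.
- by apply: filterS near_inside => y yi; rewrite /transport_potential yi.
- apply/rowP => i; rewrite mxE deriveE// (_ : 'd _ x _ = dot (delta_mx 0 i) v); last by rewrite dE.
  rewrite /dot (bigD1 i)//= mxE !eqxx mul1r.
  by rewrite big1 ?addr0// => j ji; rewrite mxE (negbTE ji) andbF mul0r.
Qed.

End gradient_at.

Lemma coordinate_transport_rank_map : is_rank_map P nu (coordinate_transport c k).
Proof.
split.
- exact: (measurable_coordinate_transport Pc kg).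
- exact: (coordinate_transport_push Pc nug kg).
- exists transport_potential; first exact: transport_potential_convex.
  by apply: filterS (interior_ae Pc) => x xi; exact: transport_potential_gradient.
Qed.

Lemma rank_map_coordinate : second_moments P -> second_moments nu ->
  {ae P, forall x, rank_map P nu x = coordinate_transport c k x}.
Proof.
move=> P2 nu2; apply: (rank_map_unique P2 nu2); last exact: coordinate_transport_rank_map.
rewrite /rank_map; case: xgetP => [y -> //|/(_ (coordinate_transport c k)) H].
by case: H; exact: coordinate_transport_rank_map.
Qed.

End rank_map_exists.

Lemma ae_ex d (T : measurableType d) (R : realType) (P : probability T R) (Q : T -> Prop) :
  {ae P, forall x, Q x} -> exists x, Q x.
Proof.
move=> [M [mM M0 QM]]; apply/not_existsP => H.
have : (P setT <= P M)%E by apply: le_measure; rewrite ?inE// => x _; apply: QM; exact: H.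
by rewrite M0 probability_setT leNgt lte01.
Qed.

Lemma rank_map_spec (R : realType) (d : nat) (P nu : probability 'rV[R]_d R) (T : 'rV[R]_d -> 'rV[R]_d) :
  is_rank_map P nu T -> is_rank_map P nu (rank_map P nu).
Proof. by move=> PT; rewrite /rank_map; case: xgetP => [y -> //|/(_ T)]. Qed.

Lemma expectation_const d (T : measurableType d) (R : realType) (P : probability T R) (r : R) :
  \int[P]_x r = r.
Proof.
have H := @Rintegral_cst _ T R P setT measurableT r.
by apply: (etrans H); apply: (etrans (congr1 (fun y => r * fine y) (probability_setT P))); rewrite mulr1.
Qed.

(** * The efficiency of product laws *)

Section covariance.
Context {R : realType} {d : nat}.
Variables (P : probability 'rV[R]_d R) (c : 'I_d -> R -> R).
Hypothesis Pc : product_law P c.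
Variable b : 'I_d -> R -> R.
Hypothesis mb : forall i, measurable_fun setT (b i).
Hypothesis b2 : forall i, P.-integrable setT (fun x => (b i (x 0 i) ^+ 2)%:E).

Let mean i := \int[P]_x b i (x 0 i).

Let mbx i : measurable_fun setT (fun x : 'rV[R]_d => b i (x 0 i)).
Proof. by apply: measurableT_comp => //; exact: measurable_coord. Qed.

Lemma integrable_of_sq i : P.-integrable setT (fun x => (b i (x 0 i))%:E).
Proof.
have := @integrable_mul_sq _ _ _ P (fun x => b i (x 0 i)) (fun=> 1) (mbx i) (measurable_cst _) (b2 i).
under [X in (_ -> P.-integrable _ X) -> _]eq_fun do rewrite mulr1.
by apply; exact: finite_measure_integrable_cst.
Qed.

Let ib i : P.-integrable setT (fun x => (b i (x 0 i) - mean i)%:E).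
Proof. by apply: integrable_realB => //; [exact: integrable_of_sq|exact: finite_measure_integrable_cst]. Qed.

Lemma covariance_diag i j :
  \int[P]_x ((b i (x 0 i) - mean i) * (b j (x 0 j) - mean j)) =
  (i == j)%:R * \int[P]_x (b i (x 0 i) - mean i) ^+ 2.
Proof.
have [<-|ij] := eqVneq i j; first by rewrite mul1r; apply: eq_Rintegral => x _.
rewrite mul0r.
have m k : measurable_fun setT (fun t => b k t - mean k) by apply: measurable_funB.
have [_ ->] := expectation_coord2 Pc ij (m i) (m j) (ib i) (ib j).
have -> : \int[P]_x (b i (x 0 i) - mean i) = 0; last by rewrite mul0r.
rewrite RintegralB//; [|exact: integrable_of_sq|exact: finite_measure_integrable_cst].
by rewrite expectation_const subrr.
Qed.

Lemma variance_moments i : \int[P]_x (b i (x 0 i) - mean i) ^+ 2 =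
  \int[P]_x (b i (x 0 i) ^+ 2) - mean i ^+ 2.
Proof.
have -> : \int[P]_x (b i (x 0 i) - mean i) ^+ 2 =
  \int[P]_x (b i (x 0 i) ^+ 2 - (2 * mean i * b i (x 0 i) - mean i ^+ 2)).
  by apply: eq_Rintegral => x _; ring.
have i1 := integrable_of_sq i.
have i2 : P.-integrable setT (fun x => (2 * mean i * b i (x 0 i))%:E) by exact: integrable_realMl.
have i3 : P.-integrable setT (fun x : 'rV[R]_d => (mean i ^+ 2)%:E) by exact: finite_measure_integrable_cst.
rewrite RintegralB//; [|exact: b2|exact: integrable_realB].
rewrite RintegralB// RintegralZl// expectation_const -/(mean i); ring.
Qed.

End covariance.

Section covmx_product.
Context {R : realType} {d : nat}.
Variables (P : probability 'rV[R]_d R) (c : 'I_d -> R -> R).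
Hypothesis Pc : product_law P c.

Definition variance i := \int[P]_x ((x : 'rV[R]_d) 0 i - \int[P]_y y 0 i) ^+ 2.

Lemma covmx_product : second_moments P -> covmx P = diag_mx (\row_i variance i).
Proof.
move=> P2; apply/matrixP => i j; rewrite !mxE -mulr_natl.
have := @covariance_diag _ _ _ _ Pc (fun _ t => t) (fun _ => @measurable_id _ _ _) P2 i j.
by move=> <-.
Qed.

(** A coordinate of variance 0 would be almost surely equal to its mean, but a law with a density
    has no atoms. *)
Lemma variance_gt0 i : second_moments P -> 0 < variance i.
Proof.
move=> P2; set m := \int[P]_x x 0 i.
have ik : P.-integrable setT (fun x : 'rV[R]_d => ((x 0 i - m) ^+ 2)%:E).
  have mx : measurable_fun setT (fun x : 'rV[R]_d => x 0 i) by exact: measurable_coord.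
  apply: (@eq_integrable _ _ _ _ setT measurableT (fun x : 'rV[R]_d => (x 0 i ^+ 2 - (2 * m * x 0 i - m ^+ 2))%:E)).
    by move=> x _; congr EFin; ring.
  apply: (integrable_realB measurableT (P2 i)).
  apply: integrable_realB => //; last exact: finite_measure_integrable_cst.
  apply: integrable_realMl => //.
  exact: (integrable_of_sq (b := fun _ t => t) (fun _ => @measurable_id _ _ _) P2 i).
have k0 : {ae P, forall x : 'rV[R]_d, 0 <= (x 0 i - m) ^+ 2} by apply: aeW => x; exact: sqr_ge0.
have [ge0 eq0] := ae_ge0_Rintegral ik k0.
rewrite lt_neqAle ge0 andbT; apply/eqP => /esym /eq0 k00.
have /ae_ex[x []] : {ae P, forall x : 'rV[R]_d, (x 0 i - m) ^+ 2 = 0 /\ x 0 i != m}.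
  by apply: filterI => //; exact: (coord_neq_ae Pc).
by move=> /eqP; rewrite sqrf_eq0 subr_eq0 => ->.
Qed.

End covmx_product.

Section covmx_push.
Context {R : realType} {d : nat}.
Variables (nu : probability 'rV[R]_d R) (g : R -> R) (j : R -> R).
Hypothesis nug : product_law nu (fun=> g).
Hypothesis mj : measurable_fun setT j.
Let mu := (@lebesgue_measure R).
Hypothesis j2 : mu.-integrable setT (fun t => (j t ^+ 2 * g t)%:E).
Let m1 := \int[mu]_t (j t * g t).
Let m2 := \int[mu]_t (j t ^+ 2 * g t).

Let J (x : 'rV[R]_d) : 'rV[R]_d := \row_i j (x 0 i).

Let mJ : measurable_fun setT J.
Proof.
apply: measurable_fun_coordP => i; under eq_fun do rewrite mxE.
by apply: measurableT_comp => //; exact: measurable_coord.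
Qed.

Let Jm : {mfun 'rV[R]_d >-> 'rV[R]_d} := mfun_Sub (mem_set mJ).
Let nuJ : probability 'rV[R]_d R := distribution nu Jm.

Let sq i : nu.-integrable setT (fun x : 'rV[R]_d => (j (x 0 i) ^+ 2)%:E).
Proof. by apply/(integrable_coord nug i (u := fun t => j t ^+ 2)) => //; exact: measurable_funX. Qed.

Let mean i : \int[nuJ]_y y 0 i = m1.
Proof.
rewrite (Rintegral_push (nu := nuJ) mJ (fun B _ => erefl _))//; last 2 first.
- exact: measurable_coord.
- apply/(integrable_push (nu := nuJ) mJ (fun B _ => erefl _)); first exact: measurable_coord.
  under eq_fun do rewrite mxE.
  exact: (integrable_of_sq (b := fun=> j) (fun=> mj) sq i).
under eq_Rintegral do rewrite mxE.
by rewrite /Rintegral (expectation_coord nug).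
Qed.

Lemma covmx_push_product : covmx (pushforward nu J) = diag_mx (\row_(i < d) (m2 - m1 ^+ 2)).
Proof.
apply/matrixP => a b; rewrite !mxE -mulr_natl.
change (\int[nuJ]_x ((x 0 a - \int[nuJ]_y y 0 a) * (x 0 b - \int[nuJ]_y y 0 b)) = (a == b)%:R * (m2 - m1 ^+ 2)).
rewrite !mean.
have nm i : \int[nu]_x j (x 0 i) = m1 by rewrite /Rintegral (expectation_coord nug).
have h i : nu.-integrable setT (fun x => (J x 0 i ^+ 2)%:E).
  by under eq_fun do rewrite mxE; exact: sq.
have iJ i : nu.-integrable setT (fun x => (J x 0 i - m1)%:E).
  under eq_fun do rewrite mxE.
  apply: integrable_realB => //; last exact: finite_measure_integrable_cst.
  exact: (integrable_of_sq (b := fun=> j) (fun=> mj) sq i).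
have sqB i : nu.-integrable setT (fun x => ((J x 0 i - m1) ^+ 2)%:E).
  apply: (@eq_integrable _ _ _ _ setT measurableT (fun x : 'rV[R]_d => (J x 0 i ^+ 2 - (2 * m1 * (J x 0 i - m1) + m1 ^+ 2))%:E)).
    by move=> x _; congr EFin; ring.
  apply: integrable_realB => //; apply: integrable_realD => //; last exact: finite_measure_integrable_cst.
  exact: integrable_realMl.
have mc i : measurable_fun setT (fun x : 'rV[R]_d => x 0 i - m1).
  by apply: measurable_funB => //; exact: measurable_coord.
rewrite (Rintegral_push (nu := nuJ) mJ (fun B _ => erefl _)); last 2 first.
- exact: measurable_funM.
- apply/(integrable_push (nu := nuJ) mJ (fun B _ => erefl _)); first exact: measurable_funM.
  apply: integrable_mul_sq => //; exact: (measurable_integrable (iJ _)).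
have := @covariance_diag _ _ _ _ nug (fun=> j) (fun=> mj) sq a b.
have -> := variance_moments (b := fun=> j) (fun=> mj) sq a.
rewrite !nm.
rewrite [X in _ = _ * (X - _) -> _](_ : _ = m2); last first.
  by rewrite /Rintegral (expectation_coord nug a (u := fun t => j t ^+ 2))//; exact: measurable_funX.
by move=> <-; apply: eq_Rintegral => x _; rewrite !mxE.
Qed.

End covmx_push.

(** * The efficiency as a weighted mean over the coordinates *)

Section are_formula.
Context {R : realType} {d : nat}.
Variables (P nu : probability 'rV[R]_d R) (c : 'I_d -> R -> R) (J : 'rV[R]_d -> 'rV[R]_d).
Variables (h : 'rV[R]_d) (eta : 'rV[R]_d -> 'rV[R]_d).
Hypothesis Pc : product_law P c.
Hypothesis P2 : second_moments P.

(** The sum <h, eta> is expanded under the integral, and Z_i correlates with eta_i alone. Z is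
    replaced by functions of single coordinates almost everywhere, as a rank map is known only up to
    null sets. *)
Lemma Evec_diag (Z : 'rV[R]_d -> 'rV[R]_d) (b : 'I_d -> R -> R) (A : 'I_d -> R) :
  (forall j, measurable_fun setT (fun x => eta x 0 j)) ->
  (forall i, measurable_fun setT (fun x => Z x 0 i)) ->
  {ae P, forall x, forall i, Z x 0 i = b i (x 0 i)} ->
  (forall i j, P.-integrable setT (fun x => (eta x 0 j * b i (x 0 i))%:E) /\
     \int[P]_x (eta x 0 j * b i (x 0 i)) = (i == j)%:R * A i) ->
  Evec P (fun x => dot h (eta x) *: Z x) = \row_i (h 0 i * A i).
Proof.
move=> meta mZ Zb HA; apply/rowP => i; rewrite !mxE.
have ib : P.-integrable setT (fun x => (\sum_j h 0 j * (eta x 0 j * b i (x 0 i)))%:E).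
  apply: integrable_sumr => // j; apply: integrable_realMl => //; exact: (HA i j).1.
transitivity (\int[P]_x (\sum_j h 0 j * (eta x 0 j * b i (x 0 i)))).
  change (\int[P]_x ((dot h (eta x) *: Z x) 0 i) = \int[P]_x (\sum_j h 0 j * (eta x 0 j * b i (x 0 i)))).
  apply: ae_eq_Rintegral => //.
  - under eq_fun do rewrite mxE; apply: measurable_funM => //.
    by apply: measurable_sum => j; apply: measurable_funM.
  - exact: (measurable_integrable ib).
  - apply: filterS Zb => x Zx _; rewrite mxE Zx /dot big_distrl/=.
    by apply: eq_bigr => j _; rewrite mulrA.
rewrite Rintegral_sum//; last by move=> j; apply: integrable_realMl => //; exact: (HA i j).1.
rewrite (bigD1 i)//= big1 ?addr0; last first.
  move=> j ji; rewrite RintegralZl//; last exact: (HA i j).1.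
  by rewrite (HA i j).2 eq_sym (negbTE ji) mul0r mulr0.
by rewrite RintegralZl//; [rewrite (HA i i).2 eqxx mul1r|exact: (HA i i).1].
Qed.

Lemma second_moments_finite : finite_variances P.
Proof.
move=> i; have /integrableP[_] := P2 i.
by under eq_integral do rewrite /= ger0_norm ?sqr_ge0//.
Qed.

Variables (tau : R) (b : 'I_d -> R -> R) (A : 'I_d -> R).
Hypotheses (tau0 : 0 < tau) (Jcov : covmx (pushforward nu J) = diag_mx (\row_(i < d) tau)).
Hypotheses (meta : forall j, measurable_fun setT (fun x => eta x 0 j))
  (mZ : forall i, measurable_fun setT (fun x => J (rank_map P nu x) 0 i))
  (Zb : {ae P, forall x, forall i, J (rank_map P nu x) 0 i = b i (x 0 i)})
  (HA : forall i j, P.-integrable setT (fun x => (eta x 0 j * b i (x 0 i))%:E) /\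
     \int[P]_x (eta x 0 j * b i (x 0 i)) = (i == j)%:R * A i)
  (Hid : forall i j, P.-integrable setT (fun x => (eta x 0 j * x 0 i)%:E) /\
     \int[P]_x (eta x 0 j * x 0 i) = (i == j)%:R).

Lemma ARE_product : ARE nu J h P eta =
  ((\sum_i h 0 i ^+ 2 * A i ^+ 2 / tau) / (\sum_i h 0 i ^+ 2 / variance P i))%:E.
Proof.
rewrite /ARE; case: asboolP => [_|[]]; last exact: second_moments_finite.
rewrite /rank_noncentrality /hotelling_noncentrality Jcov (covmx_product Pc P2).
rewrite (Evec_diag meta mZ Zb HA) (@Evec_diag id (fun _ t => t) (fun=> 1))//; last 3 first.
- by move=> i; exact: measurable_coord.
- exact: aeW.
- by move=> i j; have [? E] := Hid i j; rewrite mulr1.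
rewrite !sqnorm_mul_inv_sqrtmx//; last by move=> i; exact: (variance_gt0 Pc i P2).
congr (_ / _)%:E; apply: eq_bigr => i _; rewrite mxE ?mulr1//.
by rewrite exprMn.
Qed.

End are_formula.

Section ratio_bound.
Context {R : realFieldType} {d : nat}.
Variables (a s h : 'I_d -> R) (k : R).
Hypotheses (s0 : forall i, 0 < s i) (ka : forall i, k <= s i * a i) (h0 : exists i, h i != 0).

Let den_gt0 : 0 < \sum_i h i ^+ 2 / s i.
Proof.
have [i hi] := h0; rewrite (bigD1 i)//= ltr_pwDl//.
  by rewrite divr_gt0// lt_neqAle sqr_ge0 eq_sym sqrf_eq0 hi.
by apply: sumr_ge0 => j _; rewrite divr_ge0 ?sqr_ge0 ?ltW.
Qed.

Let termB i : h i ^+ 2 * a i - k * (h i ^+ 2 / s i) = h i ^+ 2 / s i * (s i * a i - k).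
Proof. by have := lt0r_neq0 (s0 i); move=> si; field. Qed.

Let termB_ge0 i : 0 <= h i ^+ 2 * a i - k * (h i ^+ 2 / s i).
Proof. by rewrite termB mulr_ge0 ?subr_ge0// divr_ge0 ?sqr_ge0// ltW. Qed.

Lemma ratio_ge : k <= (\sum_i h i ^+ 2 * a i) / (\sum_i h i ^+ 2 / s i).
Proof.
rewrite ler_pdivlMr// mulr_sumr; apply: ler_sum => i _.
by rewrite -subr_ge0.
Qed.

(** Cleared of its denominator, the excess over k is a sum of nonnegative terms, which vanish one by
    one. A coordinate with h i = 0 has weight 0 and stays unconstrained. *)
Lemma ratio_eq : (\sum_i h i ^+ 2 * a i) / (\sum_i h i ^+ 2 / s i) = k ->
  forall i, h i != 0 -> s i * a i = k.
Proof.
move=> E i hi; have : \sum_i (h i ^+ 2 * a i - k * (h i ^+ 2 / s i)) == 0.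
  by rewrite sumrB -mulr_sumr -E mulfVK ?subrr// gt_eqF.
rewrite psumr_eq0// => /allP/(_ i); rewrite mem_index_enum => /(_ isT)/=.
rewrite termB mulf_eq0 mulf_eq0 invr_eq0 sqrf_eq0 (negbTE hi) gt_eqF//= subr_eq0.
by move/eqP.
Qed.

End ratio_bound.

Lemma FTC2_everywhere {R : realType} (f h : R -> R) (a b : R) : continuous f ->
  (forall x : R, is_derive x (1 : R) h (f x)) -> a < b ->
  (\int[lebesgue_measure]_(x in `[a, b]) (f x)%:E = (h b - h a)%:E)%E.
Proof.
move=> fc hf ab; rewrite EFinB; apply: continuous_FTC2 => //.
- exact: continuous_subspaceT.
- have hc : continuous h by move=> x; apply/differentiable_continuous/derivable1_diffP; exact: ex_derive.
  split => //.
  + by apply: cvg_at_right_filter; exact: hc.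
  + by apply: cvg_at_left_filter; exact: hc.
- by move=> x _; rewrite derive1E; exact: (@derive_val _ _ _ _ _ _ _ (hf x)).
Qed.

(** * The reference distributions *)

Section integral_tail.
Context {R : realType}.
Let mu := (@lebesgue_measure R).
Variables (f h : R -> R).
Hypotheses (fi : mu.-integrable setT (EFin \o f)) (fc : continuous f)
  (hf : forall x : R, is_derive x (1 : R) h (f x)).

Let mf : measurable_fun setT f.
Proof. exact: continuous_measurable_fun. Qed.

Let mind (A : set R) : measurable A -> measurable_fun setT (fun x => (f x * \1_A x)%:E).
Proof. by move=> mA; apply/measurable_EFinP; apply: measurable_funM. Qed.

Let dom (A : (set R)^nat) (B : set R) : (forall n, measurable (A n)) -> measurable B ->
  (forall x, \forall n \near \oo, \1_(A n) x = \1_B x :> R) ->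
  (\int[mu]_x (f x * \1_(A n) x)%:E)%E @[n --> \oo] --> (\int[mu]_x (f x * \1_B x)%:E)%E.
Proof.
move=> mA mB AB; apply: (@dominated_cvg _ _ _ mu setT measurableT _ _ (fun x => `|f x|%:E)) => //.
- by move=> n; exact: mind.
- move=> x _; apply: cvg_near_cst; apply: filterS (AB x) => n /= ->//.
- exact: (integrable_abse fi).
- move=> n x _ /=; rewrite lee_fin normrM ler_piMr// indicE.
  by case: (_ \in _); rewrite ?normr1 ?normr0.
Qed.

(** The fundamental theorem on [a, n], then dominated convergence with [|f|] as the dominating
    function. *)
Lemma integral_tail a l : h n%:R @[n --> \oo] --> (l : R) ->
  \int[mu]_x (f x * (a < x)%R%:R) = l - h a.
Proof.
move=> h0.
have E (A : set R) : measurable A -> (\int[mu]_x (f x * \1_A x)%:E = \int[mu]_(x in A) (f x)%:E)%E.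
  move=> mA; rewrite [RHS]integral_mkcond; apply: eq_integral => x _; rewrite patchE indicE.
  by case: (_ \in _); rewrite ?mulr1 ?mulr0.
have c1 := @dom (fun n => `[a, n%:R]%classic) `[a, +oo[%classic (fun n => measurable_itv _) (measurable_itv _).
have {}c1 : (h n%:R - h a)%:E @[n --> \oo] --> (\int[mu]_x (f x * \1_(`[a, +oo[%classic) x)%:E)%E.
  apply: cvg_trans (c1 _); last first.
    move=> x; exists (Num.bound `|x|) => // n /= xn; rewrite !indicE !mem_setE !in_itv/= andbT.
    suff -> : x <= n%:R by rewrite andbT.
    apply: (le_trans (ler_norm x)); apply: (le_trans (ltW (archi_boundP (normr_ge0 x)))).
    by rewrite ler_nat.
  apply: near_eq_cvg; exists (Num.bound `|a|).+1 => // n /= an.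
  rewrite E// (FTC2_everywhere fc hf)//; apply: (le_lt_trans (ler_norm a)).
  by apply: (lt_trans (archi_boundP (normr_ge0 a))); rewrite ltr_nat.
have c2 : (h n%:R - h a)%:E @[n --> \oo] --> (l - h a)%:E.
  apply: cvg_EFin; first exact: nearW.
  by apply: cvgB => //; exact: cvg_cst.
have {c1 c2} H := cvg_unique (@ereal_hausdorff R) c1 c2.
rewrite /Rintegral -[RHS]/(fine (l - h a)%:E) -H; congr fine.
rewrite E// -integral_itv_obnd_cbnd; last by apply/measurable_EFinP/measurable_funTS.
rewrite -E//; apply: eq_integral => x _; rewrite indicE mem_setE in_itv/= andbT.
by [].
Qed.

Lemma integral_total l1 l0 : h n%:R @[n --> \oo] --> (l1 : R) ->
  h (- n%:R) @[n --> \oo] --> (l0 : R) -> \int[mu]_x f x = l1 - l0.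
Proof.
move=> h0 hN.
have E n : (\int[mu]_x (f x * \1_(`](- n%:R), +oo[%classic) x)%:E = (l1 - h (- n%:R))%:E)%E.
  rewrite -(integral_tail (- n%:R) h0) /Rintegral fineK; last first.
    apply: integrable_fin_num => //.
    apply: (@le_integrable _ _ _ mu setT measurableT _ (EFin \o f)) => //.
    - by apply/measurable_EFinP; apply: measurable_funM => //; exact: measurable_ltR.
    - by move=> x _ /=; rewrite lee_fin normrM ler_piMr//; case: (- n%:R < x); rewrite ?normr1 ?normr0.
  by apply: eq_integral => x _; rewrite indicE mem_setE in_itv/= andbT.
have c1 := @dom (fun n => `](- n%:R), +oo[%classic) setT (fun n => measurable_itv _) measurableT.
have {}c1 : (l1 - h (- n%:R))%:E @[n --> \oo] --> (\int[mu]_x (f x * \1_setT x)%:E)%E.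
  apply: cvg_trans (c1 _); last first.
    move=> x; exists (Num.bound `|x|) => // n /= xn; rewrite !indicE in_setT !mem_setE !in_itv/= andbT.
    suff -> : - n%:R < x by [].
    rewrite ltrNl; apply: (le_lt_trans (ler_norm _)); rewrite normrN.
    by apply: (lt_le_trans (archi_boundP (normr_ge0 x))); rewrite ler_nat.
  by apply: near_eq_cvg; apply: nearW => n; rewrite E.
have c2 : (l1 - h (- n%:R))%:E @[n --> \oo] --> (l1 - l0)%:E.
  apply: cvg_EFin; first exact: nearW.
  by apply: cvgB => //; exact: cvg_cst.
have {c1 c2} H := cvg_unique (@ereal_hausdorff R) c1 c2.
rewrite /Rintegral -[RHS]/(fine (l1 - l0)%:E) -H; congr fine.
by apply: eq_integral => x _; rewrite indicT mulr1.
Qed.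

End integral_tail.

Section std_normal.
Context {R : realType}.
Let mu := (@lebesgue_measure R).
Local Notation phi := (@normal_pdf R 0 1).

Let peak : R := normal_peak 1.

Let peak_gt0 : 0 < peak. Proof. exact: normal_peak_gt0 (oner_neq0 _). Qed.

Let phiE t : phi t = peak * expR (- (t ^+ 2 / 2)).
Proof. by rewrite normal_pdfE ?oner_neq0// /normal_fun subr0 expr1n mulNr. Qed.

Lemma std_normal_pdf_gt0 t : 0 < phi t.
Proof. by rewrite phiE mulr_gt0 ?expR_gt0. Qed.

Lemma is_pdf_normal (m s : R) : is_pdf (normal_pdf m s).
Proof.
split; [exact: measurable_normal_pdf|exact: normal_pdf_ge0|].
exact: integral_normal_pdf.
Qed.

Lemma std_normal_pdf_derive (t : R) : is_derive t (1 : R) phi (- (t * phi t)).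
Proof.
have -> : phi = (fun t => peak * expR (- (t ^+ 2 / 2))) by apply/funext => u; exact: phiE.
apply: is_derive_eq.
by rewrite /GRing.scale/=; field.
Qed.

Lemma continuous_std_normal_pdf : continuous phi.
Proof. by apply: continuous_normal_pdf; exact: oner_neq0. Qed.

Let phi_le (t : R) : 0 < t -> phi t <= peak / t.
Proof.
move=> t0; rewrite phiE ler_pM2l// expRN lef_pV2 ?posrE ?expR_gt0//.
by apply: le_trans (expR_ge1Dx _); nra.
Qed.

Let phiN t : phi (- t) = phi t.
Proof. by rewrite !phiE sqrrN. Qed.

Let phi_cvg0 : phi n%:R @[n --> \oo] --> (0 : R).
Proof.
apply/cvgrPdist_le => e e0; exists (Num.bound (peak / e)).+1 => // n /= en.
have n0 : 0 < n%:R :> R by rewrite ltr0n; apply: leq_trans en.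
rewrite sub0r normrN (ger0_norm (ltW (std_normal_pdf_gt0 _))).
apply: (le_trans (phi_le n0)); rewrite ler_pdivrMr// -ler_pdivrMl// mulrC.
have h := archi_boundP (divr_ge0 (ltW peak_gt0) (ltW e0)).
by apply: (le_trans (ltW h)); rewrite ler_nat ltnW.
Qed.

Lemma std_normal_pdf_sq_integrable : mu.-integrable setT (fun t => (t ^+ 2 * phi t)%:E).
Proof.
pose s2 := Num.sqrt (2 : R).
have s20 : s2 != 0 by rewrite gt_eqF// sqrtr_gt0.
(* The dominating function is a multiple of the normal density of variance 2: t^2 exp(- t^2 / 2) <=
   4 exp(- t^2 / 4), since t^2 / 4 <= exp(t^2 / 4). C trades one normalising constant for the
   other. *)
pose C := 4 * peak / normal_peak s2.
apply: (@le_integrable _ _ _ mu setT measurableT _ (fun t => (C * normal_pdf 0 s2 t)%:E)).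
- apply/measurable_EFinP; apply: measurable_funM; first exact: exprn_measurable.
  exact: measurable_normal_pdf.
- move=> t _ /=; rewrite lee_fin.
  have n0 := normal_peak_gt0 s20.
  have C0 : 0 <= C.
    by apply: divr_ge0; [apply: mulr_ge0 => //; exact: ltW|exact: ltW].
  have pt := normal_pdf_ge0 0 1 t; have ps := normal_pdf_ge0 0 s2 t.
  rewrite (ger0_norm (mulr_ge0 (sqr_ge0 t) pt)) (ger0_norm (mulr_ge0 C0 ps)).
  have -> : normal_pdf 0 s2 t = normal_peak s2 * expR (- t ^+ 2 / (2 *+ 2)).
    by rewrite normal_pdfE// /normal_fun subr0 sqr_sqrtr.
  rewrite /C.
  have -> : 4 * peak / normal_peak s2 * (normal_peak s2 * expR (- t ^+ 2 / (2 *+ 2))) =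
    peak * (4 * expR (- t ^+ 2 / (2 *+ 2))) by field; exact: lt0r_neq0.
  rewrite phiE mulrCA ler_pM2l//.
  have -> : - (t ^+ 2 / 2) = - (t ^+ 2 / 4) + - (t ^+ 2 / 4) by field.
  have -> : - t ^+ 2 / (2 *+ 2) = - (t ^+ 2 / 4) by rewrite -mulr_natr -natrM mulNr.
  rewrite expRD mulrA ler_pM2r ?expR_gt0// expRN ler_pdivrMr ?expR_gt0//.
  have := expR_ge1Dx (t ^+ 2 / 4); lra.
- by apply: integrable_realMl => //; exact: integrable_normal_pdf.
Qed.

Lemma std_normal_pdf_id_integrable : mu.-integrable setT (fun t => (t * phi t)%:E).
Proof.
apply: (@le_integrable _ _ _ mu setT measurableT _ (fun t => (phi t + t ^+ 2 * phi t)%:E)).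
- by apply/measurable_EFinP; apply: measurable_funM => //; exact: measurable_normal_pdf.
- move=> t _ /=; rewrite lee_fin.
  rewrite -{2}[phi t]mul1r -mulrDl !normrM ler_wpM2r// [leRHS]ger0_norm ?addr_ge0 ?sqr_ge0//.
  by rewrite -[t ^+ 2]real_normK ?num_real//; have := normr_ge0 t; nra.
- apply: integrable_realD => //; [exact: integrable_normal_pdf|exact: std_normal_pdf_sq_integrable].
Qed.

Let N_derive (t : R) : is_derive t (1 : R) (fun t => - phi t) (t * phi t).
Proof.
have h := std_normal_pdf_derive t; apply: is_derive_eq.
by rewrite opprK.
Qed.

Let N_cont : continuous (fun t : R => t * phi t).
Proof. by move=> t; apply: continuousM => //; exact: continuous_std_normal_pdf. Qed.

Let N_cvg : - phi n%:R @[n --> \oo] --> (0 : R).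
Proof.
have /cvgrPdist_le H := phi_cvg0; apply/cvgrPdist_le => e e0; apply: filterS (H e e0) => n.
by rewrite !sub0r !normrN.
Qed.

Lemma std_normal_tail (a : R) : \int[mu]_t (t * phi t * (a < t)%R%:R) = phi a.
Proof. by rewrite (integral_tail std_normal_pdf_id_integrable N_cont N_derive a N_cvg) sub0r opprK. Qed.

Lemma std_normal_mean : \int[mu]_t (t * phi t) = 0.
Proof.
rewrite -[RHS](subrr 0); apply: (integral_total std_normal_pdf_id_integrable N_cont N_derive N_cvg).
by under eq_fun do rewrite phiN; exact: N_cvg.
Qed.

(** [expectation_primitive] with W and H both the identity: the expectation of t beyond s is phi(s),
    and phi has integral 1. *)
Lemma std_normal_variance : \int[mu]_t (t ^+ 2 * phi t) = 1.
Proof.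
pose P : probability (measurableTypeR R) R := normal_prob 0 1.
have PE A : measurable A -> P A = (\int[mu]_(t in A) (phi t)%:E)%E by [].
have mphi := measurable_normal_pdf 0 (1 : R); have phi0 := normal_pdf_ge0 0 (1 : R).
have toP (u : R -> R) : measurable_fun setT u -> \int[P]_t u t = \int[mu]_t (u t * phi t).
  move=> mU; rewrite /Rintegral (integral_density (nu := P) (mu := mu) mphi phi0 PE)//.
have iP (u : R -> R) : measurable_fun setT u -> mu.-integrable setT (fun t => (u t * phi t)%:E) ->
    P.-integrable setT (EFin \o u).
  by move=> mU iu; exact: (integrable_density (nu := P) (mu := mu) mphi phi0 PE mU).2.
have mid : measurable_fun setT (fun t : R => t) by exact: measurable_id.
have i1 := iP _ mid std_normal_pdf_id_integrable.
have m2 : measurable_fun setT (fun t : R => t * t) by exact: measurable_funM.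
have i2 : P.-integrable setT (fun t : R => (t * t)%:E).
  by apply: iP => //; have := std_normal_pdf_sq_integrable; under eq_fun do rewrite expr2.
have [] := @expectation_primitive _ _ _ P (fun t : R => t) (fun t => t) (fun=> 1) (fun t => t) 0 mid i1.
- by rewrite toP//; exact: std_normal_mean.
- exact: measurable_cst.
- by [].
- apply: aeW => x; split => hx.
    by rewrite integral_cst// mul1e [LHS](@lebesgue_measure_itv R `[0, x[)/= lte_fin; case: ltP => [//|h]; rewrite ?sube0//; congr EFin; lra.
  by rewrite integral_cst// mul1e [LHS](@lebesgue_measure_itv R `[x, 0[)/= lte_fin hx add0e.
- exact: m2.
- exact: i2.
move=> _; rewrite toP//; under eq_Rintegral do rewrite -expr2.
move=> ->; transitivity (\int[mu]_s phi s); last first.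
  by rewrite /Rintegral integral_normal_pdf.
apply: eq_Rintegral => s _; rewrite mul1r -(std_normal_tail s) toP; last first.
  by apply: measurable_funM => //; exact: measurable_ltR.
by apply: eq_Rintegral => t _; rewrite mulrAC.
Qed.

End std_normal.

Lemma is_derive_power {R : realType} (F : R -> R) (k : nat) (t l : R) : is_derive t (1 : R) F l ->
  is_derive t (1 : R) (fun t => k.+1%:R^-1 * F t ^+ k.+1) (F t ^+ k * l).
Proof.
move=> h; have k0 : k.+1%:R != 0 :> R by rewrite pnatr_eq0.
have E : k.+1%:R^-1 \*: F ^+ k.+1 = (fun t => k.+1%:R^-1 * F t ^+ k.+1).
  by apply/funext => s; rewrite !fctE.
rewrite -E; apply: is_derive_eq.
by rewrite /GRing.scale/=; field.
Qed.

Section pcdf_facts.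
Context {R : realType} (c : R -> R).
Hypothesis pc : is_pdf c.
Let mu := (@lebesgue_measure R).

Lemma pcdf_derive t : {for t, continuous c} -> is_derive t (1 : R) (pcdf c) (c t).
Proof.
move=> ct; have t1 : t < t + 1 by rewrite ltrDl.
have [|||d1 d2] := @continuous_FTC1 R c -oo%O t _ t1.
- exact: integrable_pdf.
- by rewrite ltNyr.
- exact: ct.
apply: DeriveDef; first exact: d1.
by rewrite -d2 derive1E.
Qed.

Lemma cvg_pcdfy : pcdf c n%:R @[n --> \oo] --> (1 : R).
Proof.
apply/cvgrPdist_le => e e0; have [|t te] := @pcdf_gt _ _ pc (1 - e); first by lra.
exists (Num.bound `|t|) => // n /= tn.
have tn' : t <= n%:R.
  apply: (le_trans (ler_norm t)); apply: (le_trans (ltW (archi_boundP (normr_ge0 t)))).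
  by rewrite ler_nat.
have := pcdf_nondecreasing pc tn'; have := pcdf_le1 pc n%:R => h1 h2.
rewrite ger0_norm ?subr_ge0//; lra.
Qed.

Lemma cvg_pcdfNy : pcdf c (- n%:R) @[n --> \oo] --> (0 : R).
Proof.
apply/cvgrPdist_le => e e0; have [t te] := @pcdf_lt _ _ pc e e0.
exists (Num.bound `|t|) => // n /= tn.
have tn' : - n%:R <= t.
  rewrite lerNl; apply: (le_trans (ler_norm (- t))); rewrite normrN.
  by apply: (le_trans (ltW (archi_boundP (normr_ge0 t)))); rewrite ler_nat.
have := pcdf_nondecreasing pc tn'; have := pcdf_ge0 pc (- n%:R) => h1 h2.
rewrite sub0r normrN ger0_norm//; lra.
Qed.

Lemma pcdf_itvco s t : s <= t -> (\int[mu]_(x in `[s, t[) (c x)%:E = (pcdf c t - pcdf c s)%:E)%E.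
Proof.
move=> st; have ic := integrable_pdf pc.
have mc (A : set R) : measurable A -> measurable_fun A (fun x => (c x)%:E).
  by move=> mA; have /integrableP[] := ic _ mA.
rewrite integral_itv_bndo_bndc; last exact: mc.
rewrite -integral_itv_obnd_cbnd; last exact: mc.
by rewrite pcdfB// /Rintegral fineK//; apply: integrable_fin_num => //; exact: ic.
Qed.

Lemma pcdf_increasing : continuous c -> (forall t, 0 < c t) -> {homo pcdf c : s t / s < t}.
Proof.
move=> cc c0 s t st.
have [||z _ E] := @MVT R (pcdf c) c s t st.
- by move=> x _; apply: pcdf_derive; exact: cc.
- exact: continuous_subspaceT (pcdf_continuous pc).
by rewrite -subr_gt0 E mulr_gt0// subr_gt0.
Qed.

End pcdf_facts.

Section normal_reference.
Context {R : realType}.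
Let mu := (@lebesgue_measure R).
Local Notation phi := (@normal_pdf R 0 1).
Local Notation Phi := (pcdf phi).

Let pphi : is_pdf phi. Proof. exact: is_pdf_normal. Qed.

Lemma std_normal_cdfE : std_normal_cdf = Phi.
Proof. by []. Qed.

Lemma std_normal_cdf_derive (t : R) : is_derive t (1 : R) Phi (phi t).
Proof. by apply: pcdf_derive => //; exact: continuous_std_normal_pdf. Qed.

Let Phi_le : {mono Phi : s t / s <= t}.
Proof.
apply: le_mono; apply: pcdf_increasing => //.
- exact: continuous_std_normal_pdf.
- exact: std_normal_pdf_gt0.
Qed.

Let Phi_lt : {mono Phi : s t / s < t}.
Proof. exact: leW_mono Phi_le. Qed.

Definition normal_quantile (u : R) : R := xget 0 [set t | Phi t = u].

Lemma normal_quantileK u : 0 < u < 1 -> Phi (normal_quantile u) = u.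
Proof. by move=> u01; have := pcdf_surj pphi u01; move=> /(xgetPex 0). Qed.

Lemma normal_cdfK t : normal_quantile (Phi t) = t.
Proof.
have [t0 t1] : Phi (normal_quantile (Phi t)) = Phi t /\ True.
  by split => //; exact: (xgetPex 0 (ex_intro (fun s => Phi s = Phi t) t erefl)).
apply/eqP; rewrite eq_le -[_ <= t]Phi_le -[t <= _]Phi_le t0 lexx.
by [].
Qed.

Lemma std_normal_cdf_01 t : 0 < Phi t < 1.
Proof.
apply/andP; split.
  by apply: (le_lt_trans (pcdf_ge0 pphi (t - 1))); rewrite Phi_lt; lra.
by apply: (lt_le_trans _ (pcdf_le1 pphi (t + 1))); rewrite Phi_lt; lra.
Qed.

Lemma normal_quantileP : is_quantile phi normal_quantile.
Proof.
move=> u z u01; have E := normal_quantileK u01.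
by rewrite -[X in (_ = (X <= _)) /\ _]E Phi_le -Phi_lt E.
Qed.

Lemma std_normal_product_law d (nu : probability 'rV[R]_d R) :
  std_normal_law nu -> product_law nu (fun=> phi).
Proof. by []. Qed.

Let Phi_measurable : measurable_fun setT Phi. Proof. exact: measurable_pcdf. Qed.

Let int_pow (k : nat) : mu.-integrable setT (fun t => (Phi t ^+ k * phi t)%:E).
Proof.
apply: (@le_integrable _ _ _ mu setT measurableT _ (EFin \o phi)).
- apply/measurable_EFinP; apply: measurable_funM; last exact: measurable_normal_pdf.
  exact: measurable_funX.
- move=> t _ /=; rewrite lee_fin normrM ler_piMl// ger0_norm ?exprn_ge0 ?pcdf_ge0//.
  by rewrite exprn_ile1 ?pcdf_ge0 ?pcdf_le1.
- exact: integrable_normal_pdf.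
Qed.

(** Phi^k phi has the antiderivative Phi^(k+1) / (k+1). These are the moments of the uniform law; k
    = 1 and 2 give the variance 1/3 - 1/4 = 1/12. *)
Lemma std_normal_cdf_moment (k : nat) : \int[mu]_t (Phi t ^+ k * phi t) = k.+1%:R^-1.
Proof.
have k0 : k.+1%:R != 0 :> R by rewrite pnatr_eq0.
have hf (t : R) : is_derive t (1 : R) (fun t => k.+1%:R^-1 * Phi t ^+ k.+1) (Phi t ^+ k * phi t).
  exact: (is_derive_power k (std_normal_cdf_derive t)).
have fc : continuous (fun t : R => Phi t ^+ k * phi t).
  move=> t; apply: (@continuousM _ R (fun t => Phi t ^+ k) phi); last exact: continuous_std_normal_pdf.
  apply: (@continuous_comp R R R Phi (fun u => u ^+ k)); first exact: pcdf_continuous.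
  exact: exprn_continuous.
rewrite (integral_total (int_pow k) fc hf (l1 := k.+1%:R^-1) (l0 := 0)) ?subr0//.
- have h1 : Phi n%:R ^+ k.+1 @[n --> \oo] --> (1 ^+ k.+1 : R).
    exact: (cvg_comp _ (fun u : R => u ^+ k.+1) (cvg_pcdfy pphi) (@exprn_continuous R k.+1 1)).
  have E : k.+1%:R^-1 * 1 ^+ k.+1 = k.+1%:R^-1 :> R by rewrite expr1n mulr1.
  have := @cvgM R nat \oo _ (fun=> k.+1%:R^-1) (fun n => Phi n%:R ^+ k.+1) k.+1%:R^-1 (1 ^+ k.+1) (cvg_cst _) h1.
  by rewrite E; apply.
- have h0 : Phi (- n%:R) ^+ k.+1 @[n --> \oo] --> (0 ^+ k.+1 : R).
    exact: (cvg_comp _ (fun u : R => u ^+ k.+1) (cvg_pcdfNy pphi) (@exprn_continuous R k.+1 0)).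
  have E : k.+1%:R^-1 * 0 ^+ k.+1 = 0 :> R by rewrite [X in _ * X]expr0n mulr0.
  have := @cvgM R nat \oo _ (fun=> k.+1%:R^-1) (fun n => Phi (- n%:R) ^+ k.+1) k.+1%:R^-1 (0 ^+ k.+1) (cvg_cst _) h0.
  by rewrite E; apply.
Qed.

Lemma std_normal_second_moments d (nu : probability 'rV[R]_d R) :
  std_normal_law nu -> second_moments nu.
Proof.
move=> nuN i; apply/(integrable_coord (std_normal_product_law nuN) i (u := fun t => t ^+ 2)).
  exact: exprn_measurable.
exact: std_normal_pdf_sq_integrable.
Qed.

Lemma covmx_std_normal d (nu : probability 'rV[R]_d R) : std_normal_law nu ->
  covmx (pushforward nu id) = diag_mx (\row_(i < d) 1).
Proof.
move=> nuN; have := @covmx_push_product _ _ nu _ (fun t => t) (std_normal_product_law nuN) (@measurable_id _ _ _) std_normal_pdf_sq_integrable.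
rewrite std_normal_variance std_normal_mean expr0n subr0 => <-.
by congr (covmx (pushforward nu _)); apply/funext => x; apply/rowP => i; rewrite mxE.
Qed.

Lemma covmx_normal_cdf d (nu : probability 'rV[R]_d R) : std_normal_law nu ->
  covmx (pushforward nu normal_cdf_score) = diag_mx (\row_(i < d) 12^-1).
Proof.
move=> nuN; rewrite (@covmx_push_product _ _ nu _ Phi (std_normal_product_law nuN) Phi_measurable (int_pow 2)).
congr diag_mx; apply/rowP => i; rewrite !mxE.
have := std_normal_cdf_moment 1; under eq_Rintegral do rewrite expr1.
by move=> ->; rewrite std_normal_cdf_moment; field.
Qed.

End normal_reference.

Section uniform_reference.
Context {R : realType}.
Let mu := (@lebesgue_measure R).
Local Notation unif := (@uniform_pdf R 0 1).

Let unifE (A : set R) (f : R -> R) : measurable A ->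
  (\int[mu]_(t in A) (f t * unif t)%:E = \int[mu]_(t in A `&` `[0%R, 1%R]) (f t)%:E)%E.
Proof.
move=> mA; rewrite [RHS]integral_mkcondr; apply: eq_integral => t _.
rewrite patchE mem_setE in_itv/= /uniform_pdf subr0 invr1.
by case: (0 <= t <= 1); rewrite ?mulr1 ?mulr0.
Qed.

Lemma is_pdf_uniform : is_pdf unif.
Proof.
split; [exact: measurable_uniform_pdf|by move=> t; apply: uniform_pdf_ge0|].
exact: integral_uniform_pdf1.
Qed.

Let G01 z : 0 <= z <= 1 -> pcdf unif z = z.
Proof.
move=> /andP[z0 z1]; rewrite /pcdf /Rintegral.
under eq_integral do rewrite -[unif _]mul1r.
rewrite (unifE (fun=> 1))//.
have -> : `]-oo, z] `&` `[0, 1] = `[0, z]%classic :> set R.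
  apply/seteqP; split => t /=; rewrite !in_itv/=; first by move=> [-> /andP[->]].
  by move=> /andP[-> tz]; rewrite tz (le_trans tz z1).
rewrite integral_cst// mul1e [X in fine X](@lebesgue_measure_itv R `[0, z])/= lte_fin.
by case: ltP => [|h] /=; lra.
Qed.

Lemma uniform_quantileP : is_quantile unif id.
Proof.
move=> u z /andP[u0 u1].
have [z0|z0] := leP 0 z; last first.
  have : pcdf unif z <= 0 by rewrite -[leRHS]G01 ?lexx ?ler01//; apply: pcdf_nondecreasing; [exact: is_pdf_uniform|exact: ltW].
  move=> h; split; last by lra.
  by apply/idP/idP; lra.
have [z1|z1] := leP z 1; first by rewrite G01 ?z0 ?z1.
have : 1 <= pcdf unif z by rewrite -[leLHS]G01 ?lexx ?ler01//; apply: pcdf_nondecreasing; [exact: is_pdf_uniform|exact: ltW].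
move=> h; split; last by lra.
by apply/idP/idP; lra.
Qed.

Lemma uniform_moment (k : nat) : \int[mu]_t (t ^+ k * unif t) = k.+1%:R^-1.
Proof.
rewrite /Rintegral (unifE (fun t => t ^+ k))// setTI.
have k0 : k.+1%:R != 0 :> R by rewrite pnatr_eq0.
have hf (x : R) : is_derive x (1 : R) (fun t : R => k.+1%:R^-1 * t ^+ k.+1) (x ^+ k).
  by rewrite -[x ^+ k]mulr1; exact: (is_derive_power (F := fun t : R => t) k (is_derive_id x 1)).
rewrite (FTC2_everywhere (@exprn_continuous R k) hf ltr01)/=.
by rewrite expr1n expr0n mulr0 subr0 mulr1.
Qed.

Lemma uniform_product_law d (nu : probability 'rV[R]_d R) :
  uniform_law nu -> product_law nu (fun=> unif).
Proof. by split => // i; exact: is_pdf_uniform. Qed.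

Let uniform_sq_integrable : mu.-integrable setT (fun t => (t ^+ 2 * unif t)%:E).
Proof.
have [mU U0 _] := is_pdf_uniform.
apply: (@le_integrable _ _ _ mu setT measurableT _ (EFin \o unif)) => //.
- by apply/measurable_EFinP; apply: measurable_funM => //; exact: exprn_measurable.
- move=> t _ /=; rewrite lee_fin normrM ger0_norm ?sqr_ge0// /uniform_pdf.
  case: ifPn => [/andP[t0 t1]|_]; last by rewrite normr0 mulr0.
  by rewrite ler_piMl// exprn_ile1.
- exact: integrable_pdf is_pdf_uniform _ measurableT.
Qed.

Lemma uniform_second_moments d (nu : probability 'rV[R]_d R) :
  uniform_law nu -> second_moments nu.
Proof.
move=> nuU i; apply/(integrable_coord (uniform_product_law nuU) i (u := fun t => t ^+ 2)) => //.
Qed.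

Lemma covmx_uniform d (nu : probability 'rV[R]_d R) : uniform_law nu ->
  covmx (pushforward nu id) = diag_mx (\row_(i < d) 12^-1).
Proof.
move=> nuU; have := @covmx_push_product _ _ nu _ (fun t => t) (uniform_product_law nuU) (@measurable_id _ _ _) uniform_sq_integrable.
have := uniform_moment 1; under eq_Rintegral do rewrite expr1.
move=> ->; rewrite uniform_moment => E.
transitivity (diag_mx (\row_(i < d) (3%:R^-1 - 2%:R^-1 ^+ 2 : R))).
  by rewrite -E; congr (covmx (pushforward nu _)); apply/funext => x; apply/rowP => i; rewrite mxE.
by congr diag_mx; apply/rowP => i; rewrite !mxE; field.
Qed.

End uniform_reference.

(** * The bound 108/125 *)

Section score_identities.
Context {R : realType} {d : nat}.
Variables (P : probability 'rV[R]_d R) (c : 'I_d -> R -> R) (eta : 'rV[R]_d -> 'rV[R]_d).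
Hypotheses (Pc : product_law P c) (SP : score_property P c eta).
Let mu := (@lebesgue_measure R).

Let pc i : is_pdf (c i). Proof. by case: Pc. Qed.
Let mc i : measurable_fun setT (c i). Proof. by case: (pc i). Qed.

Lemma score_integrable j : P.-integrable setT (fun x => (eta x 0 j)%:E).
Proof. by have [] := SP j. Qed.

Lemma score_measurable j : measurable_fun setT (fun x => eta x 0 j).
Proof. exact: measurable_integrable (score_integrable j). Qed.

(** [expectation_primitive] with H = eta_j, the tail expectation being replaced by (i == j) c_i. For
    i != j the integrand that Fubini's theorem controls vanishes, so the integrability of w c_i is
    obtained for i = j only. *)
Lemma score_primitive i j (w W : R -> R) t0 : measurable_fun setT w -> (forall s, 0 <= w s) ->
  {ae P, forall x : 'rV[R]_d,
  (t0 <= x 0 i -> (\int[mu]_(s in `[t0, x 0%R i[) (w s)%:E = (W (x 0%R i))%:E)%E) /\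
  (x 0 i < t0 -> (\int[mu]_(s in `[x 0%R i, t0[) (w s)%:E = (- W (x 0%R i))%:E)%E)} ->
  P.-integrable setT (fun x => (W (x 0 i) * eta x 0 j)%:E) ->
  (i = j -> mu.-integrable setT (fun s => (w s * c i s)%:E)) /\
  \int[P]_x (W (x 0 i) * eta x 0 j) = (i == j)%:R * \int[mu]_s (w s * c i s).
Proof.
move=> mw w0 Ww iWH; have [ieta Eeta Geta] := SP j.
have mWH := measurable_integrable iWH.
have [ig eg] := @expectation_primitive _ _ _ P (fun x : 'rV[R]_d => x 0 i) (fun x => eta x 0 j) w W t0
  (measurable_coord i) ieta Eeta mw w0 Ww mWH iWH.
have mg := measurable_integrable ig.
have gE : ae_eq mu setT (fun s => w s * \int[P]_x (eta x 0 j * (s < (x : 'rV[R]_d) 0 i)%R%:R))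
    (fun s => w s * ((i == j)%:R * c i s)).
  have := Geta i; apply: filterS; first exact: (ae_filter_ringOfSetsType mu).
  by move=> s -> _.
have mwc : measurable_fun (setT : set (measurableTypeR R)) (fun s => w s * ((i == j)%:R * c i s)).
  apply: measurable_funM; first exact: mw.
  by apply: measurable_funM; [exact: measurable_cst|exact: mc].
split.
  move=> ij; subst j; have := @ae_eq_integrable _ _ _ mu setT measurableT _ _ mwc gE ig.
  by under eq_fun do rewrite eqxx mul1r.
rewrite eg (@ae_eq_Rintegral _ _ _ mu setT measurableT _ _ mg mwc gE).
case: eqP => ij; last first.
  by rewrite mul0r /Rintegral; under eq_integral do rewrite mul0r mulr0; rewrite integral0.
by rewrite mul1r; apply: eq_Rintegral => s _; rewrite mul1r.
Qed.

Lemma score_id i j : P.-integrable setT (fun x => (eta x 0 j * x 0 i)%:E) ->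
  \int[P]_x (eta x 0 j * x 0 i) = (i == j)%:R.
Proof.
move=> iH; have iH' : P.-integrable setT (fun x => ((x : 'rV[R]_d) 0 i * eta x 0 j)%:E).
  by apply: eq_integrable iH => // x _; rewrite mulrC.
have [|_] := @score_primitive i j (fun=> 1) (fun t => t) 0 (measurable_cst _) (fun=> ler01) _ iH'.
  apply: aeW => x; split => hx.
    by rewrite integral_cst// mul1e [LHS](@lebesgue_measure_itv R `[0, x 0 i[)/= lte_fin; case: ltP => [_|h]; rewrite ?sube0//; congr EFin; lra.
  by rewrite integral_cst// mul1e [LHS](@lebesgue_measure_itv R `[x 0 i, 0[)/= lte_fin hx add0e.
under eq_Rintegral do rewrite mulrC.
move=> ->.
under eq_Rintegral do rewrite mul1r.
by have [_ _ c1] := pc i; rewrite /Rintegral c1 mulr1.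
Qed.

(** [score_primitive] with w = c_i. Its primitive from 0 is F_i - F_i(0), and the constant drops out
    because eta_j is centred. *)
Lemma score_cdf i j : P.-integrable setT (fun x => (eta x 0 j * pcdf (c i) (x 0 i))%:E) /\
  \int[P]_x (eta x 0 j * pcdf (c i) (x 0 i)) = (i == j)%:R * \int[mu]_s (c i s ^+ 2).
Proof.
have mF : measurable_fun setT (fun x : 'rV[R]_d => pcdf (c i) (x 0 i)).
  by apply: measurableT_comp; [exact: measurable_pcdf|exact: measurable_coord].
have iH : P.-integrable setT (fun x => (eta x 0 j * pcdf (c i) (x 0 i))%:E).
  apply: (@le_integrable _ _ _ P setT measurableT _ (fun x => (eta x 0 j)%:E)) => //.
  - by apply/measurable_EFinP; apply: measurable_funM => //; exact: score_measurable.
  - move=> x _ /=; rewrite lee_fin normrM ler_piMr// ger0_norm ?pcdf_ge0//.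
    exact: pcdf_le1.
  - exact: score_integrable.
split => //; pose W t := pcdf (c i) t - pcdf (c i) 0.
have iW : P.-integrable setT (fun x => (W ((x : 'rV[R]_d) 0 i) * eta x 0 j)%:E).
  apply: (@eq_integrable _ _ _ P setT measurableT (fun x => (eta x 0 j * pcdf (c i) (x 0 i) - pcdf (c i) 0 * eta x 0 j)%:E)).
    by move=> x _; congr EFin; rewrite /W; ring.
  by apply: integrable_realB => //; apply: integrable_realMl => //; exact: score_integrable.
have c0 s : 0 <= c i s by case: (pc i).
have [|_] := @score_primitive i j (c i) W 0 (mc i) c0 _ iW.
  apply: aeW => x; split => hx; first by rewrite pcdf_itvco.
  by rewrite pcdf_itvco ?ltW// /W opprB.
under [X in _ = _ * X -> _]eq_Rintegral do rewrite -expr2.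
move=> <-.
transitivity (\int[P]_x (eta x 0 j * pcdf (c i) (x 0 i) - pcdf (c i) 0 * eta x 0 j)); last first.
  by apply: eq_Rintegral => x _; rewrite /W; ring.
rewrite RintegralB//; last by apply: integrable_realMl => //; exact: score_integrable.
by rewrite RintegralZl//; [have [_ -> _] := SP j; rewrite mulr0 subr0|exact: score_integrable].
Qed.

(** Square integrability is not assumed of a component density but follows from the existence of a
    score: F_i is bounded and eta_i integrable, so Fubini's theorem applies with w = c_i. *)
Lemma pdf_sq_integrable i : mu.-integrable setT (fun s => (c i s ^+ 2)%:E).
Proof.
have [iH _] := score_cdf i i; pose W t := pcdf (c i) t - pcdf (c i) 0.
have iW : P.-integrable setT (fun x => (W ((x : 'rV[R]_d) 0 i) * eta x 0 i)%:E).
  apply: (@eq_integrable _ _ _ P setT measurableT (fun x => (eta x 0 i * pcdf (c i) (x 0 i) - pcdf (c i) 0 * eta x 0 i)%:E)).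
    by move=> x _; congr EFin; rewrite /W; ring.
  by apply: integrable_realB => //; apply: integrable_realMl => //; exact: score_integrable.
have c0 s : 0 <= c i s by case: (pc i).
have [|H _] := @score_primitive i i (c i) W 0 (mc i) c0 _ iW.
  apply: aeW => x; split => hx; first by rewrite pcdf_itvco.
  by rewrite pcdf_itvco ?ltW// /W opprB.
by have := H erefl; under eq_fun do rewrite -expr2.
Qed.

End score_identities.

(** * Epanechnikov densities and the integral of a squared density *)

Section epanechnikov.
Context {R : realType}.
Let mu := (@lebesgue_measure R).

Definition epanechnikov (m s t : R) : R :=
  3 / (20 * Num.sqrt 5 * s ^+ 3) * (5 * s ^+ 2 - (t - m) ^+ 2)
      * (`|t - m| <= Num.sqrt 5 * s)%R%:R.

Variables (m s : R).
Hypothesis s0 : 0 < s.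
Let q : R := Num.sqrt 5.
Let q0 : 0 < q. Proof. by rewrite sqrtr_gt0. Qed.
Let q2 : q ^+ 2 = 5. Proof. by rewrite sqr_sqrtr. Qed.
Let r := q * s.
Let r0 : 0 < r. Proof. exact: mulr_gt0. Qed.
Let K := 3 / (20 * q * s ^+ 3).
Let K0 : 0 < K. Proof. by rewrite divr_gt0// !mulr_gt0// exprn_gt0. Qed.
Local Notation e := (epanechnikov m s).

Let r2 : r ^+ 2 = 5 * s ^+ 2. Proof. by rewrite exprMn q2. Qed.

Let absE t : (`|t - m| <= r) = (m - r <= t <= m + r).
Proof. by rewrite ler_norml; apply/idP/idP => /andP[? ?]; apply/andP; split; lra. Qed.

(** The normalisation: r^2 - u^2 has integral 4 r^3 / 3 over [-r, r]. *)
Let Kr : K * r ^+ 3 = 3 / 4.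
Proof.
rewrite /K /r; have -> : (q * s) ^+ 3 = q * q ^+ 2 * s ^+ 3 by ring.
by rewrite q2; field; rewrite ?gt_eqF.
Qed.

Lemma epanechnikov_ge0 t : 0 <= e t.
Proof.
rewrite /epanechnikov -/q -/K -/r; case: (leP `|t - m| r) => h; last by rewrite mulr0.
rewrite mulr1; apply: mulr_ge0; first exact: ltW.
rewrite subr_ge0 -r2 -real_normK ?num_real// ler_pXn2r ?nnegrE//.
exact: ltW.
Qed.

Lemma epanechnikov_ge t : K * (r ^+ 2 - (t - m) ^+ 2) <= e t.
Proof.
rewrite /epanechnikov -/q -/K -/r -r2; case: (leP `|t - m| r) => h; first by rewrite mulr1.
rewrite mulr0; apply: mulr_ge0_le0; first exact: ltW.
rewrite subr_le0 -[leRHS]real_normK ?num_real// ler_pXn2r ?nnegrE//; exact: ltW.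
Qed.

Lemma measurable_epanechnikov : measurable_fun setT e.
Proof.
apply: measurable_funM.
  apply: measurable_funM => //; apply: measurable_funB => //.
  by apply: measurable_funX; exact: measurable_funB.
rewrite (_ : (fun _ => _) = \1_(`[m - r, m + r]%classic)); first exact: measurable_indic.
by apply/funext => t; rewrite indicE mem_setE in_itv/= -absE.
Qed.

(** The density is a polynomial cut off at m - r and m + r, so all the integrals below are
    differences of two values of an antiderivative. *)
Lemma integral_epanechnikov (p h : R -> R) : continuous p ->
  (forall t : R, is_derive t (1 : R) h (p t * (K * (r ^+ 2 - (t - m) ^+ 2)))) ->
  mu.-integrable setT (fun t => (p t * e t)%:E) /\
  \int[mu]_t (p t * e t) = h (m + r) - h (m - r).
Proof.
move=> cp hf; have ab : m - r < m + r by rewrite ltrD2l gtrN.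
pose f t := p t * (K * (r ^+ 2 - (t - m) ^+ 2)).
have cq : continuous (fun t : R => K * (r ^+ 2 - (t - m) ^+ 2)).
  move=> t; apply: (@continuousM _ R (fun=> K) (fun t => r ^+ 2 - (t - m) ^+ 2)); first exact: cst_continuous.
  apply: (@continuousB _ R^o); first exact: cst_continuous.
  apply: (@continuous_comp R R R (fun t => t - m) (fun u => u ^+ 2)); last exact: exprn_continuous.
  by apply: (@continuousB _ R^o) => //; exact: cst_continuous.
have cf : continuous f by move=> t; apply: (@continuousM _ R p (fun t => K * (r ^+ 2 - (t - m) ^+ 2))); [exact: cp|exact: cq].
have E t : (p t * e t)%:E = ((EFin \o f) \_ `[m - r, m + r]) t.
  rewrite patchE mem_setE in_itv/= -absE /f /epanechnikov -/q -/K -/r -r2.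
  by case: (`|t - m| <= r); rewrite ?mulr1 ?mulr0.
split.
  under eq_fun do rewrite E.
  apply/integrable_restrict => //; rewrite setTI.
  apply: continuous_compact_integrable; first exact: segment_compact.
  exact: continuous_subspaceT.
rewrite /Rintegral; under eq_integral do rewrite E.
by rewrite -integral_mkcond (FTC2_everywhere cf hf ab).
Qed.

Lemma epanechnikov_mean : mu.-integrable setT (fun t => ((t - m) * e t)%:E) /\
  \int[mu]_t ((t - m) * e t) = 0.
Proof.
have [|t|i E] := @integral_epanechnikov (fun t => t - m)
  (fun t => K * (r ^+ 2 * ((t - m) ^+ 2 / 2) - (t - m) ^+ 4 / 4)).
- by move=> t; apply: (@continuousB _ R^o) => //; exact: cst_continuous.
- by apply: is_derive_eq; rewrite /GRing.scale/=; field.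
- by split => //; rewrite E; ring.
Qed.

Lemma epanechnikov_variance : mu.-integrable setT (fun t => ((t - m) ^+ 2 * e t)%:E) /\
  \int[mu]_t ((t - m) ^+ 2 * e t) = s ^+ 2.
Proof.
have [|t|i E] := @integral_epanechnikov (fun t => (t - m) ^+ 2)
  (fun t => K * (r ^+ 2 * ((t - m) ^+ 3 / 3) - (t - m) ^+ 5 / 5)).
- move=> t; apply: (@continuous_comp R R R (fun t => t - m) (fun u => u ^+ 2)); last exact: exprn_continuous.
  by apply: (@continuousB _ R^o) => //; exact: cst_continuous.
- by apply: is_derive_eq; rewrite /GRing.scale/=; field.
- split => //; rewrite E.
  transitivity (4 / 15 * (K * r ^+ 3) * r ^+ 2); first by field.
  by rewrite Kr r2; field.
Qed.

Lemma epanechnikov_sq : mu.-integrable setT (fun t => (e t ^+ 2)%:E) /\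
  \int[mu]_t (e t ^+ 2) = 3 / (5 * r).
Proof.
have [|t|i E] := @integral_epanechnikov (fun t => K * (r ^+ 2 - (t - m) ^+ 2))
  (fun t => K ^+ 2 * (r ^+ 4 * (t - m) - 2 * r ^+ 2 * ((t - m) ^+ 3 / 3) + (t - m) ^+ 5 / 5)).
- move=> t; apply: (@continuousM _ R (fun=> K) (fun t => r ^+ 2 - (t - m) ^+ 2)); first exact: cst_continuous.
  apply: (@continuousB _ R^o); first exact: cst_continuous.
  apply: (@continuous_comp R R R (fun t => t - m) (fun u => u ^+ 2)); last exact: exprn_continuous.
  by apply: (@continuousB _ R^o) => //; exact: cst_continuous.
- by apply: is_derive_eq; rewrite /GRing.scale/=; field.
have ee t : K * (r ^+ 2 - (t - m) ^+ 2) * e t = e t ^+ 2.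
  rewrite /epanechnikov -/q -/K -/r -r2; case: (`|t - m| <= r); rewrite ?mulr1 ?mulr0 ?expr0n//.
split; first by move: i; under eq_fun do rewrite ee.
under eq_Rintegral do rewrite -ee; rewrite E.
transitivity (16 / 15 * (K * r ^+ 3) ^+ 2 / r); first by field; rewrite gt_eqF.
by rewrite Kr; field; rewrite gt_eqF.
Qed.

End epanechnikov.

Section square_integral_bound.
Context {R : realType} (c : R -> R) (m v : R).
Let mu := (@lebesgue_measure R).
Hypotheses (pc : is_pdf c) (c2 : mu.-integrable setT (fun t => (c t ^+ 2)%:E)).
Hypotheses (v0 : 0 < v) (im2 : mu.-integrable setT (fun t => ((t - m) ^+ 2 * c t)%:E))
  (m2 : \int[mu]_t ((t - m) ^+ 2 * c t) = v).

Let s := Num.sqrt v.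
Let s0 : 0 < s. Proof. by rewrite sqrtr_gt0. Qed.
Let s2 : s ^+ 2 = v. Proof. by rewrite sqr_sqrtr// ltW. Qed.
Let q : R := Num.sqrt 5.
Let q0 : 0 < q. Proof. by rewrite sqrtr_gt0. Qed.
Let q2 : q ^+ 2 = 5. Proof. by rewrite sqr_sqrtr. Qed.
Local Notation e := (epanechnikov m s).
(** The integral of e^2, by [epanechnikov_sq]. *)
Let a := 3 / (5 * (q * s)).
Let mc : measurable_fun setT c. Proof. by case: pc. Qed.
Let me : measurable_fun setT e. Proof. exact: measurable_epanechnikov. Qed.

Let ice : mu.-integrable setT (fun t => (c t * e t)%:E).
Proof. by apply: integrable_mul_sq => //; exact: (epanechnikov_sq m s0).1. Qed.

(** Below e lies the parabola K ((q s)^2 - (t - m)^2), whose integral against c sees only the mass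
    and the variance of c: K (5 s^2 - s^2) = 4 K s^2 = a. *)
Let ce_ge : a <= \int[mu]_t (c t * e t).
Proof.
pose K := 3 / (20 * q * s ^+ 3).
have i1 : mu.-integrable setT (fun t => (K * (q * s) ^+ 2 * c t)%:E).
  by apply: integrable_realMl => //; exact: (integrable_pdf pc measurableT).
have i2 : mu.-integrable setT (fun t => (K * ((t - m) ^+ 2 * c t))%:E) by exact: integrable_realMl.
have -> : a = \int[mu]_t (K * (q * s) ^+ 2 * c t - K * ((t - m) ^+ 2 * c t)).
  rewrite RintegralB// !RintegralZl//; last exact: (integrable_pdf pc measurableT).
  have -> : \int[mu]_t c t = 1 by have [_ _ c1] := pc; rewrite /Rintegral c1.
  rewrite m2 -s2 mulr1 -mulrBr.
  have -> : (q * s) ^+ 2 - s ^+ 2 = 4 * s ^+ 2 by rewrite exprMn q2; ring.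
  by rewrite /a /K; field; rewrite !gt_eqF.
apply: le_Rintegral => //; first exact: integrable_realB.
move=> t _; have c0 : 0 <= c t by case: pc.
have := epanechnikov_ge m s0 t; rewrite -/q -/K => h.
have -> : K * (q * s) ^+ 2 * c t - K * ((t - m) ^+ 2 * c t) = c t * (K * ((q * s) ^+ 2 - (t - m) ^+ 2)) by ring.
exact: ler_wpM2l.
Qed.

Let k t := (c t - e t) ^+ 2.

Let ik : mu.-integrable setT (fun t => (k t)%:E) /\
  \int[mu]_t k t = \int[mu]_t (c t ^+ 2) - 2 * \int[mu]_t (c t * e t) + a.
Proof.
have [ie2 e2] := epanechnikov_sq m s0.
have i1 : mu.-integrable setT (fun t => (2 * (c t * e t))%:E) by exact: integrable_realMl.
have i2 : mu.-integrable setT (fun t => (c t ^+ 2 - 2 * (c t * e t))%:E) by exact: integrable_realB.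
have kE t : k t = c t ^+ 2 - 2 * (c t * e t) + e t ^+ 2 by rewrite /k; ring.
split.
  by under eq_fun do rewrite kE; apply: integrable_realD.
under eq_Rintegral do rewrite kE.
by rewrite RintegralD// RintegralB// RintegralZl// e2.
Qed.

Let k_ge0 : 0 <= \int[mu]_t k t /\ (\int[mu]_t k t = 0 -> {ae mu, forall t, k t = 0}).
Proof.
by apply: (ae_ge0_Rintegral ik.1); apply: aeW => t; exact: sqr_ge0.
Qed.

Let A := \int[mu]_t (c t ^+ 2).

Let a0 : 0 < a.
Proof. by rewrite divr_gt0// !mulr_gt0. Qed.

Let aA : a <= A.
Proof. by have := k_ge0.1; rewrite ik.2 -/A; have := ce_ge; lra. Qed.

(** The scale cancels: s^2 a^2 = 9 / 125, and 12 is the inverse of the variance of the uniform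
    law. *)
Let va : v * (a ^+ 2 / 12^-1) = 108 / 125.
Proof.
rewrite /a -s2; have -> : (3 / (5 * (q * s))) ^+ 2 = 9 / (25 * (q ^+ 2 * s ^+ 2)).
  by field; rewrite !gt_eqF.
by rewrite q2; field; rewrite gt_eqF.
Qed.

Lemma square_integral_ge : 108 / 125 <= v * (A ^+ 2 / 12^-1).
Proof.
rewrite -va ler_pM2l// ler_pM2r ?invr_gt0//.
by rewrite ler_pXn2r ?nnegrE ?(le_trans (ltW a0) aA)//; exact: ltW.
Qed.

(** If A = a, then \int (c - e)^2 = A - 2 \int c e + a <= 0. *)
Lemma square_integral_eq : v * (A ^+ 2 / 12^-1) = 108 / 125 ->
  {ae mu, forall t, c t = e t}.
Proof.
rewrite -va => /(mulfI (lt0r_neq0 v0))/(mulIf _) => /(_ _)/eqP.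
rewrite eqrXn2 ?(le_trans (ltW a0) aA)//; last exact: ltW.
have n0 : (12^-1)^-1 != 0 :> R by rewrite invrK.
move=> /(_ n0)/eqP Aa.
have k00 : \int[mu]_t k t = 0.
  apply/eqP; rewrite eq_le k_ge0.1 andbT ik.2 -/A Aa.
  have := ce_ge; lra.
have := k_ge0.2 k00; apply: filterS; first exact: (ae_filter_ringOfSetsType mu).
by move=> t /eqP; rewrite sqrf_eq0 subr_eq0 => /eqP.
Qed.

End square_integral_bound.

Lemma ae_itv_ex {R : realType} (Q : R -> Prop) (a b : R) : a < b ->
  {ae (@lebesgue_measure R), forall t, Q t} -> exists t, a < t < b /\ Q t.
Proof.
move=> ab [M [mM M0 QM]]; apply/not_existsP => H.
have : (lebesgue_measure `]a, b[%classic <= lebesgue_measure M)%E.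
  apply: le_measure; rewrite ?inE// => t /=; rewrite in_itv/= => tab.
  by apply: QM => Qt; apply: (H t).
rewrite M0 [leLHS](@lebesgue_measure_itv R `]a, b[)/= lte_fin ab -EFinB lee_fin.
by rewrite leNgt subr_gt0 ab.
Qed.

(** * Epanechnikov components contradict a square integrable score *)

Section epanechnikov_irregular.
Context {R : realType} {d : nat}.
Variables (P : probability 'rV[R]_d R) (c : 'I_d -> R -> R) (eta : 'rV[R]_d -> 'rV[R]_d).
Hypotheses (Pc : product_law P c) (SP : score_property P c eta).
Variables (j : 'I_d) (m s : R).
Hypotheses (s0 : 0 < s) (eta2 : P.-integrable setT (fun x => (eta x 0 j ^+ 2)%:E)).
Let mu := (@lebesgue_measure R).
Hypothesis cE : {ae mu, forall t, c j t = epanechnikov m s t}.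

Let q : R := Num.sqrt 5.
Let q0 : 0 < q. Proof. by rewrite sqrtr_gt0. Qed.
Let q2 : q ^+ 2 = 5. Proof. by rewrite sqr_sqrtr. Qed.
Let r := q * s.
Let r0 : 0 < r. Proof. exact: mulr_gt0. Qed.
Let K := 3 / (20 * q * s ^+ 3).
Let K0 : 0 < K. Proof. by rewrite divr_gt0// !mulr_gt0// exprn_gt0. Qed.
Local Notation e := (epanechnikov m s).

Let r2 : 5 * s ^+ 2 = r ^+ 2. Proof. by rewrite exprMn q2. Qed.

Let e_in t : m < t < m + r -> K * r * (m + r - t) <= e t.
Proof.
move=> /andP[mt tr]; apply: le_trans (epanechnikov_ge m s0 t); rewrite -/q -/K -/r -mulrA ler_pM2l//.
have -> : r ^+ 2 - (t - m) ^+ 2 = (r + (t - m)) * (m + r - t) by ring.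
rewrite ler_pM2r ?subr_gt0//; lra.
Qed.

Let e_tail b t : m < b -> b < t -> e t <= 2 * K * r * (m + r - b) * \1_(`]b, m + r]%classic) t.
Proof.
move=> mb bt; rewrite /epanechnikov -/q -/K -/r r2 indicE mem_setE in_itv/= bt/=.
have -> : (`|t - m| <= r) = (t <= m + r) by rewrite ger0_norm ?subr_ge0 ?lerBlDl//; lra.
case: (leP t (m + r)) => h; last by rewrite !mulr0.
rewrite !mulr1.
have -> : 2 * K * r * (m + r - b) = K * (2 * r * (m + r - b)) by ring.
rewrite ler_pM2l//.
have -> : r ^+ 2 - (t - m) ^+ 2 = (r + (t - m)) * (m + r - t) by ring.
have tm : t - m <= r by rewrite lerBlDl.
have mt : 0 <= t - m by rewrite subr_ge0 ltW// (lt_trans mb).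
apply: ler_pM.
- exact: addr_ge0 (ltW r0) mt.
- by rewrite subr_ge0.
- by rewrite mulr_natl mulr2n lerD2l.
- by rewrite lerD2l lerN2 ltW.
Qed.

Let tail_le b : m < b < m + r -> \int[P]_x ((b < (x : 'rV[R]_d) 0 j)%R%:R) <= 2 * K * r * (m + r - b) ^+ 2.
Proof.
move=> /andP[mb br]; have D0 : 0 < m + r - b by rewrite subr_gt0.
have C0 : 0 <= 2 * K * r * (m + r - b) 
  by apply: ltW; do 3![apply: mulr_gt0 => //].
have mI : measurable_fun setT (fun t : R => (b < t)%R%:R : R) by exact: measurable_ltR.
have [mcj _ _] : is_pdf (c j) by case: Pc.
rewrite /Rintegral (expectation_coord Pc j (u := fun t => (b < t)%R%:R))//.
have -> : (\int[lebesgue_measure]_t ((b < t)%R%:R * c j t)%:E = \int[mu]_t ((b < t)%R%:R * e t)%:E)%E.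
  apply: ae_eq_integral => //.
  - by apply/measurable_EFinP; apply: measurable_funM; [exact: mI|exact: mcj].
  - by apply/measurable_EFinP; apply: measurable_funM; [exact: mI|exact: measurable_epanechnikov].
  - by have := cE; apply: filterS; [exact: (ae_filter_ringOfSetsType mu)|move=> t -> _].
have B : (\int[mu]_t ((b < t)%R%:R * e t)%:E <= (2 * K * r * (m + r - b) ^+ 2)%:E)%E.
  apply: (@le_trans _ _ (\int[mu]_t (2 * K * r * (m + r - b) * \1_(`]b, m + r]%classic) t)%:E)%E).
    apply: ge0_le_integral => //.
    - by move=> t _; rewrite lee_fin mulr_ge0// epanechnikov_ge0.
    - by apply/measurable_EFinP; apply: measurable_funM; [exact: mI|exact: measurable_epanechnikov].
    - by apply/measurable_EFinP; apply: measurable_funM.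
    - move=> t _; rewrite lee_fin; case: ltP => h; first by rewrite mul1r; exact: e_tail.
      by rewrite mul0r; apply: mulr_ge0 => //; rewrite indicE.
  under eq_integral do rewrite EFinM.
  rewrite ge0_integralZl//; last by apply/measurable_EFinP.
  rewrite integral_indic// setIT [X in (_ * X)%E](@lebesgue_measure_itv R `]b, m + r])/= lte_fin br.
  have -> : 2 * K * r * (m + r - b) ^+ 2 = 2 * K * r * (m + r - b) * (m + r - b) by ring.
  by rewrite lexx.
rewrite -[leRHS]/(fine (2 * K * r * (m + r - b) ^+ 2)%:E) fine_le//.
rewrite ge0_fin_numE; first exact: (le_lt_trans B (ltry _)).
by apply: integral_ge0 => t _; rewrite lee_fin mulr_ge0// epanechnikov_ge0.
Qed.

Let isq b : P.-integrable setT (fun x => (eta x 0 j ^+ 2 * (b < (x : 'rV[R]_d) 0 j)%R%:R)%:E).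
Proof.
apply: (integrable_mul_ind (b := fun x : 'rV[R]_d => b < x 0 j)) => //.
by apply: measurable_ltR => //; exact: measurable_coord.
Qed.

(** Integrate 2 eta <= 2 D eta^2 + 1 / (2 D) over {b < x_j}. The left side becomes 2 e(b) >= 2 K r
    D, and the tail bound makes the last term at most K r D. The weight 2 D is chosen so that K r D
    remains for 2 D times the energy. *)
Let energy_ge b : m < b < m + r ->
  \int[P]_x (eta x 0 j * (b < (x : 'rV[R]_d) 0 j)%R%:R) = e b ->
  K * r / 2 <= \int[P]_x (eta x 0 j ^+ 2 * (b < (x : 'rV[R]_d) 0 j)%R%:R).
Proof.
move=> bm Eb; have [mb br] := andP bm; pose D := m + r - b.
have D0 : 0 < D by rewrite subr_gt0.
have isqb := isq b.
have iI : P.-integrable setT (fun x => ((b < (x : 'rV[R]_d) 0 j)%R%:R)%:E).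
  have := @integrable_mul_ind _ _ _ P (fun=> 1) (fun x : 'rV[R]_d => b < x 0 j).
  under [X in _ -> _ -> P.-integrable _ X]eq_fun do rewrite mul1r.
  apply; first by apply: measurable_ltR => //; exact: measurable_coord.
  exact: finite_measure_integrable_cst.
have i1 : P.-integrable setT (fun x => (eta x 0 j * (b < (x : 'rV[R]_d) 0 j)%R%:R)%:E).
  apply: (integrable_mul_ind (b := fun x : 'rV[R]_d => b < x 0 j)).
    by apply: measurable_ltR => //; exact: measurable_coord.
  exact: (score_integrable SP).
have key : \int[P]_x (2 * (eta x 0 j * (b < (x : 'rV[R]_d) 0 j)%R%:R)) <=
  \int[P]_x (2 * D * (eta x 0 j ^+ 2 * (b < (x : 'rV[R]_d) 0 j)%R%:R) + (2 * D)^-1 * (b < (x : 'rV[R]_d) 0 j)%R%:R).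
  apply: le_Rintegral => //.
  - exact: integrable_realMl.
  - by apply: integrable_realD => //; apply: integrable_realMl.
  - move=> x _; case: (b < x 0 j); last by rewrite !mulr0 addr0.
    rewrite !mulr1 -subr_ge0.
    have -> : 2 * D * eta x 0 j ^+ 2 + (2 * D)^-1 - 2 * eta x 0 j = (2 * D * eta x 0 j - 1) ^+ 2 / (2 * D).
      by field; rewrite gt_eqF.
    by rewrite divr_ge0 ?sqr_ge0// mulr_ge0// ltW.
rewrite RintegralZl// Eb in key.
rewrite RintegralD// in key; [|exact: integrable_realMl|exact: integrable_realMl].
rewrite !RintegralZl// in key.
have := e_in bm; have := tail_le bm; rewrite -/D.
move: key; set E2 := \int[P]_x (eta x 0 j ^+ 2 * _); set T := \int[P]_x (_%:R).
move=> key tl el.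
have tl' : (2 * D)^-1 * T <= K * r * D.
  by rewrite ler_pdivrMl ?mulr_gt0//; apply: (le_trans tl); rewrite le_eqVlt; apply/orP; left; apply/eqP; ring.
have : K * r * D <= 2 * D * E2 by lra.
have -> : K * r * D = 2 * D * (K * r / 2) by field.
by rewrite ler_pM2l// mulr_gt0.
Qed.

(* Near the right end point, at distance D, the density e is of order D and the
   tail probability of order D^2. By Cauchy-Schwarz, e(b)^2 =
   E[eta_j 1(b < x_j)]^2 <= E[eta_j^2 1(b < x_j)] P(b < x_j), so the energy of
   eta_j does not vanish at the end point, which contradicts its integrability. *)
Lemma epanechnikov_irregular : False.
Proof.
have [_ _ /(_ j)] := SP j; rewrite eqxx => Gj.
have good : {ae mu, forall b, \int[P]_x (eta x 0 j * (b < (x : 'rV[R]_d) 0 j)%R%:R) = e b}.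
  have := cE; apply: filterS2 Gj; first exact: (ae_filter_ringOfSetsType mu).
  by move=> b -> ->; rewrite mul1r.
(* Points that tend to the right end m + r, picked where the almost everywhere identity holds. *)
have bex n : exists b, m + r - r / n.+1%:R < b < m + r /\
    \int[P]_x (eta x 0 j * (b < (x : 'rV[R]_d) 0 j)%R%:R) = e b.
  by apply: ae_itv_ex good; rewrite gtrBl divr_gt0.
pose b n := projT1 (cid (bex n)).
have bP n : m + r - r / n.+1%:R < b n < m + r /\
    \int[P]_x (eta x 0 j * (b n < (x : 'rV[R]_d) 0 j)%R%:R) = e (b n) := projT2 (cid (bex n)).
have bm n : m < b n < m + r.
  have [/andP[h1 ->] _] := bP n; rewrite andbT; apply: le_lt_trans h1.
  rewrite -addrA lerDl subr_ge0 ler_pdivrMr// ler_peMr//; first exact: ltW.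
  by rewrite ler1n.
(* The factor 1(x_j < m + r) is almost surely 1; it makes f n tend to 0 at every point. *)
pose f n (x : 'rV[R]_d) := eta x 0 j ^+ 2 * (b n < x 0 j)%R%:R * (x 0 j < m + r)%R%:R.
have mfn n : measurable_fun setT (f n).
  apply: measurable_funM; first exact: (measurable_integrable (isq (b n))).
  by apply: measurable_ltR => //; exact: measurable_coord.
have cv : (\int[P]_x (f n x)%:E)%E @[n --> \oo] --> (\int[P]_x (cst 0%E x))%E.
  apply: (@dominated_cvg _ _ _ P setT measurableT _ _ (fun x => (eta x 0 j ^+ 2)%:E)) => //.
  - by move=> n; exact/measurable_EFinP.
  - move=> x _; rewrite /f /cst; have [xr|xr] := ltP (x 0 j) (m + r); last first.
      by under eq_fun do rewrite mulr0; exact: cvg_cst.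
    apply: cvg_near_cst; exists (Num.bound (r / (m + r - x 0 j))) => // n /= hn.
    suff -> : (b n < x 0 j) = false by rewrite mulr0 mul0r.
    apply/negbTE; rewrite -leNgt; have [/andP[h1 _] _] := bP n; apply: ltW; apply: le_lt_trans h1.
    have D0 : 0 < m + r - x 0 j by rewrite subr_gt0.
    rewrite lerBrDr -lerBrDl ler_pdivrMr// mulrC -ler_pdivrMr//.
    apply: (le_trans (ltW (archi_boundP (divr_ge0 (ltW r0) (ltW D0))))).
    by rewrite ler_nat; apply: leq_trans hn _.
  - move=> n x _; rewrite /= lee_fin /f.
    case: (b n < x 0 j); case: (x 0 j < m + r); rewrite ?mulr1 ?mulr0 ?normr0 ?sqr_ge0//.
    by rewrite ger0_norm ?sqr_ge0.
rewrite integral0 in cv.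
have lt : {ae P, forall x : 'rV[R]_d, x 0 j < m + r}.
  apply: filterS2 (coord_ae Pc j cE) (coord_pdf_gt0_ae Pc j) => x -> .
  rewrite /epanechnikov -/q -/K -/r r2; case: (leP `|x 0 j - m| r) => h; last by rewrite mulr0 ltxx.
  rewrite mulr1 pmulr_rgt0// subr_gt0 -[X in X < _]real_normK ?num_real// ltr_pXn2r ?nnegrE// ?ltW//.
  by move=> /ltr_normlW; lra.
have fE n : (\int[P]_x (f n x)%:E = (\int[P]_x (eta x 0 j ^+ 2 * (b n < (x : 'rV[R]_d) 0 j)%R%:R))%:E)%E.
  rewrite /Rintegral fineK; last by apply: integrable_fin_num => //; exact: isq.
  apply: ae_eq_integral => //.
  - exact/measurable_EFinP.
  - by have /integrableP[] := isq (b n).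
  - by apply: filterS lt => x xr _; rewrite /f xr mulr1.
have Kr0 : 0 < K * r / 2 by rewrite divr_gt0// mulr_gt0.
have : ((K * r / 2)%:E <= 0)%E.
  rewrite -(cvg_lim _ cv)//; apply: lime_ge; first by apply/cvg_ex; exists 0%E.
  apply: nearW => n; rewrite fE lee_fin.
  by apply: energy_ge; [exact: bm|exact: (bP n).2].
by rewrite lee_fin leNgt Kr0.
Qed.

End epanechnikov_irregular.

(** * Scores computed from classical derivatives *)

Section classical_score.
Context {R : realType} {d : nat}.
Variables (X : F_ind R d) (j : 'I_d) (g psi : R -> R).
Let mu := (@lebesgue_measure R).
Local Notation c := (component_density X).
Hypothesis cg : {ae mu, forall t, c j t = g t}.

Let partial (x : 'rV[R]_d) (h : R) :
  Defs.family X x (h *: delta_mx 0 j + theta0 X) =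
  (\prod_(i | i != j) c i (x 0 i)) * c j (x 0 j - h).
Proof.
rewrite /Defs.family /product_location (bigD1 j)//= mulrC; congr (_ * _).
  apply: eq_bigr => i ij; rewrite /component_density !mxE (negbTE ij) andbF mulr0 add0r.
  by [].
by rewrite /component_density !mxE !eqxx mulr1 opprD addrA.
Qed.

(* c j and g agree only almost everywhere, but the partial derivative in the
   score exists, so it is computed along points at which they do agree. *)
Lemma classical_score_component (x : 'rV[R]_d) : has_grad (Defs.family X x) (theta0 X) ->
  (forall i, 0 < c i (x 0 i)) -> c j (x 0 j) = g (x 0 j) ->
  is_derive (x 0 j) (1 : R) g (- (psi (x 0 j) * g (x 0 j))) ->
  Defs.eta X x 0 j = psi (x 0 j).
Proof.
move=> /(_ j) dp c0 cgx [dg gE]; set t := x 0 j in cgx dg gE *.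
set C := \prod_(i | i != j) c i (x 0 i).
have C0 : 0 < C by apply: prodr_gt0 => i _; exact: c0.
set l := 'D_(delta_mx 0 j) (Defs.family X x) (theta0 X).
have px : Defs.family X x (theta0 X) = C * c j t.
  by have := partial x 0; rewrite scale0r add0r subr0.
suff lE : l = C * (psi t * g t).
  rewrite /Defs.eta /score !mxE -/l px lE -cgx; field.
  by rewrite !gt_eqF//; exact: c0.
pose q (h : R) := h^-1 * (C * c j (t - h) - C * c j t).
have ql : q h @[h --> (0 : R)^'] --> l.
  have : h^-1 *: (Defs.family X x (h *: delta_mx 0 j + theta0 X) - Defs.family X x (theta0 X)) @[h --> (0 : R)^'] --> l.
    exact: dp.
  apply: cvg_trans; apply: near_eq_cvg; apply: nearW => h.
  by rewrite partial px.
pose Q (h : R) := h^-1 * (g (h + t) - g t).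
have Ql : Q h @[h --> (0 : R)^'] --> - (psi t * g t).
  rewrite -gE; have : h^-1 *: (g (h *: 1 + t) - g t) @[h --> (0 : R)^'] --> 'D_1 g t by exact: dg.
  by apply: cvg_trans; apply: near_eq_cvg; apply: nearW => h; rewrite /Q [h *: 1]mulr1.
apply/eqP; rewrite -subr_eq0 -normr_le0; apply/ler_addgt0Pr => e e0; rewrite add0r.
have e1 : 0 < e / (1 + C) by rewrite divr_gt0// addr_gt0.
have /cvgrPdist_lt/(_ _ e1)/nbhs_ballP[r1 /= r10 H1] := ql.
have /cvgrPdist_lt/(_ _ e1)/nbhs_ballP[r2 /= r20 H2] := Ql.
pose r := Num.min r1 r2; have r0 : 0 < r by rewrite lt_min r10.
have [u [/andP[ur ut] cu]] : exists u, t - r < u < t /\ c j u = g u.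
  by apply: ae_itv_ex cg; rewrite gtrBl.
pose h := t - u; have h0 : 0 < h by rewrite subr_gt0.
have hr : h < r by rewrite /h; lra.
have hn0 : h != 0 by rewrite gt_eqF.
have /H1/(_ hn0) A1 : ball (0 : R) r1 h.
  by rewrite /ball/= sub0r normrN gtr0_norm// (lt_le_trans hr)// ge_min lexx.
have Nhn0 : - h != 0 by rewrite oppr_eq0.
have /H2/(_ Nhn0) A2 : ball (0 : R) r2 (- h).
  by rewrite /ball/= sub0r opprK gtr0_norm// (lt_le_trans hr)// ge_min lexx orbT.
(* A step h of the location moves the argument of the density from t to u = t - h, where c j and g
   agree; hence the quotient of g at -h, with the opposite sign. *)
have E : q h = - (C * Q (- h)).
  rewrite /q /Q; have -> : t - h = u by rewrite /h; ring.
  have -> : - h + t = u by rewrite /h; ring.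
  by rewrite cu cgx invrN; ring.
have -> : l - C * (psi t * g t) = (l - q h) + C * (- (psi t * g t) - Q (- h)).
  by rewrite E; ring.
apply: (le_trans (ler_normD _ _)); rewrite normrM (gtr0_norm C0).
have -> : e = e / (1 + C) + C * (e / (1 + C)) by field; rewrite gt_eqF// addr_gt0.
by apply: lerD; [exact: ltW|rewrite ler_pM2l// ltW].
Qed.

Hypothesis sX : has_score X.
Hypothesis g_derive : {ae law X, forall x : 'rV[R]_d,
  is_derive (x 0 j) (1 : R) g (- (psi (x 0 j) * g (x 0 j)))}.

Lemma classical_score : {ae law X, forall x, Defs.eta X x 0 j = psi (x 0 j)}.
Proof.
have Xc := product_law_F_ind X; have [_ sg] := sX.
have pos : {ae law X, forall x : 'rV[R]_d, forall i, 0 < c i (x 0 i)}.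
  by apply: filter_forall => i; exact: (coord_pdf_gt0_ae Xc).
have pos' : {ae law X, forall x : 'rV[R]_d, (forall i, 0 < c i (x 0 i)) /\ c j (x 0 j) = g (x 0 j)}.
  by apply: filterI => //; exact: (coord_ae Xc j cg).
apply: filterS3 sg pos' g_derive => x hx [px cx] gx.
exact: classical_score_component.
Qed.

End classical_score.

Section separable_score.
Context {R : realType} {d : nat}.
Variables (P : probability 'rV[R]_d R) (c : 'I_d -> R -> R) (eta : 'rV[R]_d -> 'rV[R]_d).
Variable psi : 'I_d -> R -> R.
Let mu := (@lebesgue_measure R).
Hypothesis Pc : product_law P c.
Hypotheses (meta : forall j, measurable_fun setT (fun x => eta x 0 j))
  (mpsi : forall j, measurable_fun setT (psi j))
  (etaE : forall j, {ae P, forall x, eta x 0 j = psi j (x 0 j)})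
  (ipsi : forall j, mu.-integrable setT (fun t => (psi j t * c j t)%:E))
  (psi0 : forall j, \int[mu]_t (psi j t * c j t) = 0)
  (psi_tail : forall j, {ae mu, forall s, \int[mu]_t (psi j t * (s < t)%R%:R * c j t) = c j s}).

Let mpsix j : measurable_fun setT (fun x : 'rV[R]_d => psi j (x 0 j)).
Proof. by apply: measurableT_comp => //; exact: measurable_coord. Qed.

Let ipsiP j : P.-integrable setT (fun x => (psi j (x 0 j))%:E).
Proof. by apply/(integrable_coord Pc j). Qed.

Let Epsi j : \int[P]_x psi j (x 0 j) = 0.
Proof. by rewrite /Rintegral (expectation_coord Pc j (mpsi j)); exact: psi0. Qed.

Lemma separable_integrable i j (u : R -> R) : measurable_fun setT u ->
  P.-integrable setT (fun x => (u (x 0 i))%:E) ->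
  mu.-integrable setT (fun t => (psi j t * u t * c j t)%:E) ->
  P.-integrable setT (fun x => (eta x 0 j * u (x 0 i))%:E).
Proof.
move=> mU iu iju; have mux : measurable_fun setT (fun x : 'rV[R]_d => u (x 0 i)).
  by apply: measurableT_comp => //; exact: measurable_coord.
apply: (@ae_eq_integrable _ _ _ P setT measurableT (fun x : 'rV[R]_d => psi j (x 0 j) * u (x 0 i))).
- exact: measurable_funM.
- by apply: filterS (etaE j) => x -> _.
have [ij|ij] := eqVneq j i.
  by subst i; apply/(integrable_coord Pc j (u := fun t => psi j t * u t)) => //; exact: measurable_funM.
exact: (expectation_coord2 Pc ij (mpsi j) mU (ipsiP j) iu).1.
Qed.

Lemma separable_expectation i j (u : R -> R) : measurable_fun setT u ->
  P.-integrable setT (fun x => (u (x 0 i))%:E) ->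
  mu.-integrable setT (fun t => (psi j t * u t * c j t)%:E) ->
  \int[P]_x (eta x 0 j * u (x 0 i)) = (i == j)%:R * \int[mu]_t (psi i t * u t * c i t).
Proof.
move=> mU iu iju; have iH := separable_integrable mU iu iju.
have mux : measurable_fun setT (fun x : 'rV[R]_d => u (x 0 i)).
  by apply: measurableT_comp => //; exact: measurable_coord.
transitivity (\int[P]_x (psi j (x 0 j) * u (x 0 i))).
  apply: ae_eq_Rintegral => //; first exact: (measurable_integrable iH).
    exact: measurable_funM.
  by apply: filterS (etaE j) => x -> _.
have [ij|ij] := eqVneq j i.
  subst i; rewrite mul1r /Rintegral (expectation_coord Pc j (u := fun t => psi j t * u t))//.
  exact: measurable_funM.
rewrite (expectation_coord2 Pc ij (mpsi j) mU (ipsiP j) iu).2 Epsi mul0r.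
by rewrite mul0r.
Qed.

(** The counterpart of [regular_score_property] for laws that merely have a score: the tail identity
    is computed from the explicit psi_j, and independence with E psi_j = 0 gives the zeros for i !=
    j. *)
Lemma separable_score_property : score_property P c eta.
Proof.
move=> j; split.
- apply: (@ae_eq_integrable _ _ _ P setT measurableT (fun x : 'rV[R]_d => psi j (x 0 j))) => //.
  by apply: filterS (etaE j) => x -> _.
- rewrite -(Epsi j); apply: ae_eq_Rintegral => //.
  by apply: filterS (etaE j) => x -> _.
- move=> i; have := psi_tail i; apply: filterS; first exact: (ae_filter_ringOfSetsType mu).
  move=> s <-.
  have mI : measurable_fun setT (fun t : R => (s < t)%R%:R : R) by exact: measurable_ltR.
  apply: (separable_expectation (u := fun t => (s < t)%R%:R)) => //.
  + have := @integrable_mul_ind _ _ _ P (fun=> 1) (fun x : 'rV[R]_d => s < x 0 i).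
    under [X in _ -> _ -> P.-integrable _ X]eq_fun do rewrite mul1r.
    apply; first by apply: measurable_ltR => //; exact: measurable_coord.
    exact: finite_measure_integrable_cst.
  + have [mcj _ _] : is_pdf (c j) by case: Pc.
    apply: (@le_integrable _ _ _ mu setT measurableT _ (fun t => (psi j t * c j t)%:E)) => //.
      apply/measurable_EFinP; apply: measurable_funM; last exact: mcj.
      by apply: measurable_funM; [exact: mpsi|exact: mI].
    move=> t _ /=; rewrite lee_fin mulrAC normrM ler_piMr//.
    by case: (s < t); rewrite ?normr1 ?normr0.
Qed.

End separable_score.

(* What the two reference pairs of part (1) have in common: the scores are the
   probability integral transforms F_i(x_i). *)
Definition uniform_scores {R : realType} {d : nat} (nu : probability 'rV[R]_d R)
    (J : 'rV[R]_d -> 'rV[R]_d) : Prop :=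
  covmx (pushforward nu J) = diag_mx (\row_(i < d) 12^-1) /\
  forall P c, product_law P c -> second_moments P ->
    (forall i, measurable_fun setT (fun x => J (rank_map P nu x) 0 i)) /\
    {ae P, forall x, forall i, J (rank_map P nu x) 0 i = pcdf (c i) (x 0 i)}.

Lemma uniform_scores_normal_cdf {R : realType} {d : nat} (nu : probability 'rV[R]_d R) :
  std_normal_law nu -> uniform_scores nu normal_cdf_score.
Proof.
move=> nuN; split; first exact: covmx_normal_cdf.
move=> P c Pc P2; have nuP := std_normal_product_law nuN; split.
- move=> i; have [mT _ _] := rank_map_spec (coordinate_transport_rank_map Pc nuP normal_quantileP).
  rewrite (_ : (fun x => _) = (fun t => std_normal_cdf t) \o (fun x => rank_map P nu x 0 i)); last first.
    by apply/funext => x; rewrite /= mxE.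
  apply: measurableT_comp; first exact: (measurable_pcdf (is_pdf_normal 0 1)).
  exact: (measurableT_comp (measurable_coord i) mT).
- apply: filterS2 (rank_map_coordinate Pc nuP normal_quantileP P2 (std_normal_second_moments nuN)) (interior_ae Pc) => x -> xi i.
  by rewrite !mxE /monotone_transport xi std_normal_cdfE normal_quantileK.
Qed.

Lemma uniform_scores_id {R : realType} {d : nat} (nu : probability 'rV[R]_d R) :
  uniform_law nu -> uniform_scores nu id.
Proof.
move=> nuU; split; first exact: covmx_uniform.
move=> P c Pc P2; have nuP := uniform_product_law nuU; split.
- move=> i; have [mT _ _] := rank_map_spec (coordinate_transport_rank_map Pc nuP uniform_quantileP).
  exact: (measurableT_comp (measurable_coord i) mT).
- apply: filterS2 (rank_map_coordinate Pc nuP uniform_quantileP P2 (uniform_second_moments nuU)) (interior_ae Pc) => x -> xi i.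
  by rewrite !mxE /monotone_transport xi.
Qed.

Lemma finite_variances_second_moments {R : realType} {d : nat} (P : probability 'rV[R]_d R) :
  finite_variances P -> second_moments P.
Proof.
move=> fP i; apply/integrableP; split.
  by apply/measurable_EFinP; apply: measurable_funX; exact: measurable_coord.
by under eq_integral do rewrite /= ger0_norm ?sqr_ge0//; exact: fP.
Qed.

Lemma ratio_const {R : realFieldType} {d : nat} (a s h : 'I_d -> R) (k : R) :
  (forall i, 0 < s i) -> (forall i, s i * a i = k) -> (exists i, h i != 0) ->
  (\sum_i h i ^+ 2 * a i) / (\sum_i h i ^+ 2 / s i) = k.
Proof.
move=> s0 sa [i hi].
have -> : \sum_i h i ^+ 2 * a i = k * \sum_i h i ^+ 2 / s i.
  rewrite mulr_sumr; apply: eq_bigr => j _; rewrite -(sa j).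
  by have := lt0r_neq0 (s0 j); move=> sj; field.
rewrite mulfK// gt_eqF// (bigD1 i)//= ltr_pwDl//.
  by rewrite divr_gt0// lt_neqAle sqr_ge0 eq_sym sqrf_eq0 hi.
by apply: sumr_ge0 => j _; rewrite divr_ge0 ?sqr_ge0 ?ltW.
Qed.

Section coordinate_moments.
Context {R : realType} {d : nat}.
Variables (P : probability 'rV[R]_d R) (c : 'I_d -> R -> R).
Hypotheses (Pc : product_law P c) (P2 : second_moments P).
Let mu := (@lebesgue_measure R).
Variable i : 'I_d.
Let m := \int[P]_x x 0 i.

Lemma mean_integrable : P.-integrable setT (fun x : 'rV[R]_d => (x 0 i)%:E).
Proof. exact: (integrable_of_sq (b := fun _ t => t) (fun _ => @measurable_id _ _ _) P2 i). Qed.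

Lemma variance_integrable : mu.-integrable setT (fun t => ((t - m) ^+ 2 * c i t)%:E).
Proof.
have m2 : measurable_fun setT (fun t : R => (t - m) ^+ 2) by apply: measurable_funX; exact: measurable_funB.
apply/(integrable_coord Pc i m2).
apply: (@eq_integrable _ _ _ _ setT measurableT (fun x : 'rV[R]_d => (x 0 i ^+ 2 - (2 * m * x 0 i - m ^+ 2))%:E)).
  by move=> x _; congr EFin; ring.
apply: (integrable_realB measurableT (P2 i)).
apply: integrable_realB => //; last exact: finite_measure_integrable_cst.
by apply: integrable_realMl => //; exact: mean_integrable.
Qed.

Lemma varianceE : \int[mu]_t ((t - m) ^+ 2 * c i t) = variance P i.
Proof.
have m2 : measurable_fun setT (fun t : R => (t - m) ^+ 2) by apply: measurable_funX; exact: measurable_funB.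
by rewrite /variance [RHS]/Rintegral (expectation_coord Pc i m2).
Qed.

End coordinate_moments.

Section uniform_are.
Context {R : realType} {d : nat}.
Variables (nu : probability 'rV[R]_d R) (J : 'rV[R]_d -> 'rV[R]_d) (h : 'rV[R]_d).
Hypotheses (h0 : h != 0) (uJ : uniform_scores nu J).
Let mu := (@lebesgue_measure R).

Lemma exists_coord_neq0 : exists i, h 0 i != 0.
Proof.
apply/not_existsP => H; move/eqP: h0; apply; apply/rowP => i; rewrite mxE.
by apply/eqP; have := H i; case: (h 0 i == 0).
Qed.

Lemma ARE_uniform P c (eta : 'rV[R]_d -> 'rV[R]_d) : product_law P c -> second_moments P ->
  score_property P c eta ->
  (forall i j, P.-integrable setT (fun x => (eta x 0 j * (x : 'rV[R]_d) 0 i)%:E)) ->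
  ARE nu J h P eta = ((\sum_i h 0 i ^+ 2 * ((\int[mu]_t (c i t ^+ 2)) ^+ 2 / 12^-1)) /
    (\sum_i h 0 i ^+ 2 / variance P i))%:E.
Proof.
move=> Pc P2 SP ieta; have [Jcov /(_ _ _ Pc P2)[mJ Jae]] := uJ.
rewrite (@ARE_product _ _ P nu c J h eta Pc P2 12^-1 (fun i => pcdf (c i)) (fun i => \int[mu]_t (c i t ^+ 2)))//.
- by congr (_%:E); congr (_ / _); apply: eq_bigr => i _; rewrite -mulrA.
- exact: score_measurable SP.
- by move=> i j; exact: score_cdf.
- by move=> i j; split; [exact: ieta|exact: score_id Pc SP _ _ (ieta i j)].
Qed.

Lemma regular_score_integrable (X : F_ind R d) : regular X -> second_moments (law X) ->
  forall i j, (law X).-integrable setT (fun x => (Defs.eta X x 0 j * (x : 'rV[R]_d) 0 i)%:E).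
Proof.
move=> rX P2 i j; apply: integrable_mul_sq; last exact: P2.
- exact: (score_measurable (regular_score_property rX)).
- exact: measurable_coord.
- apply/integrableP; split.
    apply/measurable_EFinP; apply: measurable_funX.
    exact: (score_measurable (regular_score_property rX)).
  under eq_integral do rewrite /= ger0_norm ?sqr_ge0//.
  exact: score_component_square.
Qed.

(** With an infinite variance the efficiency is +oo and both claims are immediate. Equality is
    exploited at one coordinate with h_i != 0, which is enough: a single Epanechnikov component
    already contradicts regularity. *)
Lemma AREX_uniform_regular (X : F_ind R d) : regular X ->
  ((108 / 125)%:E <= AREX nu J h X)%E /\
  (AREX nu J h X = (108 / 125)%:E -> exists i, epanechnikov_component X i).
Proof.
move=> rX; have Pc := product_law_F_ind X; have SP := regular_score_property rX.
rewrite /AREX; have [fP|nfP] := pselect (finite_variances (law X)); last first.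
  by rewrite /ARE; case: asboolP => // _; split => //; exact: leey.
have P2 := finite_variances_second_moments fP.
rewrite (ARE_uniform Pc P2 SP (regular_score_integrable rX P2)).
have v0 i := variance_gt0 Pc i P2.
have c2 i := pdf_sq_integrable Pc SP i.
have ge i : 108 / 125 <= variance (law X) i * ((\int[mu]_t (component_density X i t ^+ 2)) ^+ 2 / 12^-1).
  exact: (square_integral_ge (proj1 Pc i) (c2 i) (v0 i) (variance_integrable Pc P2 i) (varianceE Pc i)).
split; first by rewrite lee_fin; exact: ratio_ge v0 ge exists_coord_neq0.
move=> -[] /(ratio_eq v0 ge exists_coord_neq0) H; have [i hi] := exists_coord_neq0.
exists i; exists (\int[law X]_x x 0 i), (Num.sqrt (variance (law X) i)).
split; first by rewrite sqrtr_gt0.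
exact: (square_integral_eq (proj1 Pc i) (c2 i) (v0 i) (variance_integrable Pc P2 i) (varianceE Pc i) (H i hi)).
Qed.

Lemma regular_not_epanechnikov (X : F_ind R d) i : regular X -> ~ epanechnikov_component X i.
Proof.
move=> rX [m [s [s0 cE]]].
have Pc := product_law_F_ind X; have SP := regular_score_property rX.
apply: (epanechnikov_irregular Pc SP s0 _ cE).
apply/integrableP; split.
  by apply/measurable_EFinP; apply: measurable_funX; exact: (score_measurable SP).
under eq_integral do rewrite /= ger0_norm ?sqr_ge0//.
exact: score_component_square.
Qed.

End uniform_are.

Lemma measurable_inv (R : realType) : measurable_fun setT (@GRing.inv R).
Proof.
rewrite -(setUv [set (0 : R)]); apply/measurable_funU => //.
  exact: measurableC.
split; first exact: measurable_fun_set1.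
apply: open_continuous_measurable_fun.
  by apply: closed_openC; exact: closed_eq.
by move=> x; rewrite inE => /eqP x0; exact: inv_continuous.
Qed.

Lemma integrable_continuous_ind {R : realType} (p : R -> R) (a b : R) : continuous p ->
  (@lebesgue_measure R).-integrable setT (fun t => (p t * \1_(`[a, b]%classic) t)%:E).
Proof.
move=> cp; have E t : (p t * \1_(`[a, b]%classic) t)%:E = ((EFin \o p) \_ `[a, b]) t.
  by rewrite patchE indicE; case: (t \in _); rewrite ?mulr1 ?mulr0.
under eq_fun do rewrite E.
apply/integrable_restrict => //; rewrite setTI.
apply: continuous_compact_integrable; first exact: segment_compact.
exact: continuous_subspaceT.
Qed.

(** * Attainment of 108/125 *)

Section epanechnikov_score.
Context {R : realType}.
Let mu := (@lebesgue_measure R).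
Variables (c : R -> R) (m s : R).
Hypotheses (s0 : 0 < s) (mc : measurable_fun setT c).
Hypothesis cE : {ae mu, forall t, c t = epanechnikov m s t}.
Let q : R := Num.sqrt 5.
Let q0 : 0 < q. Proof. by rewrite sqrtr_gt0. Qed.
Let q2 : q ^+ 2 = 5. Proof. by rewrite sqr_sqrtr. Qed.
Let r := q * s.
Let r0 : 0 < r. Proof. exact: mulr_gt0. Qed.
Let K := 3 / (20 * q * s ^+ 3).
Local Notation e := (epanechnikov m s).
Let r2 : 5 * s ^+ 2 = r ^+ 2. Proof. by rewrite exprMn q2. Qed.
Let D := `[m - r, m + r]%classic : set R.

(** Minus the logarithmic derivative of the density in the interior of its support. At the two end
    points the denominator is 0, and beyond them the density vanishes. *)
Definition epanechnikov_score (t : R) : R := 2 * (t - m) / (5 * s ^+ 2 - (t - m) ^+ 2).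
Local Notation psi := epanechnikov_score.

Lemma measurable_epanechnikov_score : measurable_fun setT psi.
Proof.
apply: measurable_funM; first by apply: measurable_funM => //; exact: measurable_funB.
apply: (measurableT_comp (@measurable_inv R)).
by apply: measurable_funB => //; apply: measurable_funX; exact: measurable_funB.
Qed.

Let absE t : (`|t - m| <= r) = (t \in `[m - r, m + r]).
Proof. by rewrite in_itv/= ler_norml; apply/idP/idP => /andP[? ?]; apply/andP; split; lra. Qed.

Lemma epanechnikovE t : e t = K * (r ^+ 2 - (t - m) ^+ 2) * \1_D t.
Proof. by rewrite /epanechnikov -/q -/K -/r r2 absE indicE mem_setE. Qed.

Let quad t : r ^+ 2 - (t - m) ^+ 2 = (m + r - t) * (t - (m - r)). Proof. ring. Qed.

(** The kinks of e sit at the ends of the support, where e = 0; positivity places t in the open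
    interval. *)
Lemma epanechnikov_derive t : 0 < e t -> is_derive t (1 : R) e (- (psi t * e t)).
Proof.
move=> et; have := et; rewrite [X in 0 < X -> _]epanechnikovE indicE mem_setE in_itv/=; case tD : (m - r <= t <= m + r); last by rewrite mulr0 ltxx.
rewrite mulr1 quad => e0.
have qn0 : (m + r - t) * (t - (m - r)) != 0.
  by apply/eqP => E; move: e0; rewrite E mulr0 ltxx.
have [n1 n2] : m + r - t != 0 /\ t - (m - r) != 0 by move: qn0; rewrite mulf_eq0 negb_or => /andP.
have /andP[t1 t2] : m - r < t < m + r.
  apply/andP; have /andP[h1 h2] := tD; split; rewrite lt_neqAle ?h1 ?h2 andbT; apply/eqP => E.
    by move: n2; rewrite E subrr eqxx.
  by move: n1; rewrite -E subrr eqxx.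
have -> : psi t * e t = 2 * K * (t - m).
  rewrite /psi epanechnikovE indicE mem_setE in_itv/= tD mulr1 r2 quad; field.
  by rewrite n1 n2.
apply: (@near_eq_is_derive _ _ _ (fun t => K * (r ^+ 2 - (t - m) ^+ 2))).
  have : \forall u \near t, u \in `]m - r, m + r[ by apply: near_in_itvoo; rewrite in_itv/= t1.
  by apply: filterS => u; rewrite in_itv/= => /andP[u1 u2]; rewrite epanechnikovE indicE mem_setE in_itv/= !ltW// mulr1.
by apply: is_derive_eq; rewrite /GRing.scale/=; ring.
Qed.

Let psi_e t : t != m - r -> t != m + r -> psi t * e t = 2 * K * (t - m) * \1_D t.
Proof.
move=> n1 n2; rewrite epanechnikovE mulrA; congr (_ * _).
by rewrite /psi r2 quad; field; rewrite !subr_eq0 n1 eq_sym n2.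
Qed.

Let ae_point (a : R) : {ae mu, forall t, t != a}.
Proof.
exists [set a]; split => //; first exact: lebesgue_measure_set1.
by move=> t /= /negP/negPn/eqP.
Qed.

Let psi_c : {ae mu, forall t, psi t * c t = 2 * K * (t - m) * \1_D t}.
Proof.
have h1 := ae_point (m - r); have h2 := ae_point (m + r); have h3 := cE.
apply: filterS3 h1 h2 h3; first exact: (ae_filter_ringOfSetsType mu).
by move=> t t1 t2 ->; exact: psi_e.
Qed.

Let mpsi := measurable_epanechnikov_score.

Let lin_cont : continuous (fun t : R => 2 * K * (t - m)).
Proof.
move=> t; apply: (@continuousM _ R (fun=> 2 * K) (fun t => t - m)); first exact: cst_continuous.
by apply: (@continuousB _ R^o) => //; exact: cst_continuous.
Qed.

(** psi is unbounded near the end points, but psi c is almost everywhere the linear function 2 K (t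
    - m) on the support, so only the second moment of psi diverges. *)
Lemma epanechnikov_score_integrable (u : R -> R) : continuous u ->
  mu.-integrable setT (fun t => (psi t * u t * c t)%:E).
Proof.
move=> cu; have mU : measurable_fun setT u by exact: continuous_measurable_fun.
apply: (@ae_eq_integrable _ _ _ mu setT measurableT (fun t => (2 * K * (t - m) * u t) * \1_D t)).
- by apply: measurable_funM => //; apply: measurable_funM => //; exact: mpsi.
- have := psi_c; apply: filterS; first exact: (ae_filter_ringOfSetsType mu).
  by move=> t E _; rewrite [RHS]mulrAC E mulrAC.
- apply: integrable_continuous_ind => t.
  by apply: (@continuousM _ R (fun t => 2 * K * (t - m)) u); [exact: lin_cont|exact: cu].
Qed.

Let hf (t : R) : is_derive t (1 : R) (fun t => - K * (r ^+ 2 - (t - m) ^+ 2)) (2 * K * (t - m)).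
Proof. by apply: is_derive_eq; rewrite /GRing.scale/=; ring. Qed.

Let int_lin (a b : R) : a <= b -> (\int[mu]_(t in `[a, b]) (2 * K * (t - m))%:E =
  (K * ((a - m) ^+ 2 - (b - m) ^+ 2) * - 1)%:E)%E.
Proof.
rewrite le_eqVlt => /predU1P[->|ab].
  by rewrite subrr mulr0 mul0r set_itv1 integral_set1.
by rewrite (FTC2_everywhere lin_cont hf ab); congr EFin; ring.
Qed.

Lemma epanechnikov_score_tail (a : R) : \int[mu]_t (psi t * (a < t)%R%:R * c t) = e a.
Proof.
have mI : measurable_fun setT (fun t : R => (a < t)%R%:R : R) by exact: measurable_ltR.
have : \int[mu]_t (psi t * (a < t)%R%:R * c t) =
    \int[mu]_(t in `]a, +oo[ `&` `[m - r, m + r]) (2 * K * (t - m)).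
  rewrite /Rintegral [in RHS]integral_mkcond/=.
  have E t : ((fun t => (2 * K * (t - m))%:E) \_ (`]a, +oo[ `&` `[m - r, m + r])) t =
     (2 * K * (t - m) * \1_D t * (a < t)%R%:R)%:E.
    rewrite patchE in_setI !mem_setE !in_itv/= andbT indicE mem_setE in_itv/=.
    by case: (a < t); case: (_ <= t <= _); rewrite ?mulr1 ?mulr0.
  under [in RHS]eq_integral do rewrite E.
  congr fine; apply: ae_eq_integral => //.
  - apply/measurable_EFinP; apply: measurable_funM; last exact: mc.
    by apply: measurable_funM; [exact: mpsi|exact: mI].
  - apply/measurable_EFinP; apply: measurable_funM; last exact: mI.
    by apply: measurable_funM; [exact: continuous_measurable_fun lin_cont|rewrite /D; exact: measurable_indic].
  - have := psi_c; apply: filterS; first exact: (ae_filter_ringOfSetsType mu).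
    by move=> t E' _; rewrite -E' [in RHS]mulrAC.
move=> ->; rewrite /Rintegral.
have [ar|ra] := leP (m + r) a.
  have -> : `]a, +oo[ `&` `[m - r, m + r] = set0 :> set R.
    by apply/seteqP; split => // t /=; rewrite !in_itv/= andbT => -[h1 /andP[_ h2]]; lra.
  rewrite integral_set0/= epanechnikovE indicE mem_setE in_itv/=.
  have [E|nE] := eqVneq a (m + r); first by rewrite quad E; ring.
  have -> : (a <= m + r) = false by apply/negbTE; rewrite -ltNge lt_neqAle eq_sym nE.
  by rewrite andbF mulr0.
have [al|la] := ltP a (m - r).
  have -> : `]a, +oo[ `&` `[m - r, m + r] = `[m - r, m + r]%classic :> set R.
    apply/seteqP; split => t /=; rewrite !in_itv/= andbT; first by case.
    by move=> tD; split => //; have /andP[? _] := tD; lra.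
  rewrite int_lin; last by have := r0; lra.
  rewrite epanechnikovE indicE mem_setE in_itv/= [m - r <= a]leNgt al/= mulr0.
  by ring.
have -> : `]a, +oo[ `&` `[m - r, m + r] = `]a, m + r]%classic :> set R.
  apply/seteqP; split => t /=; rewrite !in_itv/= ?andbT; first by move=> [-> /andP[_ ->]].
  by move=> /andP[at_ ->]; split => //; rewrite andbT ltW// (le_lt_trans la).
rewrite integral_itv_obnd_cbnd; last first.
  by apply/measurable_EFinP/measurable_funTS; exact: continuous_measurable_fun lin_cont.
rewrite int_lin ?ltW// epanechnikovE indicE mem_setE in_itv/= la (ltW ra)/=.
by ring.
Qed.

Lemma epanechnikov_score_mean : \int[mu]_t (psi t * c t) = 0.
Proof.
have <- : e (m - r - 1) = 0.
  rewrite epanechnikovE indicE mem_setE in_itv/= [_ <= _ - 1]leNgt gtrBl ltr01/=.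
  by rewrite mulr0.
rewrite -epanechnikov_score_tail; apply: ae_eq_Rintegral => //.
- by apply: measurable_funM => //; exact: mpsi.
- apply: measurable_funM; last exact: mc.
  by apply: measurable_funM; [exact: mpsi|exact: measurable_ltR].
- have := psi_c; apply: filterS; first exact: (ae_filter_ringOfSetsType mu).
  move=> t E _; rewrite [RHS]mulrAC E indicE mem_setE in_itv/=.
  case: ltP => h; first by rewrite mulr1.
  have -> : (m - r <= t) = false by apply/negbTE; rewrite -ltNge; lra.
  by rewrite !mulr0.
Qed.

End epanechnikov_score.

Section epanechnikov_are.
Context {R : realType} {d : nat}.
Variables (nu : probability 'rV[R]_d R) (J : 'rV[R]_d -> 'rV[R]_d) (h : 'rV[R]_d).
Hypotheses (h0 : h != 0) (uJ : uniform_scores nu J).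
Let mu := (@lebesgue_measure R).
Variable X : F_ind R d.
Local Notation c := (component_density X).
Hypotheses (sX : has_score X) (eX : forall i, epanechnikov_component X i).

Let Pc := product_law_F_ind X.
Let mc i : measurable_fun setT (c i). Proof. by case: (proj1 Pc i). Qed.

Let m i : R := projT1 (cid (eX i)).
Let s i : R := projT1 (cid (projT2 (cid (eX i)))).
Let s0 i : 0 < s i. Proof. exact: (proj1 (projT2 (cid (projT2 (cid (eX i)))))). Qed.
Let cE i : {ae mu, forall t, c i t = epanechnikov (m i) (s i) t}.
Proof. exact: (proj2 (projT2 (cid (projT2 (cid (eX i)))))). Qed.

Let psi i := epanechnikov_score (m i) (s i).

Let etaE i : {ae law X, forall x, Defs.eta X x 0 i = psi i (x 0 i)}.
Proof.
apply: (classical_score (cE i) sX).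
apply: filterS2 (coord_ae Pc i (cE i)) (coord_pdf_gt0_ae Pc i) => x cx.
by rewrite cx; exact: epanechnikov_derive.
Qed.

Let meta i : measurable_fun setT (fun x => Defs.eta X x 0 i).
Proof. exact: (measurableT_comp (measurable_coord i) (proj1 sX)). Qed.

Let mpsi i : measurable_fun setT (psi i).
Proof. exact: measurable_epanechnikov_score. Qed.

Let ipsi i : mu.-integrable setT (fun t => (psi i t * c i t)%:E).
Proof.
have := epanechnikov_score_integrable (mc i) (cE i) (u := fun=> 1) (fun t => @cst_continuous R R 1 t).
by under eq_fun do rewrite mulr1.
Qed.

Let psi0 i : \int[mu]_t (psi i t * c i t) = 0.
Proof. exact: epanechnikov_score_mean (s0 i) (mc i) (cE i). Qed.

Let psi_tail i : {ae mu, forall a, \int[mu]_t (psi i t * (a < t)%R%:R * c i t) = c i a}.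
Proof.
have := cE i; apply: filterS; first exact: (ae_filter_ringOfSetsType mu).
by move=> a ->; exact: epanechnikov_score_tail (s0 i) (mc i) (cE i) a.
Qed.

Let SP := separable_score_property Pc meta mpsi etaE ipsi psi0 psi_tail.

Let ae_c (u : R -> R) i : measurable_fun setT u ->
  mu.-integrable setT (fun t => (u t * epanechnikov (m i) (s i) t)%:E) ->
  mu.-integrable setT (fun t => (u t * c i t)%:E) /\
  \int[mu]_t (u t * c i t) = \int[mu]_t (u t * epanechnikov (m i) (s i) t).
Proof.
move=> mU iu.
have E : ae_eq mu setT (fun t => u t * epanechnikov (m i) (s i) t) (fun t => u t * c i t).
  have := cE i; apply: filterS; first exact: (ae_filter_ringOfSetsType mu).
  by move=> t -> _.
split; first by apply: (@ae_eq_integrable _ _ _ mu setT measurableT _ _ _ E iu); apply: measurable_funM; [exact: mU|exact: mc].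
apply/esym; apply: (@ae_eq_Rintegral _ _ _ mu setT measurableT _ _ _ _ E).
- exact: (measurable_integrable iu).
- by apply: measurable_funM; [exact: mU|exact: mc].
Qed.

Let P2 : second_moments (law X).
Proof.
move=> i; apply/(integrable_coord Pc i (u := fun t => t ^+ 2)); first exact: exprn_measurable.
apply: (ae_c _ _).1; first exact: exprn_measurable.
have [i1 _] := epanechnikov_mean (m i) (s0 i); have [i2 _] := epanechnikov_variance (m i) (s0 i).
have i0 : mu.-integrable setT (fun t => (epanechnikov (m i) (s i) t)%:E).
  apply: (@ae_eq_integrable _ _ _ mu setT measurableT (c i)).
  - exact: measurable_epanechnikov.
  - by have := cE i; apply: filterS; [exact: (ae_filter_ringOfSetsType mu)|move=> t ->].
  - exact: (integrable_pdf (proj1 Pc i) measurableT).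
apply: (@eq_integrable _ _ _ mu setT measurableT (fun t => ((t - m i) ^+ 2 * epanechnikov (m i) (s i) t +
  (2 * m i * ((t - m i) * epanechnikov (m i) (s i) t) + m i ^+ 2 * epanechnikov (m i) (s i) t))%:E)).
  by move=> t _; congr EFin; ring.
apply: integrable_realD => //; apply: integrable_realD => //; exact: integrable_realMl.
Qed.

Let mean i : \int[law X]_x x 0 i = m i.
Proof.
have ic := mean_integrable P2 i.
have : \int[law X]_x (x 0 i - m i) = 0.
  have mB : measurable_fun setT (fun t : R => t - m i) by exact: measurable_funB.
  rewrite /Rintegral (expectation_coord Pc i mB).
  have [i1 E1] := epanechnikov_mean (m i) (s0 i).
  by have [_ E2] := ae_c mB i1; rewrite -[LHS]/(\int[mu]_t ((t - m i) * c i t)) E2.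
rewrite RintegralB//; last exact: finite_measure_integrable_cst.
by rewrite expectation_const => /eqP; rewrite subr_eq0 => /eqP.
Qed.

Let var i : variance (law X) i = s i ^+ 2.
Proof.
rewrite -(varianceE Pc i) mean.
have [i1 E1] := epanechnikov_variance (m i) (s0 i).
have mB : measurable_fun setT (fun t : R => (t - m i) ^+ 2).
  by apply: measurable_funX; exact: measurable_funB.
by rewrite (ae_c mB i1).2.
Qed.

Let c2 i : \int[mu]_t (c i t ^+ 2) = 3 / (5 * (Num.sqrt 5 * s i)).
Proof.
rewrite -(epanechnikov_sq (m i) (s0 i)).2.
apply: (@ae_eq_Rintegral _ _ _ mu setT measurableT).
- by apply: measurable_funX; exact: mc.
- by apply: measurable_funX; exact: measurable_epanechnikov.
- by have := cE i; apply: filterS; [exact: (ae_filter_ringOfSetsType mu)|move=> t -> _].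
Qed.

Lemma AREX_epanechnikov : AREX nu J h X = (108 / 125)%:E.
Proof.
rewrite /AREX (ARE_uniform h uJ Pc P2 SP); last first.
  move=> i j; apply: (separable_integrable Pc meta mpsi etaE ipsi (u := fun t => t)) => //.
    exact: mean_integrable.
  by apply: (epanechnikov_score_integrable (mc j) (cE j) (u := fun t => t)) => t; exact: cvg_id.
congr EFin; apply: ratio_const.
- by move=> i; exact: (variance_gt0 Pc).
- move=> i; rewrite var c2 exprMn exprVn.
  have -> : (5 * (Num.sqrt 5 * s i)) ^+ 2 = 125 * s i ^+ 2.
    by rewrite !exprMn sqr_sqrtr//; ring.
  by field; rewrite gt_eqF.
- exact: exists_coord_neq0.
Qed.

End epanechnikov_are.

(** * The bound 1 *)

Section normal_scores.
Context {R : realType} {d : nat}.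
Variables (P nu : probability 'rV[R]_d R) (c : 'I_d -> R -> R).
Hypotheses (Pc : product_law P c) (P2 : second_moments P) (nuN : std_normal_law nu).
Let mu := (@lebesgue_measure R).
Local Notation phi := (@normal_pdf R 0 1).
Local Notation F i := (pcdf (c i)).
Local Notation S i := (monotone_transport (c i) normal_quantile).

Let pc i : is_pdf (c i). Proof. by case: Pc. Qed.
Let nuP := std_normal_product_law nuN.
Let T := coordinate_transport c normal_quantile.
Let mT : measurable_fun setT T. Proof. exact: (measurable_coordinate_transport Pc normal_quantileP). Qed.
Let TP B : measurable B -> pushforward P T B = nu B.
Proof. exact: (coordinate_transport_push Pc nuP normal_quantileP). Qed.
Let mS i : measurable_fun setT (S i).
Proof. exact: (measurable_monotone_transport (pc i) normal_quantileP). Qed.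
Let mSx i : measurable_fun setT (fun x : 'rV[R]_d => S i (x 0 i)).
Proof. by apply: measurableT_comp => //; exact: measurable_coord. Qed.
Let TE x i : T x 0 i = S i (x 0 i). Proof. by rewrite mxE. Qed.

(** The second event is contained in the first and both have probability 1 - F_i(s); they differ by
    the set where x_i >= s and F_i(x_i) = F_i(s). *)
Lemma le_pcdf_ae i s : {ae P, forall x : 'rV[R]_d, (s <= x 0 i) = (F i s < F i (x 0 i))}.
Proof.
have mA : measurable [set x : 'rV[R]_d | s <= x 0 i].
  apply: (measurable_coord_preimage i (A := [set t | s <= t])).
  rewrite (_ : [set t | _] = `[s, +oo[%classic)//.
  by apply/seteqP; split => t /=; rewrite in_itv/= andbT.
have mB : measurable [set x : 'rV[R]_d | F i s < F i (x 0 i)].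
  exact: (measurable_coord_preimage i (measurable_pcdf_gt (pc i) _)).
have BA : [set x : 'rV[R]_d | F i s < F i (x 0 i)] `<=` [set x | s <= x 0 i].
  by move=> x /=; apply: contraTT; rewrite -!ltNge => /ltW/(pcdf_nondecreasing (pc i)); rewrite leNgt.
exists ([set x : 'rV[R]_d | s <= x 0 i] `\` [set x | F i s < F i (x 0 i)]); split.
- exact: measurableD.
- have PB : P [set x : 'rV[R]_d | F i s < F i (x 0 i)] = (1 - F i s)%:E.
    by apply: (product_law_pcdf_gt Pc); rewrite pcdf_ge0// pcdf_le1.
  have PA : P [set x : 'rV[R]_d | s <= x 0 i] = (1 - F i s)%:E.
    rewrite -(ccdf_pdf (pc i)).
    have AE : [set t | s <= t] = `[s, +oo[%classic :> set R.
      by apply/seteqP; split => t /=; rewrite in_itv/= andbT.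
    apply: etrans; first apply: (product_law_coord Pc i (A := [set t | s <= t])).
      by rewrite AE.
    rewrite AE.
    rewrite -integral_itv_obnd_cbnd; last first.
      by apply/measurable_EFinP/measurable_funTS; case: (pc i).
    by rewrite /Rintegral fineK//; exact: (pdf_integral_fin_num Pc).
  have fA : (P [set x : 'rV[R]_d | (s <= x 0 i)%R] < +oo)%E.
    by apply: (@le_lt_trans _ _ 1%E); [exact: probability_le1|exact: ltry].
  apply: (etrans (measureD mA mB fA)); rewrite (setIidr BA).
  by apply: (etrans (congr2 (fun a b => a - b)%E PA PB)); rewrite subee.
- move=> x /= H; split.
    by apply: contrapT => /negP h; apply: H; rewrite (negbTE h); apply/esym/negbTE; apply: contra h => /BA.
  by move=> h; apply: H; rewrite h (BA _ h).
Qed.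

Let S_le i s t : 0 < F i s < 1 -> 0 < F i t < 1 -> (S i s <= S i t) = (F i s <= F i t).
Proof.
move=> s01 t01; rewrite (monotone_transport_le normal_quantileP _ s01).
by rewrite {1}/monotone_transport t01 normal_quantileK.
Qed.

Let S_lt i s t : 0 < F i s < 1 -> 0 < F i t < 1 -> (S i s < S i t) = (F i s < F i t).
Proof. by move=> s01 t01; rewrite !ltNge S_le. Qed.

Let nu2 := std_normal_second_moments nuN.

Let phi_neq0 t : phi t != 0. Proof. by rewrite gt_eqF// std_normal_pdf_gt0. Qed.

Lemma transport_sq_integrable i : P.-integrable setT (fun x : 'rV[R]_d => (S i (x 0 i) ^+ 2)%:E).
Proof.
have := (coord_sq_push nu2 mT TP).2 i.
by apply: eq_integrable => // x _; rewrite TE.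
Qed.

Lemma transport_integrable i : P.-integrable setT (fun x : 'rV[R]_d => (S i (x 0 i))%:E).
Proof. exact: (integrable_of_sq (b := fun i => S i) mS transport_sq_integrable i). Qed.

Lemma transport_mean i : \int[P]_x S i (x 0 i) = 0.
Proof.
transitivity (\int[P]_x T x 0 i); first by apply: eq_Rintegral => x _; rewrite TE.
rewrite -(Rintegral_push mT TP (measurable_coord i) (mean_integrable nu2 i)).
rewrite /Rintegral (expectation_coord nuP i (u := fun t => t))//.
exact: std_normal_mean.
Qed.

Lemma transport_second_moment i : \int[P]_x (S i (x 0 i) ^+ 2) = 1.
Proof.
transitivity (\int[P]_x (T x 0 i ^+ 2)); first by apply: eq_Rintegral => x _; rewrite TE.
have m2 : measurable_fun setT (fun y : 'rV[R]_d => y 0 i ^+ 2).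
  by apply: measurable_funX; exact: measurable_coord.
rewrite -(Rintegral_push mT TP m2 (nu2 i)).
rewrite /Rintegral (expectation_coord nuP i (u := fun t => t ^+ 2)); last exact: exprn_measurable.
exact: std_normal_variance.
Qed.

(** The change of variables r = S_i s without a derivative of S_i. The integral is an expectation of
    1 / phi(S_i(x_i)) over {s <= x_i < t}; pushed forward to nu, its density phi cancels and leaves
    the length of ]S_i s, S_i t]. *)
Lemma transport_increment i s t : 0 < F i s < 1 -> 0 < F i t < 1 -> s <= t ->
  (\int[mu]_(r in `[s, t[) (c i r / phi (S i r))%:E = (S i t - S i s)%:E)%E.
Proof.
move=> s01 t01 st; have Sst : S i s <= S i t by rewrite S_le// (pcdf_nondecreasing (pc i)).
have miphi : measurable_fun setT (fun r : R => (phi r)^-1).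
  by apply: (measurableT_comp (@measurable_inv R)); exact: measurable_normal_pdf.
pose K (r : R) : R := \1_(`]S i s, S i t]%classic) r / phi r.
have mK : measurable_fun setT K by apply: measurable_funM => //; exact: measurable_indic.
have K0 r : 0 <= K r by rewrite mulr_ge0 ?invr_ge0 ?normal_pdf_ge0.
pose k (r : R) : R := \1_(`[s, t[%classic) r / phi (S i r).
have mk : measurable_fun setT k.
  by apply: measurable_funM; [exact: measurable_indic|exact: (measurableT_comp miphi (mS i))].
have k0 r : 0 <= k r by rewrite mulr_ge0 ?invr_ge0 ?normal_pdf_ge0.
transitivity (\int[P]_x (k (x 0%R i))%:E)%E.
  rewrite (ge0_expectation_coord Pc i (u := fun r => (k r)%:E)); last 2 first.
  - exact/measurable_EFinP.
  - by move=> r; rewrite lee_fin.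
  rewrite [LHS]integral_mkcond; apply: eq_integral => r _; rewrite patchE /k indicE.
  by case: (r \in _); rewrite -EFinM ?mul1r ?mul0r// mulrC.
transitivity (\int[P]_x (K (T x 0%R i))%:E)%E.
  apply: ae_eq_integral => //.
  - by apply/measurable_EFinP; apply: measurableT_comp => //; exact: measurable_coord.
  - apply/measurable_EFinP; apply: (measurableT_comp mK).
    exact: (measurableT_comp (measurable_coord i) mT).
  (* The closed and open ends change sides: almost surely s <= x_i means S_i s < S_i(x_i), and x_i <
     t means S_i(x_i) <= S_i t. *)
  - have h1 := le_pcdf_ae i s; have h2 := le_pcdf_ae i t; have h3 := interior_ae Pc.
    apply: filterS3 h1 h2 h3 => x h1 h2 /(_ i) x01 _.
    rewrite /K /k TE; congr (_ / _)%:E.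
    rewrite !indicE !mem_setE !in_itv/= h1 S_lt// S_le//.
    by rewrite [x 0 i < t]ltNge h2 -leNgt.
rewrite -(ge0_integral_push mT TP (f := fun y => (K (y 0%R i))%:E)); last 2 first.
- by apply/measurable_EFinP; apply: measurableT_comp => //; exact: measurable_coord.
- by move=> y; rewrite lee_fin.
rewrite (ge0_expectation_coord nuP i (u := fun r => (K r)%:E)); last 2 first.
- exact/measurable_EFinP.
- by move=> r; rewrite lee_fin.
transitivity (\int[mu]_r (\1_(`]S i s, S i t]%classic) r)%:E)%E.
  by apply: eq_integral => r _; rewrite /K -EFinM divfK.
rewrite integral_indic// setIT.
apply: (etrans (@lebesgue_measure_itv R `]S i s, S i t])); rewrite /= lte_fin.
by case: ltP => // h; have /eqP -> : S i s == S i t; rewrite ?eq_le ?Sst// subrr.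
Qed.

(* The derivative of S i, by the change of variables r = S i s. *)
Definition transport_density i (r : R) : R := c i r / phi (S i r).

Local Notation w i := (transport_density i).

Lemma measurable_transport_density i : measurable_fun setT (w i).
Proof.
apply: measurable_funM; first by case: (pc i).
apply: (measurableT_comp (@measurable_inv R)).
by apply: (measurableT_comp (measurable_normal_pdf 0 (1 : R))).
Qed.

Lemma transport_density_ge0 i r : 0 <= w i r.
Proof. by rewrite mulr_ge0 ?invr_ge0 ?normal_pdf_ge0//; case: (pc i). Qed.

Section transport_score.
Variable eta : 'rV[R]_d -> 'rV[R]_d.
Hypothesis SP : score_property P c eta.

Lemma transport_score i j : P.-integrable setT (fun x => (eta x 0 j * S i (x 0 i))%:E) ->
  (i = j -> mu.-integrable setT (fun s => (w i s * c i s)%:E)) /\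
  \int[P]_x (eta x 0 j * S i (x 0 i)) = (i == j)%:R * \int[mu]_s (w i s * c i s).
Proof.
(* A median is taken as base point, because the increments of S_i are known only between points
   where 0 < F_i < 1. *)
move=> iH; have [|t0 Ft0] := pcdf_surj (pc i) (u := 2^-1); first by apply/andP; split; lra.
have t01 : 0 < F i t0 < 1 by rewrite Ft0; apply/andP; split; lra.
pose W t := S i t - S i t0.
have ieta := score_integrable SP j.
have iW : P.-integrable setT (fun x => (W ((x : 'rV[R]_d) 0 i) * eta x 0 j)%:E).
  apply: (@eq_integrable _ _ _ P setT measurableT (fun x => (eta x 0 j * S i (x 0 i) - S i t0 * eta x 0 j)%:E)).
    by move=> x _; congr EFin; rewrite /W; ring.
  by apply: integrable_realB => //; exact: integrable_realMl.
have [|iw E] := @score_primitive _ _ _ _ _ Pc SP i j (w i) W t0 (measurable_transport_density i) (transport_density_ge0 i) _ iW.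
  apply: filterS (interior_ae Pc) => x /(_ i) x01; split => hx.
    exact: transport_increment.
  by rewrite /W opprB; apply: transport_increment => //; exact: ltW.
split => //; rewrite -E.
transitivity (\int[P]_x (eta x 0 j * S i (x 0 i) - S i t0 * eta x 0 j)); last first.
  by apply: eq_Rintegral => x _; rewrite /W; ring.
rewrite RintegralB//; last exact: integrable_realMl.
by rewrite RintegralZl//; have [_ -> _] := SP j; rewrite mulr0 subr0.
Qed.

End transport_score.

(** Off the interior the event s < x_i has probability 0 or 1, and the centred S_i(x_i) has tail
    expectation 0. *)
Definition transport_tail i (s : R) : R :=
  if 0 < F i s < 1 then phi (S i s) else 0.

Lemma transport_tailE i s :
  \int[P]_x (S i ((x : 'rV[R]_d) 0 i) * (s < x 0 i)%R%:R) = transport_tail i s.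
Proof.
have lt_ae : {ae P, forall x : 'rV[R]_d, (s < x 0 i) = (F i s < F i (x 0 i))}.
  apply: filterS2 (le_pcdf_ae i s) (coord_neq_ae Pc i s) => x <- xs.
  by rewrite lt_neqAle eq_sym xs.
have mI (a : R) : measurable_fun setT (fun x : 'rV[R]_d => (a < x 0 i)%R%:R : R).
  by apply: measurable_ltR => //; exact: measurable_coord.
have mL : measurable_fun setT (fun x : 'rV[R]_d => S i (x 0 i) * (s < x 0 i)%R%:R).
  by apply: measurable_funM; [exact: mSx|exact: mI].
rewrite /transport_tail; case: ifPn => s01.
  have mu1 : measurable_fun setT (fun y : 'rV[R]_d => y 0 i * (S i s < y 0 i)%R%:R).
    by apply: measurable_funM; [exact: measurable_coord|exact: mI].
  have iu : nu.-integrable setT (fun y : 'rV[R]_d => (y 0 i * (S i s < y 0 i)%R%:R)%:E).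
    apply: (@integrable_mul_ind _ _ _ nu (fun y : 'rV[R]_d => y 0 i) (fun y : 'rV[R]_d => S i s < y 0 i)); first exact: mI.
    exact: mean_integrable.
  transitivity (\int[P]_x (T x 0 i * (S i s < T x 0 i)%R%:R)).
    apply: ae_eq_Rintegral => //.
      exact: (measurableT_comp mu1 mT).
    have h3 := interior_ae Pc; apply: filterS2 lt_ae h3 => x -> /(_ i) x01 _.
    by rewrite TE S_lt.
  rewrite -(Rintegral_push mT TP mu1 iu) /Rintegral.
  rewrite (expectation_coord nuP i (u := fun t => t * (S i s < t)%R%:R)); last first.
    by apply: measurable_funM => //; exact: measurable_ltR.
  rewrite -(std_normal_tail (S i s)); apply: eq_Rintegral => t _.
  by rewrite mulrAC.
have F0 := pcdf_ge0 (pc i) s; have F1 := pcdf_le1 (pc i) s.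
have [Fs|Fs] := eqVneq (F i s) 0.
  rewrite -(transport_mean i); apply: ae_eq_Rintegral => //.
  have h3 := interior_ae Pc; apply: filterS2 lt_ae h3 => x -> /(_ i) /andP[x0 _] _.
  by rewrite Fs x0 mulr1.
have {}Fs : F i s = 1.
  apply/eqP; rewrite eq_le F1 leNgt; apply: contra s01 => ->.
  by rewrite andbT lt_neqAle eq_sym Fs.
transitivity (\int[P]_x (0 : R)); last exact: expectation_const.
apply: ae_eq_Rintegral => //.
have h3 := interior_ae Pc; apply: filterS2 lt_ae h3 => x -> /(_ i) /andP[_ x1] _.
by rewrite Fs ltNge ltW// mulr0.
Qed.

(** [expectation_primitive] with the roles exchanged: W is the identity and the centred variable is
    S_i(x_i), whose tail expectation is phi(S_i s). *)
Lemma transport_covariance i : mu.-integrable setT (fun s => (transport_tail i s)%:E) /\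
  \int[P]_x (x 0 i * S i (x 0 i)) = \int[mu]_s transport_tail i s.
Proof.
have iWH : P.-integrable setT (fun x : 'rV[R]_d => (x 0 i * S i (x 0 i))%:E).
  by apply: integrable_mul_sq; [exact: measurable_coord|exact: mSx|exact: P2|exact: transport_sq_integrable].
have [|ig eg] := @expectation_primitive _ _ _ P (fun x : 'rV[R]_d => x 0 i) (fun x => S i (x 0 i))
  (fun=> 1) (fun t => t) 0 (measurable_coord i) (transport_integrable i) (transport_mean i)
  (measurable_cst _) (fun=> ler01) _ (measurable_integrable iWH) iWH.
  apply: aeW => x; split => hx.
    by rewrite integral_cst// mul1e [LHS](@lebesgue_measure_itv R `[0, x 0 i[)/= lte_fin; case: ltP => [_|h]; rewrite ?sube0//; congr EFin; lra.
  by rewrite integral_cst// mul1e [LHS](@lebesgue_measure_itv R `[x 0 i, 0[)/= lte_fin hx add0e.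
have E s : 1 * \int[P]_x (S i ((x : 'rV[R]_d) 0 i) * (s < x 0 i)%R%:R) = transport_tail i s.
  by rewrite mul1r transport_tailE.
split; first by move: ig; under eq_fun do rewrite E.
by rewrite eg; apply: eq_Rintegral => s _; exact: E.
Qed.

End normal_scores.

(** * Normal laws with arbitrary mean and variance *)

Section normal_scale.
Context {R : realType}.
Local Notation phi := (@normal_pdf R 0 1).
Local Notation Phi := (pcdf phi).

Lemma normal_pdf_scale (m s t : R) : 0 < s -> normal_pdf m s t = phi ((t - m) / s) / s.
Proof.
move=> s0; rewrite !normal_pdfE ?oner_neq0 ?gt_eqF// /normal_fun /normal_peak subr0 expr1n.
have -> : s ^+ 2 * pi *+ 2 = s ^+ 2 * (1 * pi *+ 2) by rewrite mul1r mulrnAr.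
rewrite sqrtrM ?sqr_ge0// sqrtr_sqr (gtr0_norm s0).
have -> : - (t - m) ^+ 2 / (s ^+ 2 *+ 2) = - ((t - m) / s) ^+ 2 / (1 *+ 2).
  by rewrite -(mulr_natr (s ^+ 2) 2); field; rewrite gt_eqF.
have : Num.sqrt (1 * pi *+ 2) != 0 :> R.
  by rewrite gt_eqF// sqrtr_gt0 mulrn_wgt0// mul1r pi_gt0.
by move=> q0; rewrite invfM [_^-1 * _^-1]mulrC mulrAC.
Qed.

Let scale_derive (m s t : R) : is_derive t (1 : R) (fun t => (t - m) / s) s^-1.
Proof.
have -> : (fun t : R => (t - m) / s) = (fun t => s^-1 * (t - m)) by apply/funext => u; rewrite mulrC.
by apply: is_derive_eq; rewrite /GRing.scale/=; ring.
Qed.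

Lemma normal_cdf_derive (m s t : R) : 0 < s ->
  is_derive t (1 : R) (fun t => Phi ((t - m) / s)) (normal_pdf m s t).
Proof.
move=> s0; rewrite normal_pdf_scale//.
exact: (@is_derive1_comp _ Phi (fun t => (t - m) / s) t _ _ (std_normal_cdf_derive _) (scale_derive m s t)).
Qed.

Lemma normal_pdf_derive (m s t : R) : 0 < s ->
  is_derive t (1 : R) (normal_pdf m s) (- ((t - m) / s ^+ 2 * normal_pdf m s t)).
Proof.
move=> s0; have -> : normal_pdf m s = (fun t => s^-1 * phi ((t - m) / s)).
  by apply/funext => u; rewrite normal_pdf_scale// mulrC.
have h := @is_derive1_comp _ phi (fun t => (t - m) / s) t _ _ (std_normal_pdf_derive _) (scale_derive m s t).
have -> : - ((t - m) / s ^+ 2 * (s^-1 * phi ((t - m) / s))) =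
    s^-1 * (- ((t - m) / s * phi ((t - m) / s)) * s^-1).
  by field; rewrite gt_eqF.
exact: (is_deriveZ s^-1 h).
Qed.

(** Both sides have the same derivative, so they differ by a constant, and both are arbitrarily
    small far to the left. *)
Lemma normal_cdfE (m s t : R) : 0 < s -> pcdf (normal_pdf m s) t = Phi ((t - m) / s).
Proof.
move=> s0; pose D t := pcdf (normal_pdf m s) t - Phi ((t - m) / s).
have D' (x : R) : is_derive x (1 : R) D 0.
  rewrite -(subrr (normal_pdf m s x)); apply: is_deriveB.
    apply: pcdf_derive; first exact: is_pdf_normal.
    by apply: continuous_normal_pdf; rewrite gt_eqF.
  exact: normal_cdf_derive.
apply/eqP; rewrite -subr_eq0 -normr_le0; apply/ler_addgt0Pr => e e0; rewrite add0r.
have [a ae] := pcdf_lt (is_pdf_normal m s) e0.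
have [b be] := pcdf_lt (is_pdf_normal (0 : R) 1) e0.
pose u := Num.min a (m + s * b).
have ua : u <= a by rewrite ge_min lexx.
have ub : (u - m) / s <= b.
  by rewrite ler_pdivrMr// lerBlDl mulrC ge_min lexx orbT.
have -> : pcdf (normal_pdf m s) t - Phi ((t - m) / s) = D u by exact: (is_derive_0_is_cst t u D').
have h1 := le_lt_trans (pcdf_nondecreasing (is_pdf_normal m s) ua) ae.
have h2 := le_lt_trans (pcdf_nondecreasing (is_pdf_normal 0 1) ub) be.
have h3 := pcdf_ge0 (is_pdf_normal m s) u; have h4 := pcdf_ge0 (is_pdf_normal 0 1) ((u - m) / s).
rewrite /D; move: (pcdf (normal_pdf m s) u) (Phi ((u - m) / s)) h1 h2 h3 h4 => x y h1 h2 h3 h4.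
by clear -h1 h2 h3 h4; rewrite ler_norml; apply/andP; split; lra.
Qed.

End normal_scale.

Section normal_bound.
Context {R : realType} {d : nat}.
Variables (P nu : probability 'rV[R]_d R) (c : 'I_d -> R -> R).
Hypotheses (Pc : product_law P c) (P2 : second_moments P) (nuN : std_normal_law nu).
Let mu := (@lebesgue_measure R).
Local Notation phi := (@normal_pdf R 0 1).
Local Notation F i := (pcdf (c i)).
Local Notation S i := (monotone_transport (c i) normal_quantile).
Local Notation w := (transport_density c).
Local Notation G := (transport_tail c).
Variable i : 'I_d.
Hypothesis iwc : mu.-integrable setT (fun t => (w i t * c i t)%:E).

Let pc : is_pdf (c i). Proof. by case: Pc. Qed.
Let v0 : 0 < variance P i. Proof. exact: (variance_gt0 Pc). Qed.
Let A := \int[mu]_t (w i t * c i t).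
Let B := \int[mu]_s G i s.
Let s := Num.sqrt (variance P i).
Let s0 : 0 < s. Proof. by rewrite sqrtr_gt0. Qed.
Let s2 : s ^+ 2 = variance P i. Proof. by rewrite sqr_sqrtr// ltW. Qed.
Let m := \int[P]_x x 0 i.
Let b t : R := (0 < F i t < 1)%R%:R.

(** c_i is carried by the set where 0 < F_i < 1. Its indicator b makes the inequality of [AB] hold
    at every point, also where [transport_tail] takes the value 0. *)
Let b_int : mu.-integrable setT (fun t => (b t * c i t)%:E) /\ \int[mu]_t (b t * c i t) = 1.
Proof.
have mb : measurable_fun setT b.
  rewrite (_ : b = \1_[set t | 0 < F i t < 1]); first by apply: measurable_indic; exact: measurable_interior.
  by apply/funext => t; rewrite indicE /b; congr (nat_of_bool _)%:R; apply/idP/idP; rewrite in_setE.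
have mbx : measurable_fun setT (fun x : 'rV[R]_d => b (x 0 i)).
  by apply: measurableT_comp => //; exact: measurable_coord.
have b1 : ae_eq P setT (fun=> 1) (fun x : 'rV[R]_d => b (x 0 i)).
  by apply: filterS (interior_ae Pc) => x /(_ i) x01 _; rewrite /b x01.
split.
  apply/(integrable_coord Pc i mb); apply: (@ae_eq_integrable _ _ _ P setT measurableT (fun=> 1)) => //.
  exact: finite_measure_integrable_cst.
rewrite /Rintegral -(expectation_coord Pc i mb).
transitivity (\int[P]_x (1 : R)); last exact: expectation_const.
by apply/esym/ae_eq_Rintegral.
Qed.

(* AM-GM: 2 c <= s c^2 / phi(S) + phi(S) / s; then integrate. *)
Let AB : 2 <= s * A + B / s.
Proof.
have [iG _] := transport_covariance Pc P2 nuN i; have [ib b1] := b_int.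
have i1 : mu.-integrable setT (fun t => (s * (w i t * c i t))%:E) by exact: integrable_realMl.
have i2 : mu.-integrable setT (fun t => (G i t / s)%:E) by exact: integrable_realMr.
have -> : 2 = \int[mu]_t (2 * (b t * c i t)) by rewrite RintegralZl// b1 mulr1.
rewrite -RintegralZl// -RintegralZr// -RintegralD//.
apply: le_Rintegral => //; [exact: integrable_realMl|exact: integrable_realD|].
move=> t _; have c0 : 0 <= c i t by case: pc.
have w0 := transport_density_ge0 Pc i t.
rewrite /transport_tail /b; case: ifP => t01; last first.
  by rewrite mul0r mulr0 mul0r addr0; apply: mulr_ge0; [exact: ltW|exact: mulr_ge0].
rewrite mul1r /transport_density; set f := phi _.
have f0 : 0 < f by exact: std_normal_pdf_gt0.
have -> : s * (c i t / f * c i t) + f / s = (s * c i t - f) ^+ 2 / (s * f) + 2 * c i t.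
  by field; rewrite !gt_eqF.
by rewrite lerDr divr_ge0 ?sqr_ge0// mulr_ge0// ltW.
Qed.

Let e (x : 'rV[R]_d) := (x 0 i - m - s * S i (x 0 i)) ^+ 2.

(** Since S_i(x_i) has mean 0 and variance 1, the expansion gives s^2 - 2 s B + s^2. This form of
    Cauchy-Schwarz keeps the equality case at hand: B = s forces e = 0 almost surely. *)
Let e_int : P.-integrable setT (fun x => (e x)%:E) /\ \int[P]_x e x = 2 * s * (s - B).
Proof.
have [_ cov] := transport_covariance Pc P2 nuN i.
have iS := transport_integrable Pc nuN i; have S0 := transport_mean Pc nuN i.
have iS2 := transport_sq_integrable Pc nuN i; have S2 := transport_second_moment Pc nuN i.
have ix : P.-integrable setT (fun x : 'rV[R]_d => ((x 0 i - m) ^+ 2)%:E).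
  apply/(integrable_coord Pc i (u := fun t => (t - m) ^+ 2)); last exact: variance_integrable.
  by apply: measurable_funX; exact: measurable_funB.
have ixS : P.-integrable setT (fun x : 'rV[R]_d => (x 0 i * S i (x 0 i))%:E).
  apply: integrable_mul_sq => //; first exact: measurable_coord.
  exact: measurable_integrable iS.
have i1 : P.-integrable setT (fun x : 'rV[R]_d => (2 * s * (x 0 i * S i (x 0 i)))%:E) by exact: integrable_realMl.
have i2 : P.-integrable setT (fun x : 'rV[R]_d => (2 * s * m * S i (x 0 i))%:E) by exact: integrable_realMl.
have i3 : P.-integrable setT (fun x : 'rV[R]_d => (s ^+ 2 * S i (x 0 i) ^+ 2)%:E) by exact: integrable_realMl.
have eE x : e x = (x 0 i - m) ^+ 2 - 2 * s * (x 0 i * S i (x 0 i)) +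
    (2 * s * m * S i (x 0 i) + s ^+ 2 * S i (x 0 i) ^+ 2) by rewrite /e; ring.
have i4 : P.-integrable setT (fun x : 'rV[R]_d => ((x 0 i - m) ^+ 2 - 2 * s * (x 0 i * S i (x 0 i)))%:E).
  exact: integrable_realB.
have i5 : P.-integrable setT (fun x : 'rV[R]_d => (2 * s * m * S i (x 0 i) + s ^+ 2 * S i (x 0 i) ^+ 2)%:E).
  exact: integrable_realD.
split; first by under eq_fun do rewrite eE; exact: integrable_realD.
under eq_Rintegral do rewrite eE.
rewrite RintegralD// RintegralB// RintegralD// !RintegralZl// S0 S2 cov -/B.
rewrite [X in X - _](_ : _ = s ^+ 2); last by rewrite s2.
by ring.
Qed.

Let e_ge0 : 0 <= \int[P]_x e x /\ (\int[P]_x e x = 0 -> {ae P, forall x, e x = 0}).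
Proof.
by apply: (ae_ge0_Rintegral e_int.1); apply: aeW => x; exact: sqr_ge0.
Qed.

Let Bs : B <= s.
Proof.
have := e_ge0.1; rewrite e_int.2 pmulr_rge0 ?mulr_gt0// subr_ge0//.
Qed.

Let sA : 1 <= s * A.
Proof.
have : B / s <= 1 by rewrite ler_pdivrMr// mul1r.
by have := AB; lra.
Qed.

Lemma normal_bound_ge : 1 <= variance P i * (A ^+ 2 / 1).
Proof. by rewrite divr1 -s2 -exprMn exprn_ege1. Qed.

(** s A = 1 in [AB] leaves B / s >= 1, hence B = s and the mean square distance e to an affine
    function of S_i has expectation 0. *)
Lemma normal_bound_eq : variance P i * (A ^+ 2 / 1) = 1 ->
  exists m s, 0 < s /\ {ae P, forall x : 'rV[R]_d, x 0 i = m + s * S i (x 0 i)}.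
Proof.
rewrite divr1 -s2 -exprMn => /eqP; rewrite sqrf_eq1 => /orP[/eqP sA1|/eqP sA1]; last by have := sA; lra.
exists m, s; split => //.
have sB : s = B.
  apply/eqP; rewrite eq_le Bs andbT.
  have : 1 <= B / s by have := AB; lra.
  by rewrite ler_pdivlMr// mul1r.
have /e_ge0.2 : \int[P]_x e x = 0 by rewrite e_int.2 -sB subrr mulr0.
by apply: filterS => x /eqP; rewrite sqrf_eq0 => /eqP; lra.
Qed.

(** The affine relation with r > 0 gives P(x_i > t) = P(S_i(x_i) > (t - a) / r), which determines
    F_i. The density is then recovered by differentiating F_i almost everywhere. *)
Lemma normal_of_affine a r : 0 < r -> {ae P, forall x : 'rV[R]_d, x 0 i = a + r * S i (x 0 i)} ->
  {ae mu, forall t, c i t = normal_pdf a r t}.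
Proof.
move=> r0 xE; have FE : F i = (fun t => pcdf phi ((t - a) / r)).
  apply/funext => t.
  have nuP := std_normal_product_law nuN; have p0 := is_pdf_normal (0 : R) 1.
  have mi (u : R) : measurable (`]u, +oo[%classic : set R) by [].
  have E1 : P [set x : 'rV[R]_d | `]t, +oo[%classic (x 0 i)] = (1 - F i t)%:E.
    apply: (etrans (product_law_coord Pc i (mi t))).
    by rewrite -(ccdf_pdf pc) /Rintegral fineK//; exact: (pdf_integral_fin_num Pc).
  have E2 : P [set x : 'rV[R]_d | `](t - a) / r, +oo[%classic (S i (x 0 i))] = (1 - pcdf phi ((t - a) / r))%:E.
    apply: (etrans (monotone_transport_law Pc nuP normal_quantileP i (mi _))).
    by rewrite -(ccdf_pdf p0) /Rintegral fineK//; exact: (pdf_integral_fin_num nuP i).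
  have : (1 - F i t)%:E = (1 - pcdf phi ((t - a) / r))%:E.
    rewrite -E1 -E2; apply: measure_ae_eq.
    - exact: (measurable_coord_preimage i (mi t)).
    - have := measurable_integrable (transport_integrable Pc nuN i).
      by move=> /(_ measurableT _ (mi ((t - a) / r))); rewrite setTI.
    - apply: filterS xE => x h; rewrite /= !in_itv/= !andbT [X in t < X]h ltr_pdivrMr// ltrBlDl [S i _ * r]mulrC.
      by split.
  by move=> [] /(congr1 (fun u => 1 - u)); rewrite !subKr.
have := pcdf_derive_ae pc; apply: filterS; first exact: (ae_filter_ringOfSetsType mu).
move=> t [_ <-]; rewrite FE derive1E.
exact: (@derive_val _ _ _ _ _ _ _ (normal_cdf_derive a t r0)).
Qed.

End normal_bound.

(** * The efficiency for normal scores *)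

Section normal_are.
Context {R : realType} {d : nat}.
Variables (nu : probability 'rV[R]_d R) (h : 'rV[R]_d).
Hypotheses (h0 : h != 0) (nuN : std_normal_law nu).
Let mu := (@lebesgue_measure R).
Let nuP := std_normal_product_law nuN.
Local Notation phi := (@normal_pdf R 0 1).

Lemma ARE_normal P c (eta : 'rV[R]_d -> 'rV[R]_d) : product_law P c -> second_moments P ->
  score_property P c eta ->
  (forall i j, P.-integrable setT (fun x => (eta x 0 j * (x : 'rV[R]_d) 0 i)%:E)) ->
  (forall i j, P.-integrable setT
    (fun x => (eta x 0 j * monotone_transport (c i) normal_quantile (x 0 i))%:E)) ->
  ARE nu id h P eta =
    ((\sum_i h 0 i ^+ 2 * ((\int[mu]_t (transport_density c i t * c i t)) ^+ 2 / 1)) /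
    (\sum_i h 0 i ^+ 2 / variance P i))%:E.
Proof.
move=> Pc P2 SP ix iS.
rewrite (@ARE_product _ _ P nu c id h eta Pc P2 1 (fun i => monotone_transport (c i) normal_quantile)
  (fun i => \int[mu]_t (transport_density c i t * c i t)))//.
- by congr (_%:E); congr (_ / _); apply: eq_bigr => i _; rewrite -mulrA.
- exact: covmx_std_normal.
- exact: score_measurable SP.
- move=> i; have [mT _ _] := rank_map_spec (coordinate_transport_rank_map Pc nuP normal_quantileP).
  exact: (measurableT_comp (measurable_coord i) mT).
- apply: filterS (rank_map_coordinate Pc nuP normal_quantileP P2 (std_normal_second_moments nuN)) => x -> i.
  by rewrite mxE.
- by move=> i j; split; [exact: iS|exact: (transport_score Pc nuN SP (iS i j)).2].
- by move=> i j; split; [exact: ix|exact: score_id Pc SP _ _ (ix i j)].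
Qed.

(** Equality constrains only the coordinates with h_i != 0: the others enter neither noncentrality
    parameter. *)
Lemma AREX_normal_regular (X : F_ind R d) : regular X ->
  (1 <= AREX nu id h X)%E /\
  (AREX nu id h X = 1%E -> forall i, h 0 i != 0 -> normal_component X i).
Proof.
move=> rX; have Pc := product_law_F_ind X; have SP := regular_score_property rX.
rewrite /AREX; have [fP|nfP] := pselect (finite_variances (law X)); last first.
  by rewrite /ARE; case: asboolP => // _; split => //; exact: leey.
have P2 := finite_variances_second_moments fP.
have iS i j : (law X).-integrable setT
    (fun x => (Defs.eta X x 0 j * monotone_transport (component_density X i) normal_quantile (x 0 i))%:E).
  apply: integrable_mul_sq; last exact: (transport_sq_integrable Pc nuN i).
  - exact: (score_measurable SP).
  - exact: measurable_integrable (transport_integrable Pc nuN i).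
  - apply/integrableP; split.
      by apply/measurable_EFinP; apply: measurable_funX; exact: (score_measurable SP).
    under eq_integral do rewrite /= ger0_norm ?sqr_ge0//.
    exact: score_component_square.
rewrite (ARE_normal Pc P2 SP (regular_score_integrable rX P2) iS).
have v0 i := variance_gt0 Pc i P2.
have iw i := (transport_score Pc nuN SP (iS i i)).1 erefl.
have ge i := normal_bound_ge Pc P2 nuN (iw i).
split; first by rewrite lee_fin; exact: ratio_ge v0 ge (exists_coord_neq0 h0).
move=> -[] /(ratio_eq v0 ge (exists_coord_neq0 h0)) H i hi.
have [m [s [s0 xE]]] := normal_bound_eq Pc P2 nuN (iw i) (H i hi).
by exists m, s; split => //; exact: (normal_of_affine Pc nuN s0 xE).
Qed.

Section normal_score.
Variable X : F_ind R d.
Local Notation c := (component_density X).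
Local Notation S i := (monotone_transport (c i) normal_quantile).
Hypotheses (sX : has_score X) (nX : forall i, normal_component X i).

Let Pc := product_law_F_ind X.
Let mc i : measurable_fun setT (c i). Proof. by case: (proj1 Pc i). Qed.

Let m i : R := projT1 (cid (nX i)).
Let s i : R := projT1 (cid (projT2 (cid (nX i)))).
Let s0 i : 0 < s i. Proof. exact: (proj1 (projT2 (cid (projT2 (cid (nX i)))))). Qed.
Let cE i : {ae mu, forall t, c i t = normal_pdf (m i) (s i) t}.
Proof. exact: (proj2 (projT2 (cid (projT2 (cid (nX i)))))). Qed.

Let FE i t : pcdf (c i) t = pcdf phi ((t - m i) / s i).
Proof.
rewrite -normal_cdfE// /pcdf; apply: ae_eq_Rintegral => //.
- exact: measurable_funTS (mc i).
- exact: measurable_funTS (measurable_normal_pdf _ _).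
- by have := cE i; apply: filterS; [exact: (ae_filter_ringOfSetsType mu)|move=> u -> _].
Qed.

Let SE i t : S i t = (t - m i) / s i.
Proof. by rewrite /monotone_transport FE std_normal_cdf_01 normal_cdfK. Qed.

Let xE i (x : 'rV[R]_d) : x 0 i = m i + s i * S i (x 0 i).
Proof. by rewrite SE; field; rewrite gt_eqF. Qed.

Let psi i t := (t - m i) / s i ^+ 2.

Let psiE i t : psi i t = (s i)^-1 * S i t.
Proof. by rewrite SE /psi; field; rewrite gt_eqF. Qed.

Let etaE i : {ae law X, forall x, Defs.eta X x 0 i = psi i (x 0 i)}.
Proof. by apply: (classical_score (cE i) sX); apply: aeW => x; exact: normal_pdf_derive. Qed.

Let meta i : measurable_fun setT (fun x => Defs.eta X x 0 i).
Proof. exact: (measurableT_comp (measurable_coord i) (proj1 sX)). Qed.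

Let mpsi i : measurable_fun setT (psi i).
Proof. by apply: measurable_funM => //; exact: measurable_funB. Qed.

Let iS i := transport_integrable Pc nuN i.
Let S0 i : \int[law X]_x S i (x 0 i) = 0 := transport_mean Pc nuN i.
Let iS2 i := transport_sq_integrable Pc nuN i.

Let ipsiP i : (law X).-integrable setT (fun x => (psi i (x 0 i))%:E).
Proof. by under eq_fun do rewrite psiE; apply: integrable_realMl => //; exact: iS. Qed.

Let ipsi i : mu.-integrable setT (fun t => (psi i t * c i t)%:E).
Proof. by apply/(integrable_coord Pc i (mpsi i)). Qed.

Let psi0 i : \int[mu]_t (psi i t * c i t) = 0.
Proof.
rewrite /Rintegral -(expectation_coord Pc i (mpsi i)).
transitivity (\int[law X]_x ((s i)^-1 * S i (x 0 i))).
  by apply: eq_Rintegral => x _; rewrite psiE.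
by rewrite RintegralZl ?S0 ?mulr0//; last exact: iS.
Qed.

(** The score is S_i / s_i, so its tail expectation is phi(S_i a) / s_i by [transport_tailE], and
    this is the normal density itself. *)
Let psi_tail i : {ae mu, forall a, \int[mu]_t (psi i t * (a < t)%R%:R * c i t) = c i a}.
Proof.
have := cE i; apply: filterS; first exact: (ae_filter_ringOfSetsType mu).
move=> a ->; rewrite normal_pdf_scale// -SE.
have mpa : measurable_fun setT (fun t : R => psi i t * (a < t)%R%:R).
  by apply: measurable_funM; [exact: mpsi|exact: measurable_ltR].
have mI : measurable_fun setT (fun x : 'rV[R]_d => (a < x 0 i)%R%:R : R).
  by apply: measurable_ltR => //; exact: measurable_coord.
rewrite /Rintegral -(expectation_coord Pc i mpa).
transitivity (\int[law X]_x ((s i)^-1 * (S i (x 0 i) * (a < x 0 i)%R%:R))).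
  by apply: eq_Rintegral => x _; rewrite psiE mulrA.
rewrite RintegralZl//; last by apply: integrable_mul_ind => //; exact: iS.
rewrite (transport_tailE Pc nuN) /transport_tail mulrC.
by rewrite FE std_normal_cdf_01.
Qed.

Let SP := separable_score_property Pc meta mpsi etaE ipsi psi0 psi_tail.

Let P2 : second_moments (law X).
Proof.
move=> i; apply: (@eq_integrable _ _ _ (law X) setT measurableT
  (fun x => (m i ^+ 2 + (2 * m i * s i * S i (x 0 i) + s i ^+ 2 * S i (x 0 i) ^+ 2))%:E)).
  by move=> x _; congr EFin; rewrite [in RHS]xE; ring.
apply: integrable_realD => //; first exact: finite_measure_integrable_cst.
by apply: integrable_realD => //; apply: integrable_realMl => //; exact: iS.
Qed.

Let mean i : \int[law X]_x x 0 i = m i.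
Proof.
transitivity (\int[law X]_x (m i + s i * S i (x 0 i))).
  by apply: eq_Rintegral => x _; exact: xE.
rewrite RintegralD//; [|exact: finite_measure_integrable_cst|by apply: integrable_realMl => //; exact: iS].
by rewrite expectation_const RintegralZl ?S0 ?mulr0 ?addr0//; exact: iS.
Qed.

Let var i : variance (law X) i = s i ^+ 2.
Proof.
rewrite /variance mean.
transitivity (\int[law X]_x (s i ^+ 2 * S i (x 0 i) ^+ 2)).
  by apply: eq_Rintegral => x _; rewrite [in LHS]xE; ring.
by rewrite RintegralZl//; [rewrite (transport_second_moment Pc nuN i) mulr1|exact: iS2].
Qed.

(** S_i is affine of slope 1 / s_i, so [transport_density] is almost everywhere this constant. *)
Let wc i : \int[mu]_t (transport_density c i t * c i t) = (s i)^-1.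
Proof.
have -> : (s i)^-1 = \int[mu]_t ((s i)^-1 * c i t).
  rewrite RintegralZl//; last exact: (integrable_pdf (proj1 Pc i) measurableT).
  by rewrite [X in _ * X](_ : _ = 1) ?mulr1// /Rintegral; case: (proj1 Pc i) => _ _ ->.
apply: (@ae_eq_Rintegral _ _ _ mu setT measurableT).
- by apply: measurable_funM; [exact: (measurable_transport_density Pc)|exact: mc].
- by apply: measurable_funM => //; exact: mc.
- have := cE i; apply: filterS; first exact: (ae_filter_ringOfSetsType mu).
  move=> t ct _; rewrite /transport_density ct normal_pdf_scale// -SE.
  by field; rewrite !gt_eqF// std_normal_pdf_gt0.
Qed.

Let integrable_psi_linear j a b :
  mu.-integrable setT (fun t => (psi j t * ((t - a) / b) * c j t)%:E).
Proof.
have mU : measurable_fun setT (fun t : R => psi j t * ((t - a) / b)).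
  by apply: measurable_funM; [exact: mpsi|apply: measurable_funM => //; exact: measurable_funB].
apply/(integrable_coord Pc j mU).
apply: (@eq_integrable _ _ _ (law X) setT measurableT
  (fun x => ((s j)^-1 * b^-1 * (s j * S j (x 0 j) ^+ 2 + (m j - a) * S j (x 0 j)))%:E)).
  move=> x _; congr EFin; rewrite psiE; have := xE j x; set u := S j _ => ->.
  by ring.
apply: integrable_realMl => //.
by apply: integrable_realD => //; apply: integrable_realMl => //; exact: iS.
Qed.

Lemma AREX_normal : AREX nu id h X = 1%E.
Proof.
rewrite /AREX (ARE_normal Pc P2 SP).
- congr EFin; apply: ratio_const.
  + by move=> i; exact: (variance_gt0 Pc i P2).
  + by move=> i; rewrite var wc divr1 exprVn divff// expf_neq0// gt_eqF.
  + exact: exists_coord_neq0.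
- move=> i j; apply: (separable_integrable Pc meta mpsi etaE ipsi (u := fun t => t)) => //.
    exact: (mean_integrable P2).
  by have := integrable_psi_linear j 0 1; under eq_fun do rewrite subr0 divr1.
- move=> i j; apply: (separable_integrable Pc meta mpsi etaE ipsi) => //.
  + exact: (measurable_monotone_transport (proj1 Pc i) normal_quantileP).
  + by under eq_fun do rewrite SE; exact: integrable_psi_linear.
Qed.

End normal_score.
End normal_are.

Theorem theorem3p4 (R : realType) (d : nat) (h : 'rV[R]_d) (h_neq0 : h != 0)
    (lambda : R) (lambda01 : 0 < lambda < 1)
    (m n : nat -> nat) (mn : forall N, (m N + n N)%N = N)
    (m_lambda : (fun N => (m N)%:R / N%:R : R) @ \oo --> lambda)
    (nu : probability 'rV[R]_d R) (J : 'rV[R]_d -> 'rV[R]_d)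
    (hd : forall N : nat, 'I_N -> 'rV[R]_d)
    (hd_nu : weak_cvg_to hd nu)
    (hd_J : (limn_esup (fun N =>
               (N%:R^-1 * \sum_(i < N) sqnorm (J (hd N i)))%:E)
             <= \int[nu]_z (sqnorm (J z))%:E)%E) :
  ((std_normal_law nu /\ J = normal_cdf_score) \/
   (uniform_law nu /\ J = id) ->
   [/\ ((108 / 125)%:E <= ereal_inf [set AREX nu J h X | X in regular])%E,
       forall X : F_ind R d, regular X ->
         (AREX nu J h X = (108 / 125)%:E <->
          forall i, epanechnikov_component X i) &
       forall X : F_ind R d, has_score X ->
         (forall i, epanechnikov_component X i) ->
         AREX nu J h X = (108 / 125)%:E])
  /\
  (std_normal_law nu /\ J = id ->
   [/\ (1 <= ereal_inf [set AREX nu J h X | X in regular])%E,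
       forall X : F_ind R d, regular X -> AREX nu J h X = 1%E ->
         forall i, h 0 i != 0 -> normal_component X i &
       forall X : F_ind R d, has_score X ->
         (forall i, normal_component X i) ->
         AREX nu J h X = 1%E]).
Proof.
split.
- move=> nuJ.
  have uJ : uniform_scores nu J.
    case: nuJ => -[nuL ->]; [exact: uniform_scores_normal_cdf|exact: uniform_scores_id].
  split.
  + by apply: le_ereal_inf_tmp => _ [X rX <-]; exact: (AREX_uniform_regular h_neq0 uJ rX).1.
  + move=> X rX; split => [/(AREX_uniform_regular h_neq0 uJ rX).2 [i eX]|eX].
      by case: (regular_not_epanechnikov rX eX).
    (* h != 0 provides a coordinate; in dimension 0 the condition on the components would be
       vacuous. *)
    have [i _] := exists_coord_neq0 h_neq0.
    by case: (regular_not_epanechnikov rX (eX i)).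
  + by move=> X sX eX; exact: (AREX_epanechnikov h_neq0 uJ sX eX).
- move=> [nuN ->]; split.
  + by apply: le_ereal_inf_tmp => _ [X rX <-]; exact: (AREX_normal_regular h_neq0 nuN rX).1.
  + by move=> X rX; exact: (AREX_normal_regular h_neq0 nuN rX).2.
  + by move=> X sX nX; exact: AREX_normal.
Qed.
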